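(* Let $\Gamma_1$ be the laplacian of the Lie algebra $L_1$. (1) In the basis $\{e_{(I;J)}\}$ of $C_*(L_1)$ consisting of the nonsingular $\tau(1)$-monomials the action of $\Gamma_1$ is expressed by the formula $$\Gamma_1(e_{(I;J)})=E(I)\,e_{(I;J)}+\sum_{(I';J')\triangleleft(I;J)}\lambda_{(I';J')}\,e_{(I';J')},$$ where $$E(I)=E(i_1,\dots,i_q)=\sum_{a=1}^q\binom{i_a}{3}-\sum_{1\leq a<b\leq q}i_ai_b .$$ (2) Each eigenvector of $\Gamma_1$ with eigenvalue $E(I)$ may uniquely be presented in the form $$\widetilde e_{(I;J)}=e_{(I;J)}+\sum_{(I';J')\triangleleft(I;J)}\lambda_{(I';J')}\,e_{(I';J')},$$ where the sum runs over the set of nonsingular $\tau(1)$-monomials. (3) To each nonsingular $1$-partition $I$ of degree $n$ corresponds an eigenspace of the restriction of $\Gamma_1$ to $C_*^{(n)}(L_1)$ with eigenvalue $E(I)$. The dimension of this space equals $2^{\alpha_1(I)}$. Thus the spectrum of $\Gamma_1$ on $C_*(L_1)$ coincides with the set of numbers $E(I)$, where $I$ runs over the set of nonsingular $1$-partitions. (4) The multiplicity of each nonzero eigenvalue of $\Gamma_1$ is finite. (5) The $q$-dimensional harmonic chains of the algebra $L_1$ are exhausted by the vectors $\widetilde e_{I(r,q)}$, where $I(r,q)=(r,r+3,\dots,r+3(q-1))$, $r=1,2$ (the main $q$-dimensional $1$-partitions).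
   Context: Algebra and complex. Everything is over $\mathbb{Q}$. $L_1$ is the Lie algebra with basis $e_i$, $i\geq1$, and bracket $[e_a,e_b]=(b-a)e_{a+b}$. $C_q(L_1)=\bigwedge^qL_1$ has the basis of monomials $e_{i_1}\wedge\dots\wedge e_{i_q}$, $1\leq i_1<\dots<i_q$, of degree $i_1+\dots+i_q$; $C_*^{(n)}(L_1)$ is the span of those of degree $n$. The boundary operator is $d(e_{i_1}\wedge\dots\wedge e_{i_q})=\sum_{r<s}(-1)^{r+s-1}(i_s-i_r)\,e_{i_r+i_s}\wedge e_{i_1}\wedge\dots\widehat{e}_{i_r}\dots\widehat{e}_{i_s}\dots\wedge e_{i_q}$. The inner product makes the monomials orthonormal, and chains are identified with cochains by means of it; $\delta_1$ is the adjoint of $d$, so that $\delta_1(e_i)=\sum_{a+b=i,\,1\leq a<b}(b-a)\,e_a\wedge e_b$ and $\delta_1(e_{i_1}\wedge\dots\wedge e_{i_q})=\sum_s(-1)^{s-1}e_{i_1}\wedge\dots\wedge\delta_1(e_{i_s})\wedge\dots\wedge e_{i_q}$. The laplacian is $\Gamma_1=d\delta_1+\delta_1d$. A harmonic chain is a chain in the zero eigenspace of $\Gamma_1$. Partitions. A $1$-partition is an integer vector $I=(i_1,\dots,i_q)$ with $1\leq i_1\leq\dots\leq i_q$; $\dim I=q$ is its dimension and $|I|=i_1+\dots+i_q$ its degree. It is strict if $i_1<\dots<i_q$, and nonsingular if $i_{r+1}-i_r\geq3$ for all $r$. The union of partitions is the partition whose parts are all their parts in nondecreasing order. The main $q$-dimensional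 $1$-partitions are $I(r,q)=(r,r+3,\dots,r+3(q-1))$, $r=1,2$; the empty partition is also allowed as a main one. A $1$-partition is dense if $i_1>2$ and $i_{r+1}-i_r=3$ for all $r$. The normal form of a nonsingular $1$-partition $I$ is its unique representation $I=I_0\cup I_1\cup\dots\cup I_m$, where $I_0$ is main and $I_1,\dots,I_m$ are dense, each of the maximal possible dimension. The minimal parts of $I_1,\dots,I_m$ are the leading parts of $I$, and $\alpha_1(I)$ is the number of leading parts (for instance $\alpha_1(2,6,9)=1$). Distinguished partitions. A distinguished $1$-partition is a pair $(I;J)$, where $I$ is a $1$-partition, $J\subset I$, and $I\setminus J$ is strict; the elements of $J$ are its distinguished parts. Its degree is $|I|$ and its dimension is $\dim I+\dim J$. A strict $I$ is identified with $(I;\emptyset)$. $(I;J)$ is nonsingular if $I$ is nonsingular and $J$ is a subset of the leading parts of $I$. The $\tau(1)$-monomial of $(I;J)$, $I=(i_1,\dots,i_q)$, is $e_{(I;J)}=\tau_{i_1}\wedge\dots\wedge\tau_{i_q}$, where $\tau_{i_r}=e_{i_r}$ if $i_r\notin J$ and $\tau_{i_r}=\delta_1(e_{i_r})$ if $i_r\in J$; it is nonsingular if $(I;J)$ is. The nonsingular $\tau(1)$-monomials of degree $n$ form a basis of $C_*^{(n)}(L_1)$. $\widetilde e_I$ means $\widetilde e_{(I;\emptyset)}$. Order. For two non-distinguished parts $i_a,i_b$ ($a<b$) of $I$, $S_{a,b}(I;J)$ is obtained by removing $i_a,i_b$ from $I$ and adding the part $i_a+i_b$ both to $I$ and to $J$.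 For distinct distinguished $1$-partitions of equal degree and equal dimension, the partial order $\triangleleft$ is given by $(I';J')\triangleleft(I;J)$ in the following cases: (i) $I=I'$ and $J'$ is lexicographically smaller than $J$; (ii) $I\neq I'$, $\dim I=\dim I'=q$, and $i'_1+\dots+i'_r\leq i_1+\dots+i_r$ for $r=1,\dots,q-1$; (iii) $\dim I'<\dim I$ and $(I';J')$ is obtained from $(I;J)$ by a finite sequence of operations $S_{a,b}$.
   Formalization: The order ◁ is the transitive closure of (i)–(iii). As distinct I can share E(I), the eigenspace of I is the eigenvectors on e_(I;J) and lower terms; (2) is for its nonzero vectors of one dimension, up to a scalar; the full eigenspace in degree n is shown to be their direct sum. *)

(* Defs.v *)
From HB Require Import structures.
From mathcomp Require Import all_boot all_order all_algebra.
From mathcomp Require Import finmap.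
From mathcomp.multinomials Require Import monalg.
From Stdlib Require Import Relation_Operators.

Set Implicit Arguments.
Unset Strict Implicit.
Unset Printing Implicit Defensive.

Import GRing.Theory.
Local Open Scope ring_scope.

(* A 1-partition is the nondecreasing sequence of its parts; its dimension is
   [size I] and its degree is [sumn I]. *)
Definition partition1 (I : seq nat) : bool :=
  sorted leq I && all (ltn 0) I.

Definition strict1 (I : seq nat) : bool :=
  sorted ltn I && all (ltn 0) I.

Definition nonsingular1 (I : seq nat) : bool :=
  partition1 I && sorted (fun a b => (a + 3 <= b)%N) I.

Definition main_part (r q : nat) : seq nat := [seq (r + 3 * k)%N | k <- iota 0 q].

Definition is_main (I : seq nat) : bool :=
  (I == main_part 1 (size I)) || (I == main_part 2 (size I)).

(* The default value 0 of [head] makes a dense partition nonempty. *)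
Definition is_dense (I : seq nat) : bool :=
  (2 < head 0 I)%N && sorted (fun a b => b == (a + 3)%N) I.

(* [blocks I] cuts [I] into its maximal runs of consecutive parts with all
   gaps equal to 3. *)
Fixpoint blocks (I : seq nat) : seq (seq nat) :=
  if I is i :: I' then
    match blocks I' with
    | (j :: B) :: Bs =>
        if j == (i + 3)%N then (i :: j :: B) :: Bs
        else [:: i] :: (j :: B) :: Bs
    | Bs => [:: i] :: Bs
    end
  else [::].

(* The pair (I_0, [:: I_1; ...; I_m]). A maximal run is main iff it starts with
   1 or 2, and in a nonsingular 1-partition only the first run can be main; see
   [normal_formP]. *)
Definition normal_form (I : seq nat) : seq nat * seq (seq nat) :=
  if (head 0 I <= 2)%N then (head [::] (blocks I), behead (blocks I))
  else ([::], blocks I).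

Lemma blocksP (I : seq nat) : nonsingular1 I ->
  [/\ flatten (blocks I) = I,
      all (fun B => (B != [::]) && sorted (fun a b => b == (a + 3)%N) B) (blocks I)
    & sorted (fun B B' => last 0 B + 3 < head 0 B')%N (blocks I)].
Proof.
elim: I => [|i I IH] //= /andP[/andP[/= pI /andP[_ aI]] gI].
have /IH[fI bI sI] : nonsingular1 I.
  by rewrite /nonsingular1 /partition1 aI (path_sorted pI) (path_sorted gI).
case: (blocks I) fI bI sI => [|[|j B] Bs] //= fI; first by rewrite -fI.
move=> /andP[gB bBs] sB; move: gI; rewrite -fI /= => /andP[gij _].
case: eqP => [ej|/eqP nej] /=; rewrite ?fI; split=> //.
- by rewrite ej eqxx -ej gB.
- by case: Bs sB {bBs fI}.
- by rewrite gB.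
- by rewrite sB andbT ltn_neqAle gij eq_sym nej.
Qed.

Lemma sorted_main (r : nat) (I : seq nat) :
  sorted (fun a b => b == (a + 3)%N) (r :: I) -> r :: I = main_part r (size I).+1.
Proof.
rewrite /main_part; move=> pI; apply: (@eq_from_nth _ 0) => [|k].
  by rewrite size_map size_iota.
move=> ltk; rewrite (nth_map 0) ?size_iota // nth_iota // add0n.
elim: k ltk => [|k IHk] ltk; first by rewrite muln0 addn0.
move/(pathP 0)/(_ k ltk)/eqP: pI => /= ->.
by rewrite -[nth 0 (r :: I) k]/(nth 0 (r :: I) k) IHk ?(ltnW ltk) // mulnS addnA addnAC.
Qed.

Lemma normal_formP (I : seq nat) : nonsingular1 I ->
  let: (I0, Is) := normal_form I in
  [/\ I0 ++ flatten Is = I, is_main I0, all is_dense Is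
    & sorted (fun B B' => last 0 B + 3 < head 0 B')%N
        (if I0 is [::] then Is else I0 :: Is)].
Proof.
move=> nI; have [fI bI sI] := blocksP nI; rewrite /normal_form.
have aI : all (ltn 0) I by case/andP: nI => /andP[].
have dense_tail B Bs : (0 < head 0 B)%N ->
    all (fun B => (B != [::]) && sorted (fun a b => b == (a + 3)%N) B) Bs ->
    (B != [::]) -> sorted (fun a b => b == (a + 3)%N) B ->
    path (fun B B' => last 0 B + 3 < head 0 B')%N B Bs -> all is_dense Bs.
  elim: Bs B => //= C Bs IHBs B _ /andP[/andP[C0 gC] bBs] _ _ /andP[lBC pC].
  have ltC : (2 < head 0 C)%N.
    by apply: leq_ltn_trans lBC; rewrite (leq_trans _ (leq_addl _ _)).
  by rewrite /is_dense ltC gC (IHBs C) // (leq_trans _ ltC).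
case: ifP => [le2|/negbT]; last rewrite -ltnNge => lt2.
  case: (blocks I) fI bI sI => [|B Bs] /= fI; first by rewrite -fI.
  move=> /andP[/andP[B0 gB] bBs] sB; rewrite fI.
  case: B B0 gB fI sB => [|i B] //= _ gB fI sB.
  move: le2 aI; rewrite -fI /= => le2 /andP[i_gt0 _]; split=> //.
    rewrite /is_main /= (sorted_main gB).
    by case: i i_gt0 le2 {gB sB fI} => [|[|[|]]] // _ _; rewrite eqxx ?orbT.
  by apply: (dense_tail (i :: B)).
split=> //; case: (blocks I) fI bI sI => [|B Bs] //= fI /andP[/andP[B0 gB] bBs] sB.
have ltB : (2 < head 0 B)%N by case: B B0 fI {gB sB} lt2 => //= i B _ <-.
by rewrite /is_dense ltB gB (dense_tail B) // (leq_trans _ ltB).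
Qed.

Definition leading_parts (I : seq nat) : seq nat :=
  [seq head 0%N B | B <- (normal_form I).2].

Definition alpha1 (I : seq nat) : nat := size (leading_parts I).

(* A strict 1-partition of degree n is a subsequence of 1, ..., n. *)
Definition strict_part : Type := {I : seq nat | strict1 I}.
HB.instance Definition _ := Choice.on strict_part.

Definition strict_parts (n : nat) : seq strict_part :=
  [seq K <- pmap insub [seq mask m (iota 1 n) | m : n.-tuple bool]
  | sumn (val K) == n].

Definition nonsingular_parts (n : nat) : seq (seq nat) :=
  [seq I <- [seq val K | K <- strict_parts n] | nonsingular1 I].

Lemma mem_strict_parts (n : nat) (K : strict_part) :
  (K \in strict_parts n) = (sumn (val K) == n).
Proof.
rewrite mem_filter andb_idr // => /eqP sK; rewrite mem_pmap_sub /=.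
case: K sK => K /= /andP[sK pK] sumK.
have le_sum (L : seq nat) i : i \in L -> (i <= sumn L)%N.
  elim: L => //= j L IHL; rewrite inE => /predU1P[->|/IHL]; first exact: leq_addr.
  by move=> /leq_trans -> //; apply: leq_addl.
have sub : subseq K (iota 1 n).
  rewrite (_ : K = [seq i <- iota 1 n | i \in K]) ?filter_subseq //.
  apply: (irr_sorted_eq ltn_trans ltnn) => // [|i].
    exact: (sorted_filter ltn_trans _ (iota_ltn_sorted 1 n)).
  rewrite mem_filter mem_iota andb_idr // => iK.
  by rewrite add1n ltnS -sumK le_sum // andbT; apply: (allP pK).
have /subseqP[m sm ->] := sub.
have sz : size m == n by rewrite sm size_iota.
by apply/imageP; exists (Tuple sz).
Qed.

Lemma strict_parts_uniq (n : nat) : uniq (strict_parts n).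
Proof.
apply/filter_uniq/(pmap_uniq (@insubK _ _ _)).
rewrite map_inj_in_uniq ?enum_uniq // => m m' _ _ eqm; apply/val_inj/eqP => /=.
apply/eqP/(@eq_from_nth _ false); rewrite ?size_tuple // => i lti.
have := in_mask (i.+1) m (iota_uniq 1 n).
rewrite eqm (in_mask _ m' (iota_uniq 1 n)).
have iI : i.+1 \in iota 1 n by rewrite mem_iota /= add1n ltnS.
have -> : index i.+1 (iota 1 n) = i.
  by rewrite -[in LHS](add1n i) -(nth_iota 1 1 lti) index_uniq ?size_iota ?iota_uniq.
by rewrite iI.
Qed.

Lemma mem_nonsingular_parts (n : nat) (I : seq nat) :
  (I \in nonsingular_parts n) = nonsingular1 I && (sumn I == n).
Proof.
rewrite mem_filter; apply: andb_id2l => /andP[/andP[_ aI] gI].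
have sI : strict1 I.
  rewrite /strict1 aI andbT; apply: sub_sorted gI => a b /=.
  by apply: leq_trans; rewrite -[X in (X <= _)%N]addn1 leq_add2l.
apply/mapP/idP => [[K]|sumI]; first by rewrite mem_strict_parts => sK ->.
by exists (Sub I sI); rewrite ?mem_strict_parts ?SubK.
Qed.

(* C_*(L_1), the rational vector space on the monomials
   e_{i_1} ^ ... ^ e_{i_q}, 1 <= i_1 < ... < i_q. *)
Notation chain := {malg rat[strict_part]}.

Definition linext (K : choiceType) (f : K -> chain) (x : {malg rat[K]}) : chain :=
  \sum_(k <- msupp x) x@_k *: f k.

Definition inversions (s : seq nat) : nat :=
  (\sum_(j < size s) \sum_(i < j) (nth 0 s j < nth 0 s i))%N.

(* e_{s_1} ^ ... ^ e_{s_q} for an arbitrary sequence s of indices: it vanishes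
   when an index is repeated, and is alternating in the indices. *)
Definition mono (s : seq nat) : chain :=
  if insub (sort leq s) is Some K then (-1) ^+ inversions s *: << K >> else 0.

Definition wedge (x y : chain) : chain :=
  linext (fun K : strict_part =>
    linext (fun K' : strict_part => mono (val K ++ val K')) y) x.

(* Positions are counted from 0, hence the exponent r + s + 1 in place of
   r + s - 1. *)
Definition bd_mono (I : seq nat) : chain :=
  \sum_(s < size I) \sum_(r < s)
    (-1) ^+ (r + s).+1 *
      ((nth 0%N I s)%:R - (nth 0%N I r)%:R) *:
      mono ((nth 0 I r + nth 0 I s)%N ::
            take r I ++ drop r.+1 (take s I) ++ drop s.+1 I).

Definition bd : chain -> chain := linext (fun K : strict_part => bd_mono (val K)).

Definition inner (x y : chain) : rat := \sum_(K <- msupp x) x@_K * y@_K.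

(* The adjoint of [bd]; the sum is over the monomials of the degree of K
   because [bd] preserves the degree. See [delta1_adjoint]. *)
Definition delta1 : chain -> chain :=
  linext (fun K : strict_part =>
    \sum_(I <- strict_parts (sumn (val K)))
      inner (bd << I >>) << K >> *: << I >>).

Lemma mcoeff_linext (K : choiceType) (f : K -> chain) x L :
  (linext f x)@_L = \sum_(k <- msupp x) x@_k * (f k)@_L.
Proof. by rewrite raddf_sum; apply: eq_bigr => k _ /=; rewrite mcoeffZ. Qed.

Lemma linextU (K : choiceType) (f : K -> chain) k : linext f << k >> = f k.
Proof. by rewrite /linext msuppU oner_eq0 big_seq_fset1 mcoeffUU scale1r. Qed.

Lemma innerC x y : inner x y = inner y x.
Proof.
rewrite /inner (big_fset_incl _ (fsubsetUl (msupp x) (msupp y))) => [|K _ /mcoeff_outdom->].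
  rewrite [RHS](big_fset_incl _ (fsubsetUr (msupp x) (msupp y))) => [|K _ /mcoeff_outdom->].
    by apply: eq_bigr => K _; rewrite mulrC.
  by rewrite mul0r.
by rewrite mul0r.
Qed.

Lemma innerU x K : inner x << K >> = x@_K.
Proof. by rewrite innerC /inner msuppU oner_eq0 big_seq_fset1 mcoeffUU mul1r. Qed.

Lemma mono_degree s K : (mono s)@_K != 0 -> sumn (val K) = sumn s.
Proof.
rewrite /mono; case: insubP => [L _ sL|]; last by rewrite mcoeff0 eqxx.
rewrite mcoeffZ mcoeffU; case: (L =P K) => [<- _|_]; last by rewrite mulr0 eqxx.
by rewrite sL; apply/perm_sumn; rewrite perm_sort.
Qed.

Lemma bd_mono_degree I K : (bd_mono I)@_K != 0 -> sumn (val K) = sumn I.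
Proof.
have [//|neK] := eqVneq (sumn (val K)) (sumn I); case/eqP.
rewrite raddf_sum big1 // => s _; rewrite raddf_sum big1 // => r _ /=.
rewrite mcoeffZ; set m := mono _; have [->|] := eqVneq (m@_K) 0; first by rewrite mulr0.
move=> /mono_degree sK; case/eqP: neK; rewrite {}sK /= !sumn_cat.
have /= lts := ltn_ord s; have ltr := ltn_ord r.
have ltrs : (r < size (take s I))%N by rewrite size_takel ?(ltnW lts).
rewrite -[in RHS](cat_take_drop s I) (drop_nth 0 lts) sumn_cat /=.
rewrite -[in RHS](cat_take_drop r (take s I)) (drop_nth 0 ltrs) sumn_cat /=.
rewrite nth_take // take_takel ?(ltnW ltr) //.
by rewrite [LHS](AC (2*(1*2)) ((3*(1*4))*(2*5))).
Qed.

Lemma delta1_adjoint x y : inner (bd x) y = inner x (delta1 y).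
Proof.
have delta1E K k : (\sum_(I <- strict_parts (sumn (val K)))
      inner (bd << I >>) << K >> *: << I >> : chain)@_k = (bd_mono (val k))@_K.
  rewrite raddf_sum /=.
  under eq_bigr do rewrite mcoeffZ innerU /bd linextU mcoeffU.
  have [kK|] := boolP (k \in strict_parts (sumn (val K))).
    rewrite (bigD1_seq k) ?strict_parts_uniq //= eqxx /= mulr1 big1 ?addr0 // => I.
    by move=> /negPf->; rewrite mulr0.
  rewrite mem_strict_parts => neK; rewrite big_seq big1 => [|I].
    by apply/esym/eqP; apply: contraNT neK => /bd_mono_degree->.
  rewrite mem_strict_parts => /eqP sI; case: (I =P k) => [eIk|_]; last by rewrite mulr0.
  by rewrite -eIk sI eqxx in neK.
rewrite innerC /inner; under eq_bigr do rewrite mcoeff_linext mulr_sumr.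
rewrite exchange_big; apply: eq_bigr => k _ /=.
rewrite mcoeff_linext mulr_sumr; apply: eq_bigr => K _.
by rewrite delta1E mulrCA.
Qed.

Definition Gamma1 (x : chain) : chain := bd (delta1 x) + delta1 (bd x).

Definition has_degree (n : nat) (x : chain) : Prop :=
  forall K, K \in msupp x -> sumn (val K) = n.

Definition has_dim (q : nat) (x : chain) : Prop :=
  forall K, K \in msupp x -> size (val K) = q.

(* The set of chains [P] is a subspace of finite dimension [m]. *)
Definition subspace_dim (P : chain -> Prop) (m : nat) : Prop :=
  exists b : 'I_m -> chain,
    (forall c : 'I_m -> rat, \sum_i c i *: b i = 0 -> forall i, c i = 0) /\
    (forall x, P x <-> exists c : 'I_m -> rat, x = \sum_i c i *: b i).

Definition msdiff (I J : seq nat) : seq nat := foldr (@rem nat) I J.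

(* For nondecreasing sequences, [subseq] is inclusion of multisets. *)
Definition distinguished (p : seq nat * seq nat) : bool :=
  [&& partition1 p.1, subseq p.2 p.1 & strict1 (msdiff p.1 p.2)].

Definition dp_degree (p : seq nat * seq nat) : nat := sumn p.1.
Definition dp_dim (p : seq nat * seq nat) : nat := (size p.1 + size p.2)%N.

Definition nonsingular_dp (p : seq nat * seq nat) : bool :=
  nonsingular1 p.1 && subseq p.2 (leading_parts p.1).

Definition ns_dpart : Type := {p : seq nat * seq nat | nonsingular_dp p}.
HB.instance Definition _ := Choice.on ns_dpart.

Definition tau_mono (p : seq nat * seq nat) : chain :=
  \big[wedge/mono [::]]_(i <- p.1)
    (if i \in p.2 then delta1 (mono [:: i]) else mono [:: i]).

Definition tau_comb : {malg rat[ns_dpart]} -> chain :=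
  linext (fun p : ns_dpart => tau_mono (val p)).

(* p' = S_{a,b}(p), with x and y the values of the parts i_a and i_b. *)
Definition S_step (p p' : seq nat * seq nat) : Prop :=
  exists x y : nat,
    [/\ x \in msdiff p.1 p.2, y \in msdiff p.1 p.2, (x < y)%N &
        p' = (sort leq ((x + y)%N :: rem x (rem y p.1)),
              sort leq ((x + y)%N :: p.2))].

Definition prec_case (p' p : seq nat * seq nat) : Prop :=
  [/\ distinguished p' && distinguished p, p' <> p,
      dp_degree p' = dp_degree p, dp_dim p' = dp_dim p &
      [\/ p'.1 = p.1 /\ ((p'.2 : seqlexi nat) < p.2)%O,
          [/\ p'.1 <> p.1, size p'.1 = size p.1 &
              forall r : nat, (0 < r < size p.1)%N ->
                (sumn (take r p'.1) <= sumn (take r p.1))%N]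
        | (size p'.1 < size p.1)%N /\ clos_refl_trans _ S_step p p']].

(* The relation [prec_case] is not transitive: the partial order is the one it
   generates. *)
Definition prec : seq nat * seq nat -> seq nat * seq nat -> Prop :=
  clos_trans _ prec_case.

Definition energy (I : seq nat) : rat :=
  \sum_(a < size I) ('C(nth 0%N I a, 3))%:R
  - \sum_(b < size I) \sum_(a < b) (nth 0 I a * nth 0 I b)%N%:R.

(* x = e_p + \sum_(p' < p) l_p' e_p' *)
Definition triangular_form (p : seq nat * seq nat) (l : {malg rat[ns_dpart]})
    (x : chain) : Prop :=
  (forall p' : ns_dpart, p' \in msupp l -> prec (val p') p) /\
  x = tau_mono p + tau_comb l.

Definition etilde (p : seq nat * seq nat) (x : chain) : Prop :=
  Gamma1 x = energy p.1 *: x /\ exists l, triangular_form p l x.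

(* The eigenspace corresponding to I. Distinct nonsingular I of one degree can
   have the same E(I): E(1,10,14) = E(3,7,15) = 320 in degree 25. The
   eigenvectors corresponding to I are those which involve only the e_(I;J) and
   smaller monomials. *)
Definition eigenspace_of (I : seq nat) (x : chain) : Prop :=
  [/\ has_degree (sumn I) x, Gamma1 x = energy I *: x &
      exists2 c : {malg rat[ns_dpart]}, x = tau_comb c &
        forall p : ns_dpart, p \in msupp c ->
          (val p).1 = I \/
          exists2 J, nonsingular_dp (I, J) & prec (val p) (I, J)].

(* Main.v *)
(* Let eps_i be the left exterior multiplication by e_i, iota_i its adjoint and phi_n the left
   exterior multiplication by delta_1(e_n). Then delta eps_n + eps_n delta = phi_n and
     Gamma eps_i = eps_i Gamma + C(i, 3) eps_i + D_i,
     D_i eps_j + eps_j D_i = - i j eps_i eps_j + 3 i phi_n - 3 n sum_(k < i) (i - k) eps_k eps_(n - k)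
   with n = i + j, and applying delta gives the similar rules for phi_j. So Gamma e_(I;J) is
   E(I) e_(I;J) plus products of factors e_k and delta(e_k) that are smaller in the order.

   Every such product straightens into nonsingular tau-monomials: two factors that are too close are
   expressed through smaller pairs by sum_k (n - k) eps_k eps_(n - k) = phi_n,
   sum_k q(k) eps_k phi_(n - k) = 0 for q = 1, k, k^2 (k - n), and sum_k q(k) phi_k phi_(n - k) = 0
   for q = 1, k (n - k). The nonsingular tau-monomials are a basis because they are not more
   numerous than the strict partitions: their generating function W(x), where x marks the
   dimension and q the degree, satisfies W(x) = (1 + x q) W(x q).

   Gamma being self-adjoint, (Gamma - E)^2 u = 0 implies (Gamma - E) u = 0, hence triangularity
   gives the eigenvectors by induction along the order. Going down in the order increases the sum
   of the cubes of the parts unless I is unchanged, and E(I) is (sum of i^3 + 2 i) / 6 - |I|^2 / 2,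
   so E strictly increases; this separates the eigenvectors of different I. Finally
     E(I) = sum_b i_b ((i_b - 1) (i_b - 2) / 6 - sum_(a < b) i_a),
   where for nonsingular I the brackets are nonnegative and nondecreasing in b, and the last one
   vanishes only if I is main. As they lie in Z/6, a nonzero E(I) bounds all parts by 6 E(I). *)

Require Import Defs.
From HB Require Import structures.
From mathcomp Require Import all_boot all_order all_algebra.
From mathcomp Require Import finmap.
From mathcomp.multinomials Require Import monalg.
From mathcomp Require Import zify ring lra.
From Stdlib Require Import Relation_Operators IndefiniteDescription.

Set Implicit Arguments.
Unset Strict Implicit.
Unset Printing Implicit Defensive.

Import Order.TTheory GRing.Theory Num.Theory.
Local Open Scope ring_scope.

(** The numbers 1, 3 and 2 of the relations used for straightening are those of the close pairs with
    a given sum of indices. Close means j - i = 1, 2 for e_i, e_j, then -2 <= l - k <= 3 for e_k,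
    delta(e_l), and 0 <= l - k <= 3 for delta(e_k), delta(e_l); the sum fixes the parity of the
    difference. So a weight can be found that is 1 at one close pair and 0 at the other close ones,
    and the remaining terms are lower. Words without close pairs are the nonsingular ones: parts
    differ by at least 3, and by more than 3 below a doubled part, which is therefore leading.

    Straightening yields generators only; their independence comes from the count. No bijection with
    strict partitions is at hand: lowering every degree by the dimension turns e_i into e_(i-1) but
    delta(e_j) into delta(e_(j-2)), which does not respect the conditions on words. Hence the
    generating function is embedded in the family B_(a,b), with independent bounds for the two kinds
    of factors. *)

(** * Linear extensions and coefficientwise identities *)

Lemma linextw (K : choiceType) (f : K -> chain) x (d : {fset K}) :
  (msupp x `<=` d)%fset -> linext f x = \sum_(k <- d) x@_k *: f k.
Proof.
move=> sub; rewrite /linext (big_fset_incl _ sub) // => k _ /mcoeff_outdom->.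
by rewrite scale0r.
Qed.

Lemma linext_is_linear (K : choiceType) (f : K -> chain) : linear (linext f).
Proof.
move=> a x y; pose d := (msupp (a *: x + y) `|` (msupp x `|` msupp y))%fset.
rewrite (@linextw _ _ _ d) ?fsubsetUl // (@linextw _ _ x d); last first.
  by rewrite fsubsetU // fsubsetUl orbT.
rewrite (@linextw _ _ y d); last by rewrite fsubsetU // fsubsetUr orbT.
rewrite scaler_sumr -big_split; apply: eq_bigr => k _ /=.
by rewrite mcoeffD mcoeffZ scalerDl scalerA.
Qed.

HB.instance Definition _ (K : choiceType) (f : K -> chain) :=
  GRing.isLinear.Build rat {malg rat[K]} chain _ (linext f) (linext_is_linear f).

(** * Exterior multiplications, contractions, and the two differentials *)

(* [dd], [dl] and later [Gam] are opaque copies of [bd], [delta1] and [Gamma1]: unification would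
   otherwise unfold them. *)
HB.lock Definition dd : chain -> chain := bd.
HB.lock Definition dl : chain -> chain := delta1.

Lemma dd_is_linear : linear dd.
Proof. by rewrite dd.unlock; apply: linext_is_linear. Qed.
HB.instance Definition _ := GRing.isLinear.Build rat chain chain _ dd dd_is_linear.

Lemma dl_is_linear : linear dl.
Proof. by rewrite dl.unlock; apply: linext_is_linear. Qed.
HB.instance Definition _ := GRing.isLinear.Build rat chain chain _ dl dl_is_linear.

Lemma ddD x y : dd (x + y) = dd x + dd y. Proof. exact: linearD. Qed.
Lemma ddB x y : dd (x - y) = dd x - dd y. Proof. exact: linearB. Qed.
Lemma ddZ c x : dd (c *: x) = c *: dd x. Proof. exact: linearZZ. Qed.
Lemma dd0r : dd 0 = 0. Proof. exact: linear0. Qed.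
Lemma dlD x y : dl (x + y) = dl x + dl y. Proof. exact: linearD. Qed.
Lemma dlB x y : dl (x - y) = dl x - dl y. Proof. exact: linearB. Qed.
Lemma dlZ c x : dl (c *: x) = c *: dl x. Proof. exact: linearZZ. Qed.
Lemma dl0r : dl 0 = 0. Proof. exact: linear0. Qed.

Lemma dl_adjoint x y : inner (dd x) y = inner x (dl y).
Proof. by rewrite dd.unlock dl.unlock; apply: delta1_adjoint. Qed.

Lemma malgE (K : choiceType) (x : {malg rat[K]}) : x = \sum_(k <- msupp x) x@_k *: << k >>.
Proof.
rewrite {1}[x]monalgE; apply: eq_bigr => k _; apply/malgP => k'.
by rewrite mcoeffZ !mcoeffU mulrnAr mulr1.
Qed.

Lemma chain_ext (f g : {linear chain -> chain}) :
  (forall K, f << K >> = g << K >>) -> forall x, f x = g x.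
Proof.
move=> fg x; rewrite [x]malgE !linear_sum; apply: eq_bigr => K _.
by rewrite !linearZZ fg.
Qed.

Ltac lin := apply/malgP=> ?;
  rewrite ?(mcoeffD, mcoeffB, mcoeffN, mcoeffZ, mcoeff0); ring.

(** The monomial without its sign. It depends only on the multiset [s], so that signs can be tracked
    apart from reordering. *)
Definition umono (s : seq nat) : chain :=
  if insub (sort leq s) is Some K then << K >> else 0.

Lemma monoE s : mono s = (-1) ^+ inversions s *: umono s.
Proof. by rewrite /mono /umono; case: insub => // ; rewrite scaler0. Qed.

Lemma umono_perm s t : perm_eq s t -> umono s = umono t.
Proof.
move=> st; rewrite /umono; suff -> : sort leq s = sort leq t by [].
by apply/perm_sortP => //; [exact: leq_total|exact: leq_trans|exact: anti_leq].
Qed.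

Lemma strict1_sort s : strict1 (sort leq s) = uniq s && (0%N \notin s).
Proof.
rewrite /strict1 ltn_sorted_uniq_leq sort_uniq sort_sorted ?andbT; last exact: leq_total.
congr andb; rewrite all_sort; apply/allP/idP => [h|h i si]; first by apply/negP => /h.
by rewrite /= lt0n; apply: contraNneq h => <-.
Qed.

Lemma strictE (K : strict_part) : [/\ sorted leq (val K), uniq (val K) & 0%N \notin val K].
Proof.
case: K => K /= sK; have sK' : sorted leq K.
  by case/andP: sK; rewrite ltn_sorted_uniq_leq => /andP[].
by have := strict1_sort K; rewrite sorted_sort ?sK // => [/esym/andP[]|]; last exact: leq_trans.
Qed.

Lemma umonoK (K : strict_part) : umono (val K) = << K >>.
Proof.
have [sK _ _] := strictE K; rewrite /umono sorted_sort //; last exact: leq_trans.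
by rewrite valK.
Qed.

Lemma umono_eq0 s : ~~ (uniq s && (0%N \notin s)) -> umono s = 0.
Proof. by rewrite -strict1_sort /umono => h; rewrite insubN. Qed.

Lemma umono_basis s : uniq s -> 0%N \notin s ->
  exists2 K : strict_part, umono s = << K >> & perm_eq (val K) s.
Proof.
move=> us s0; have h : strict1 (sort leq s) by rewrite strict1_sort us.
exists (Sub _ h); last by rewrite SubK perm_sort.
by rewrite /umono insubT.
Qed.

(** The number of transpositions that carry a leading factor [x] to its place among the sorted
    factors [s]. *)
Definition ltcount (x : nat) (s : seq nat) := count (fun y => (y < x)%N) s.

Lemma inversions_cons x s : inversions (x :: s) = (ltcount x s + inversions s)%N.
Proof.
rewrite /inversions /= big_ord_recl big_ord0 add0n.
transitivity (\sum_(j < size s) ((nth 0 s j < x) +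
    \sum_(i < j) (nth 0 s j < nth 0 s i)))%N.
  by apply: eq_bigr => j _; rewrite lift0 big_ord_recl.
rewrite big_split /=; congr addn.
rewrite /ltcount -sum1_count [RHS]big_mkcond [RHS](big_nth 0%N) big_mkord.
by apply: eq_bigr => j _; case: ltnP.
Qed.

Lemma inversions_sorted s : sorted leq s -> inversions s = 0%N.
Proof.
elim: s => [|x s IH] ss; first by rewrite /inversions big_ord0.
rewrite inversions_cons IH ?(path_sorted ss) // addn0.
apply/eqP; rewrite -leqn0 leqNgt -has_count; apply/hasPn => y ys.
by rewrite -leqNgt (allP (order_path_min leq_trans ss)).
Qed.

Lemma monoK (K : strict_part) : mono (val K) = << K >>.
Proof. by have [sK _ _] := strictE K; rewrite monoE inversions_sorted // scale1r umonoK. Qed.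

(* Left exterior multiplication by e_i; it is 0 for i = 0. *)
HB.lock Definition eps (i : nat) : chain -> chain :=
  linext (fun K : strict_part => mono (i :: val K)).

Lemma eps_is_linear i : linear (eps i).
Proof. by rewrite eps.unlock; apply: linext_is_linear. Qed.
HB.instance Definition _ i := GRing.isLinear.Build rat chain chain _ (eps i) (eps_is_linear i).

Lemma epsD i x y : eps i (x + y) = eps i x + eps i y. Proof. exact: linearD. Qed.
Lemma epsB i x y : eps i (x - y) = eps i x - eps i y. Proof. exact: linearB. Qed.
Lemma epsN i x : eps i (- x) = - eps i x. Proof. exact: linearN. Qed.
Lemma epsZ i c x : eps i (c *: x) = c *: eps i x. Proof. exact: linearZZ. Qed.
Lemma eps0r i : eps i 0 = 0. Proof. exact: linear0. Qed.
Definition eps_lin := (epsD, epsB, epsN, epsZ, eps0r).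

(* The contraction adjoint to [eps i]. *)
HB.lock Definition iota_op (i : nat) : chain -> chain :=
  linext (fun K : strict_part =>
    (i \in val K)%:R * (-1) ^+ ltcount i (val K) *: umono (rem i (val K))).

Lemma iota_op_is_linear i : linear (iota_op i).
Proof. by rewrite iota_op.unlock; apply: linext_is_linear. Qed.
HB.instance Definition _ i :=
  GRing.isLinear.Build rat chain chain _ (iota_op i) (iota_op_is_linear i).

Lemma iota_opB i x y : iota_op i (x - y) = iota_op i x - iota_op i y. Proof. exact: linearB. Qed.
Lemma iota_opZ i c x : iota_op i (c *: x) = c *: iota_op i x. Proof. exact: linearZZ. Qed.

Lemma ltcount_perm x s t : perm_eq s t -> ltcount x s = ltcount x t.
Proof. by move=> /permP; apply. Qed.

Lemma eps_umono i s : eps i (umono s) = (-1) ^+ ltcount i s *: umono (i :: s).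
Proof.
have [/andP[us s0]|ns] := boolP (uniq s && (0%N \notin s)); last first.
  rewrite !umono_eq0 ?linear0 ?scaler0 //; apply: contraNN ns => /=.
  by rewrite inE negb_or => /andP[/andP[_ ->] /andP[_ ->]].
have [K -> Ks] := umono_basis us s0; rewrite eps.unlock linextU monoE inversions_cons.
have [sK _ _] := strictE K; rewrite (inversions_sorted sK) addn0 (ltcount_perm _ Ks).
by congr (_ *: _); apply: umono_perm; rewrite perm_cons.
Qed.

Lemma mono_cons i s : mono (i :: s) = eps i (mono s).
Proof. by rewrite !monoE linearZZ /= eps_umono inversions_cons scalerA -exprD addnC. Qed.

Lemma perm_rem (x : nat) s t : perm_eq s t -> perm_eq (rem x s) (rem x t).
Proof.
move=> st; have [xs|xs] := boolP (x \in s); last by rewrite !rem_id // -(perm_mem st).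
rewrite -(perm_cons x) -(permPl (perm_to_rem xs)) (permPl st).
by apply: perm_to_rem; rewrite -(perm_mem st).
Qed.

Lemma iota_umono i s : uniq s -> 0%N \notin s ->
  iota_op i (umono s) = (i \in s)%:R * (-1) ^+ ltcount i s *: umono (rem i s).
Proof.
move=> us s0; have [K -> Ks] := umono_basis us s0.
rewrite iota_op.unlock linextU (perm_mem Ks) (ltcount_perm _ Ks).
by congr (_ *: _); apply/umono_perm/perm_rem.
Qed.

Lemma eps0 x : eps 0 x = 0.
Proof.
apply: (chain_ext (f := eps 0) (g := \0)) => K /=; rewrite -umonoK eps_umono umono_eq0 ?scaler0 //.
by rewrite negb_and negbK inE eqxx orbT.
Qed.

Lemma epsC i j x : eps i (eps j x) = - eps j (eps i x).
Proof.
apply: (chain_ext (f := eps i \o eps j) (g := \- (eps j \o eps i))) => K /=.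
rewrite -umonoK !eps_umono !linearZZ /= !eps_umono scalerN !scalerA -scaleNr.
have [->|ij] := eqVneq i j; first by rewrite umono_eq0 ?scaler0 //= inE eqxx.
rewrite [umono [:: j, i & _]](@umono_perm _ [:: i, j & val K]); last first.
  by apply/permP => a /=; rewrite addnCA.
congr (_ *: _); rewrite /ltcount /=.
by move: ij; case: ltngtP => // _ _; rewrite ?add0n ?add1n ?exprS; ring.
Qed.

Lemma eps2 i x : eps i (eps i x) = 0.
Proof.
apply/malgP => K; have := congr1 (mcoeff K) (epsC i i x).
by rewrite mcoeffN mcoeff0; lra.
Qed.

(** The canonical anticommutation relation. At i = j = 0 it would fail, because both operators
    vanish there. *)
Lemma iota_eps i j x : (0 < i)%N -> (0 < j)%N ->
  iota_op i (eps j x) = (i == j)%:R *: x - eps j (iota_op i x).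
Proof.
move=> i0 j0; apply: (chain_ext (f := iota_op i \o eps j)
   (g := ((i == j)%:R \*: idfun) \- (eps j \o iota_op i))) => K /=.
have [_ uK zK] := strictE K; rewrite -umonoK eps_umono linearZZ /=.
rewrite (iota_umono i uK zK) linearZZ /= eps_umono.
have [jK|jK] := boolP (j \in val K).
  rewrite umono_eq0 /= ?jK // linear0 scaler0.
  have [->|ij] := eqVneq i j.
    rewrite jK mul1r scalerA scale1r -exprD.
    rewrite (@umono_perm (_ :: _) (val K)); last by rewrite perm_sym perm_to_rem.
    rewrite (ltcount_perm j (perm_to_rem jK)) /ltcount /= ltnn add0n.
    by rewrite addnn -mul2n exprM sqrrN !expr1n scale1r subrr.
  rewrite (@umono_eq0 (j :: _)) ?scaler0 ?scale0r ?subrr //=.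
  by rewrite rem_filter // mem_filter /= eq_sym ij jK.
rewrite iota_umono ?inE; first last.
- by rewrite negb_or zK andbT eq_sym -lt0n.
- by rewrite /= jK uK.
rewrite /= [j == i]eq_sym; have [->|ij] /= := eqVneq i j.
  rewrite (negPf jK) mul1r !mul0r scale0r subr0 scalerA scale1r.
  by rewrite /ltcount /= ltnn add0n -exprD addnn -mul2n exprM sqrrN !expr1n scale1r.
rewrite scale0r sub0r; have [iK|iK] := boolP (i \in val K); last first.
  by rewrite !mul0r !scale0r scaler0 oppr0.
rewrite !mul1r !scalerA -scaleNr; congr (_ *: _).
rewrite (ltcount_perm j (perm_to_rem iK)) /ltcount /=.
by move: ij; case: ltngtP => // _ _; rewrite ?add0n ?add1n ?exprS; ring.
Qed.

Lemma inner_linear x : linear (inner x : chain -> rat^o).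
Proof.
move=> a y z; rewrite /inner scaler_sumr -big_split; apply: eq_bigr => K _ /=.
by rewrite mcoeffD mcoeffZ; rewrite /GRing.scale /=; ring.
Qed.
HB.instance Definition _ x :=
  GRing.isLinear.Build rat chain rat^o _ (inner x) (inner_linear x).

Lemma innerZ x a y : inner x (a *: y) = a * inner x y.
Proof. exact: (linearZZ (inner x : {linear chain -> rat^o})). Qed.

Lemma inner_ext (f g : {linear chain -> chain}) :
  (forall K L, (f << K >>)@_L = (g << L >>)@_K) -> forall x y, inner (f x) y = inner x (g y).
Proof.
move=> fg x y; rewrite [y]malgE !linear_sum; apply: eq_bigr => L _.
rewrite !linearZZ /= !innerZ innerU; congr (_ * _).
rewrite innerC [x]malgE !linear_sum raddf_sum /=; apply: eq_bigr => K _.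
by rewrite !linearZZ /= mcoeffZ innerZ innerU fg.
Qed.

(** Both matrix entries are nonzero only when L is K with the part i added, and the signs agree
    because [ltcount i] does not count i itself. *)
Lemma eps_iota_adj i : (0 < i)%N -> forall x y, inner (eps i x) y = inner x (iota_op i y).
Proof.
move=> i0; apply: inner_ext => K L; have [_ uK zK] := strictE K; have [_ uL zL] := strictE L.
have cU (s t : seq nat) (M N : strict_part) : perm_eq (val M) s -> perm_eq (val N) t ->
    (<< M >> : chain)@_N = (perm_eq s t)%:R.
  move=> Ms Nt; rewrite mcoeffU; congr (_ *+ _); congr (nat_of_bool _).
  rewrite -(permPl Ms) -(permPr Nt); apply/eqP/idP => [->//|MN].
  apply/val_inj/(sorted_eq leq_trans anti_leq) => //; first by case: (strictE M).
  by case: (strictE N).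
rewrite /= -(umonoK K) eps_umono -(umonoK L) iota_umono // !mcoeffZ.
have [iK|iK] := boolP (i \in val K).
  rewrite umono_eq0 /= ?iK // mcoeff0 mulr0.
  have [iL|iL] := boolP (i \in val L); last by rewrite !mul0r.
  have [||M -> ML] := @umono_basis (rem i (val L)); first by rewrite rem_uniq.
    by apply: contraNN zL; apply: mem_rem.
  rewrite (cU _ _ _ _ ML (perm_refl _)); have [h|_] := boolP (perm_eq _ _); last by rewrite mulr0.
  have /(_ i) := perm_mem h.
  by rewrite iK mem_rem_uniq // !inE eqxx.
have [||M -> MK] := @umono_basis (i :: val K); first by rewrite /= iK.
  by rewrite inE negb_or zK andbT eq_sym -lt0n.
rewrite (cU _ _ _ _ MK (perm_refl _)).
have [iL|iL] := boolP (i \in val L); last first.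
  rewrite !mul0r; have [h|_] := boolP (perm_eq _ _); last by rewrite mulr0.
  have /(_ i) := perm_mem h.
  by rewrite inE eqxx (negPf iL).
rewrite mul1r; have [||N -> NL] := @umono_basis (rem i (val L)).
- by rewrite rem_uniq.
- by apply: contraNN zL; apply: mem_rem.
rewrite (cU _ _ _ _ NL (perm_refl _)) (ltcount_perm i (perm_to_rem iL)) (permPr (perm_to_rem iL)).
rewrite perm_cons perm_sym; have [h|] := boolP (perm_eq _ _); last by rewrite !mulr0.
by move: (ltcount_perm i h); rewrite /ltcount /= ltnn add0n => ->.
Qed.

Lemma iotaK0 i (K : strict_part) : i \notin val K -> iota_op i << K >> = 0.
Proof. by move=> iK; rewrite iota_op.unlock linextU (negPf iK) mul0r scale0r. Qed.

Lemma ddK (K : strict_part) : dd << K >> = bd_mono (val K).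
Proof. by rewrite dd.unlock; apply: linextU. Qed.

HB.lock Definition E2 (n : nat) (c : nat -> rat) (x : chain) : chain :=
  \sum_(a < n.+1) c a *: eps a (eps (n - a) x).

Lemma E2_is_linear n c : linear (E2 n c).
Proof.
move=> k x y; rewrite E2.unlock scaler_sumr -big_split; apply: eq_bigr => a _ /=.
by rewrite !linearP.
Qed.
HB.instance Definition _ n c := GRing.isLinear.Build rat chain chain _ (E2 n c) (E2_is_linear n c).

Lemma E2_rev n c x : E2 n c x = - E2 n (fun a => c (n - a)%N) x.
Proof.
rewrite E2.unlock (reindex_inj rev_ord_inj) -sumrN; apply: eq_bigr => a _ /=.
have lea : (a <= n)%N by rewrite -ltnS.
by rewrite subSS subKn // epsC scalerN.
Qed.

Lemma E2D n c c' x : E2 n (fun a => c a + c' a) x = E2 n c x + E2 n c' x.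
Proof. by rewrite E2.unlock -big_split; apply: eq_bigr => a _; rewrite scalerDl. Qed.

Lemma E2Z n k c x : E2 n (fun a => k * c a) x = k *: E2 n c x.
Proof. by rewrite E2.unlock scaler_sumr; apply: eq_bigr => a _; rewrite scalerA. Qed.

Lemma halve (x : chain) : x = - x -> x = 0.
Proof.
move=> h; apply/malgP => K; have := congr1 (mcoeff K) h.
by rewrite mcoeffN mcoeff0; lra.
Qed.

Lemma E2_sym n c x : (forall a b, (0 < a)%N -> (0 < b)%N -> (a + b = n)%N -> c a = c b) ->
  E2 n c x = 0.
Proof.
move=> h; apply: halve; rewrite {1}E2_rev; congr (- _); rewrite E2.unlock; apply: eq_bigr => a _.
have lea : (a <= n)%N by rewrite -ltnS.
have [->|a0] := posnP a; first by rewrite eps0 !scaler0.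
have [->|na] := eqVneq (nat_of_ord a) n; first by rewrite subnn eps0 linear0 !scaler0.
by rewrite (h (n - a)%N a) // ?subnK // subn_gt0 ltn_neqAle na.
Qed.

(** The factors anticommute, so only the antisymmetric part of a weight counts, and only at positive
    indices. Weights that look different are compared in this way. *)
Lemma eq_E2 n c c' x :
  (forall a b, (0 < a)%N -> (0 < b)%N -> (a + b = n)%N -> c a - c b = c' a - c' b) ->
  E2 n c x = E2 n c' x.
Proof.
move=> h; apply/eqP; rewrite -subr_eq0 -scaleN1r -E2Z -E2D; apply/eqP/E2_sym => a b a0 b0 ab.
by have := h a b a0 b0 ab; lra.
Qed.

(* The left exterior multiplication by delta_1(e_n): each e_a ^ e_b with a < b and a + b = n occurs
   twice in the sum [E2], with total coefficient b - a. *)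
HB.lock Definition phi (n : nat) : chain -> chain := E2 n (fun a => n%:R - a%:R).
Lemma phi_is_linear n : linear (phi n).
Proof. by rewrite phi.unlock; apply: E2_is_linear. Qed.
HB.instance Definition _ n := GRing.isLinear.Build rat chain chain _ (phi n) (phi_is_linear n).

Lemma phiD n x y : phi n (x + y) = phi n x + phi n y. Proof. exact: linearD. Qed.
Lemma phiB n x y : phi n (x - y) = phi n x - phi n y. Proof. exact: linearB. Qed.
Lemma phiZ n c x : phi n (c *: x) = c *: phi n x. Proof. exact: linearZZ. Qed.
Lemma phi0r n : phi n 0 = 0. Proof. exact: linear0. Qed.

(** * The differentials through multiplications and contractions *)

Lemma big_sub (K T : seq nat) (P : pred nat) (F : nat -> chain) : uniq K -> uniq T ->
  {subset K <= T} -> (forall i, i \notin K -> F i = 0) ->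
  \sum_(i <- T | P i) F i = \sum_(i <- K | P i) F i.
Proof.
move=> uK uT KT F0; rewrite (bigID (mem K)) /= [X in _ + X]big1 ?addr0; last first.
  by move=> i /andP[_ /F0].
rewrite -big_filter -[RHS]big_filter; apply/perm_big/uniq_perm; rewrite ?filter_uniq //.
move=> i; rewrite !mem_filter; apply/idP/idP; first by case/andP=> /andP[-> ->].
by case/andP=> -> iK; rewrite iK KT.
Qed.

Lemma sum_delta (T : seq nat) (P : pred nat) (F : nat -> chain) (a : nat) :
  uniq T -> a \in T -> \sum_(i <- T | P i) (i == a)%:R *: F i = (P a)%:R *: F a.
Proof.
move=> uT aT; rewrite big_mkcond (bigD1_seq a) //= eqxx big1 => [|i /negPf->].
  by case: (P a); rewrite !(scale1r, scale0r) addr0.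
by case: (P i); rewrite // scale0r.
Qed.

(* [ddM] and [dlM] agree with [dd] and [dl] on chains with all indices at most [M]. *)
Definition ddM (M : nat) (x : chain) : chain :=
  \sum_(i <- iota 1 M) \sum_(j <- iota 1 M | (i < j)%N)
    (j%:R - i%:R) *: eps (i + j) (iota_op j (iota_op i x)).

Definition dlM (M : nat) (x : chain) : chain :=
  \sum_(i <- iota 1 M) \sum_(j <- iota 1 M | (i < j)%N)
    (j%:R - i%:R) *: eps i (eps j (iota_op (i + j) x)).

Lemma ddM_is_linear M : linear (ddM M).
Proof.
move=> k x y; rewrite /ddM scaler_sumr -big_split; apply: eq_bigr => i _ /=.
rewrite scaler_sumr -big_split; apply: eq_bigr => j _ /=.
by rewrite !linearP.
Qed.
HB.instance Definition _ M := GRing.isLinear.Build rat chain chain _ (ddM M) (ddM_is_linear M).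
Lemma dlM_is_linear M : linear (dlM M).
Proof.
move=> k x y; rewrite /dlM scaler_sumr -big_split; apply: eq_bigr => i _ /=.
rewrite scaler_sumr -big_split; apply: eq_bigr => j _ /=.
by rewrite !linearP.
Qed.
HB.instance Definition _ M :=
  GRing.isLinear.Build rat chain chain _ (dlM M) (dlM_is_linear M).

Lemma innerDr x y z : inner x (y + z) = inner x y + inner x z.
Proof. exact: (linearD (inner x : {linear chain -> rat^o})). Qed.
Lemma inner_sumr (I : Type) (r : seq I) (P : pred I) (F : I -> chain) x :
  inner x (\sum_(i <- r | P i) F i) = \sum_(i <- r | P i) inner x (F i).
Proof. exact: (linear_sum (inner x : {linear chain -> rat^o})). Qed.

Lemma ddM_adj M x y : inner (ddM M x) y = inner x (dlM M y).
Proof.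
rewrite innerC.
rewrite /ddM /dlM.
rewrite [LHS]inner_sumr.
rewrite [RHS]inner_sumr.
apply: eq_big_seq => i; rewrite mem_iota => /andP[i0 _].
rewrite [LHS]inner_sumr [RHS]inner_sumr.
apply: eq_bigr => j ij; have j0 := leq_ltn_trans (leq0n i) ij.
rewrite [LHS]innerZ [RHS]innerZ.
have ij0 : (0 < i + j)%N by rewrite addn_gt0 i0.
rewrite [inner y _]innerC (eps_iota_adj ij0) [inner x _]innerC (eps_iota_adj i0).
by rewrite (eps_iota_adj j0) [inner _ (iota_op (i + j) y)]innerC.
Qed.

Lemma ltcount_nth (K : seq nat) r : sorted ltn K -> (r < size K)%N -> ltcount (nth 0%N K r) K = r.
Proof.
rewrite /ltcount; elim: K r => [|k K IH] [|r] //= pK.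
  rewrite ltnn add0n => _; apply/eqP; rewrite -leqn0 leqNgt -has_count; apply/hasPn => y yK.
  by rewrite -leqNgt ltnW // (allP (order_path_min ltn_trans pK)).
rewrite ltnS => rK; rewrite (IH r (path_sorted pK) rK).
by rewrite (allP (order_path_min ltn_trans pK)) // mem_nth.
Qed.

(** The positions in [bd_mono] give way to contractions: in a strict partition the position of a
    part is its [ltcount], and the extra sign in [iota2] arises because the smaller part [i] is
    already gone when [j] is contracted. *)
Lemma dd_ddM_basis (K : strict_part) M : {subset val K <= iota 1 M} -> dd << K >> = ddM M << K >>.
Proof.
move=> KM; have [sK uK zK] := strictE K; rewrite ddK /bd_mono.
have sK' : sorted ltn (val K) by rewrite ltn_sorted_uniq_leq uK.
pose G i j := (j%:R - i%:R) *: eps (i + j) (iota_op j (iota_op i << K >>)).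
have iota2 i j : i \in val K -> j \in val K -> (i < j)%N ->
    iota_op j (iota_op i << K >>) =
    - (-1) ^+ (ltcount i (val K) + ltcount j (val K)) *: umono (rem j (rem i (val K))).
  move=> iK jK ij; have jiK : j \in rem i (val K) by rewrite mem_rem_uniq // !inE gtn_eqF.
  rewrite -{1}(umonoK K) iota_umono // linearZZ /= iota_umono ?rem_uniq //; last first.
    by apply: contraNN zK; apply: mem_rem.
  rewrite iK jiK !mul1r scalerA (ltcount_perm j (perm_to_rem iK)); congr (_ *: _).
  by rewrite {3}/ltcount /= ij add1n addnS exprS exprD -/(ltcount j _); ring.
have -> : ddM M << K >> = \sum_(j <- val K) \sum_(i <- val K | (i < j)%N) G i j.
  rewrite /ddM (big_sub xpredT uK (iota_uniq 1 M) KM); last first.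
    by move=> i iK; rewrite big1 // => j _; rewrite iotaK0 // !linear0.
  rewrite [RHS](exchange_big_dep xpredT) //=; rewrite big_seq [RHS]big_seq.
  apply: eq_bigr => i iK; apply: (big_sub _ uK (iota_uniq 1 M) KM) => j jK.
  rewrite -(umonoK K) iota_umono // linearZZ /= iota_umono ?rem_uniq //; last first.
    by apply: contraNN zK; apply: mem_rem.
  rewrite (negPf (_ : j \notin rem i (val K))); last by apply: contraNN jK; apply: mem_rem.
  by rewrite mul0r scale0r !(scaler0, linear0).
rewrite (big_nth 0%N) big_mkord; apply: eq_bigr => s _.
rewrite (big_nth 0%N) big_mkord.
rewrite (@big_ord_widen_cond _ _ _ s (size (val K)) xpredT (fun r =>
  ((-1) ^+ (r + s).+1 * ((nth 0%N (val K) s)%:R - (nth 0%N (val K) r)%:R)) *: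
  mono ((nth 0 (val K) r + nth 0 (val K) s)%N ::
        take r (val K) ++ drop r.+1 (take s (val K)) ++ drop s.+1 (val K))) (ltnW (ltn_ord s))).
have ltKE (r s' : 'I_(size (val K))) : (nth 0%N (val K) r < nth 0%N (val K) s')%N = (r < s')%N.
  apply/idP/idP => [|rs]; last by apply: (sorted_ltn_nth ltn_trans 0%N sK') => //; rewrite inE.
  by rewrite !ltnNge; apply: contraNN => sr; apply: (sorted_leq_nth leq_trans leqnn 0%N sK) => //; rewrite inE.
apply: eq_big => [r|r rs]; first by rewrite ltKE.
have ltr := ltn_ord r; have lts := ltn_ord s; rewrite /= in rs.
set t := take r _ ++ _; rewrite /G iota2 ?mem_nth ?ltKE // !ltcount_nth //.
have Kt : perm_eq (val K) [:: nth 0%N (val K) r, nth 0%N (val K) s & t].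
  have rs' : (r < size (take s (val K)))%N by rewrite size_takel // ltnW.
  rewrite -{1}(cat_take_drop s (val K)) (drop_nth 0%N lts) -(cat_take_drop r (take s _)).
  rewrite (drop_nth 0%N rs') nth_take // take_takel ?(ltnW rs) //.
  by apply/permP => a; rewrite /t /= !count_cat /=; lia.
have ut : uniq t by move: uK; rewrite (perm_uniq Kt) => /and3P[].
have st : sorted leq t.
  have sub : subseq t (val K).
    rewrite /t catA -[X in subseq _ X](cat_take_drop s) cat_subseq //; last first.
      by rewrite (drop_nth 0%N lts) subseq_cons.
    rewrite -[X in subseq _ X](cat_take_drop r) take_takel ?(ltnW rs) // cat_subseq //.
    by rewrite -add1n -drop_drop drop_subseq.
  exact: (subseq_sorted leq_trans sub).
rewrite mono_cons monoE inversions_sorted // scale1r linearZZ /= scalerA.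
congr (_ *: eps _ _); first by rewrite exprS; ring.
apply: umono_perm; rewrite -(perm_cons (nth 0%N (val K) s)) -(perm_cons (nth 0%N (val K) r)).
rewrite -(permPl Kt); have rK : nth 0%N (val K) r \in val K by rewrite mem_nth.
rewrite (permPl (perm_to_rem rK)) perm_cons; apply: perm_to_rem.
by rewrite mem_rem_uniq // !inE mem_nth // andbT gtn_eqF ?ltKE.
Qed.

Lemma chain_bound (x : chain) :
  exists M0, forall M, (M0 <= M)%N -> forall K, K \in msupp x -> {subset val K <= iota 1 M}.
Proof.
exists (\max_(K <- msupp x) sumn (val K)) => M leM K Kx i iK.
have [_ _ zK] := strictE K; rewrite mem_iota add1n ltnS; apply/andP; split.
  by rewrite lt0n; apply: contraNneq zK => <-.
apply: leq_trans leM; apply: leq_trans (leq_bigmax_seq _ Kx isT).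
by rewrite (perm_sumn (perm_to_rem iK)) /= leq_addr.
Qed.

(** Every large bound works, so that a single M can serve all the chains of an identity. *)
Lemma dd_ddM (x : chain) : exists M0, forall M, (M0 <= M)%N -> dd x = ddM M x.
Proof.
have [M0 h] := chain_bound x; exists M0 => M leM.
rewrite [x]malgE !linear_sum; apply: eq_big_seq => K Kx.
by rewrite !linearZZ /= (@dd_ddM_basis K M) //; apply: h.
Qed.

(** By transposition of [dd_ddM]. The bound M' needed for L may exceed M, but the added terms
    vanish: an index i + j contracted from K is at most M, and so are i and j. *)
Lemma dl_dlM_basis (K : strict_part) M :
  {subset val K <= iota 1 M} -> dl << K >> = dlM M << K >>.
Proof.
move=> KM; have [_ _ zK] := strictE K; apply/malgP => L.
rewrite -innerU innerC -dl_adjoint.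
have [M0 hM0] := dd_ddM << L >>; pose M' := maxn M0 M.
rewrite (hM0 M' (leq_maxl _ _)) ddM_adj innerC innerU; congr (_@__).
have sub : {subset iota 1 M <= iota 1 M'}.
  by move=> i; rewrite !mem_iota => /andP[-> h]; rewrite (leq_trans h) // ltnS leq_max leqnn orbT.
have out i j : (i \notin iota 1 M) || (j \notin iota 1 M) -> eps i (eps j (iota_op (i + j) << K >>)) = 0.
  move=> h; have [->|i0] := posnP i; first by rewrite eps0.
  have [->|j0] := posnP j; first by rewrite eps0 linear0.
  rewrite iotaK0 ?linear0 //; apply: contraTN h => /KM.
  by rewrite !mem_iota negb_or !negbK i0 j0 => /andP[_ h]; rewrite /= !(leq_ltn_trans _ h) ?leq_addl ?leq_addr.
rewrite /dlM (big_sub _ (iota_uniq 1 M) (iota_uniq 1 M') sub) => [|i iM]; last first.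
  by rewrite big1 // => j _; rewrite out ?iM // scaler0.
apply: eq_bigr => i _; apply: (big_sub _ (iota_uniq 1 M) (iota_uniq 1 M') sub) => j jM.
by rewrite out ?jM ?orbT // scaler0.
Qed.

Lemma dl_dlM (x : chain) : exists M0, forall M, (M0 <= M)%N -> dl x = dlM M x.
Proof.
have [M0 h] := chain_bound x; exists M0 => M leM.
rewrite [x]malgE !linear_sum; apply: eq_big_seq => K Kx.
by rewrite !linearZZ /= (@dl_dlM_basis K M) //; apply: h.
Qed.

Lemma sub_iota a M : (0 < a <= M)%N -> a \in iota 1 M.
Proof. by rewrite mem_iota add1n ltnS. Qed.

(** The contraction in [dlM] either meets e_m, which collects the products e_i ^ e_j with i + j = m,
    or passes it with one change of sign. *)
Lemma dl_eps m x : dl (eps m x) = phi m x - eps m (dl x).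
Proof.
have [->|m0] := posnP m.
  by rewrite !eps0 linear0 subr0 phi.unlock E2.unlock big_ord_recl big_ord0 eps0 scaler0 addr0.
have [M1 h1] := dl_dlM x; have [M2 h2] := dl_dlM (eps m x).
pose M := maxn m (maxn M1 M2).
have leM1 : (M1 <= M)%N by rewrite /M !leq_max leqnn !orbT.
have leM2 : (M2 <= M)%N by rewrite /M !leq_max leqnn !orbT.
rewrite (h1 _ leM1) (h2 _ leM2) /dlM linear_sum /=.
have -> : phi m x = \sum_(i <- iota 1 M) \sum_(j <- iota 1 M | (i < j)%N)
    (j%:R - i%:R) *: ((i + j == m)%:R *: eps i (eps j x)).
  (* This weight keeps only the half a < b of each pair and has the same antisymmetric part as the
     weight of [phi m]. *)
  transitivity (E2 m (fun a => (2 * a < m)%N%:R * (m%:R - 2 * a%:R)) x).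
    rewrite phi.unlock; apply: eq_E2 => a b a0 b0 ab; rewrite -ab natrD.
    have [-> ->] : (2 * a < a + b)%N = (a < b)%N /\ (2 * b < a + b)%N = (b < a)%N by split; lia.
    by case: (ltngtP a b) => [_|_|->] /=; ring.
  rewrite E2.unlock big_ord_recl eps0 scaler0 add0r.
  pose F i := ((2 * i < m)%N%:R * (m%:R - 2 * i%:R)) *: eps i (eps (m - i) x).
  transitivity (\sum_(i <- iota 1 m) F i).
    rewrite (iotaDl 1 0) big_map.
    by rewrite (_ : iota 0 m = index_iota 0 m) ?big_mkord // /index_iota subn0.
  rewrite -(big_sub xpredT (iota_uniq 1 m) (iota_uniq 1 M)) => [||i]; first last.
  - rewrite mem_iota add1n ltnS lt0n negb_and negbK -ltnNge => /orP[/eqP->|mi].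
      by rewrite /F eps0 scaler0.
    by rewrite /F (_ : (2 * i < m)%N = false) ?mul0r ?scale0r //; lia.
  - by move=> i; rewrite !mem_iota /M; lia.
  apply: eq_big_seq => i; rewrite mem_iota => /andP[i0 _].
  have [lt|ge] := ltnP (2 * i) m; last first.
    rewrite /F ltnNge ge mul0r scale0r big1 // => j ij.
    by rewrite (_ : (i + j == m) = false) ?scale0r ?scaler0 //; lia.
  rewrite (eq_bigr (fun j => (j == m - i)%N%:R *: ((j%:R - i%:R) *: eps i (eps j x)))).
  2: by move=> j _; rewrite !scalerA mulrC (_ : (i + j == m) = (j == m - i))%N //; lia.
  have iM : (m - i)%N \in iota 1 M by rewrite sub_iota // /M; lia.
  rewrite (sum_delta _ _ (iota_uniq 1 M) iM).
  rewrite /F lt (_ : (i < m - i)%N); last by lia.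
  by rewrite mul1r scale1r natrB ?(leq_trans (leq_pmull i _) (ltnW lt)) //; congr (_ *: _); ring.
rewrite -sumrB; apply: eq_big_seq => i; rewrite mem_iota => /andP[i0 _].
rewrite linear_sum -sumrB; apply: eq_bigr => j ij; have ij0 : (0 < i + j)%N by lia.
rewrite /= iota_eps // !eps_lin [eps j (eps m _)]epsC [eps m (eps i _)]epsC !eps_lin.
by lin.
Qed.

(** The anticommutator of the boundary with the multiplication by e_m is the action of e_m on
    chains, that is the derivation e_k -> [e_m, e_k] = (k - m) e_(m+k); see [LopE]. *)
HB.lock Definition Lop (m : nat) (x : chain) : chain := dd (eps m x) + eps m (dd x).

Lemma LopE m x : (0 < m)%N -> exists M0, forall M, (M0 <= M)%N ->
  Lop m x = \sum_(k <- iota 1 M) (k%:R - m%:R) *: eps (m + k) (iota_op k x).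
Proof.
move=> m0; have [M1 h1] := dd_ddM x; have [M2 h2] := dd_ddM (eps m x).
exists (maxn m (maxn M1 M2)) => M; rewrite !geq_max => /and3P[lemM leM1 leM2].
rewrite Lop.unlock (h1 _ leM1) (h2 _ leM2) {h1 h2 leM1 leM2 M1 M2} /ddM.
have mM : m \in iota 1 M by rewrite sub_iota ?m0.
transitivity (\sum_(i <- iota 1 M) \sum_(j <- iota 1 M | (i < j)%N)
   ((i == m)%:R *: ((j%:R - i%:R) *: eps (i + j) (iota_op j x))
    - (j == m)%:R *: ((j%:R - i%:R) *: eps (i + j) (iota_op i x)))).
  rewrite linear_sum -big_split; apply: eq_big_seq => i; rewrite mem_iota => /andP[i0 _].
  rewrite linear_sum -big_split; apply: eq_bigr => j ij /=; have j0 : (0 < j)%N by lia.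
  rewrite iota_eps // iota_opB iota_opZ iota_eps // !eps_lin.
  by rewrite [eps (i + j) (eps m _)]epsC; lin.
under eq_bigr => i _ do rewrite sumrB; rewrite sumrB.
under eq_bigr => i _ do rewrite -scaler_sumr.
rewrite (sum_delta xpredT) ?iota_uniq // scale1r.
under [X in _ - X]eq_bigr => i _ do rewrite (sum_delta _ _ (iota_uniq 1 M) mM).
rewrite big_mkcond -sumrB; apply: eq_bigr => k _ /=.
case: ltngtP => [mk|km|->]; rewrite ?(scale1r, scale0r) ?subr0 ?sub0r //; last by rewrite subrr scale0r.
by rewrite addnC -scaleNr opprB.
Qed.

Lemma Lop_eps m j x : (0 < m)%N -> (0 < j)%N ->
  Lop m (eps j x) = eps j (Lop m x) + (j%:R - m%:R) *: eps (m + j) x.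
Proof.
move=> m0 j0; have [M1 h1] := LopE (eps j x) m0; have [M2 h2] := LopE x m0.
pose M := maxn j (maxn M1 M2).
rewrite (h1 M) ?(h2 M) /M ?leq_max ?leqnn ?orbT // -/M.
have jM : j \in iota 1 M by rewrite sub_iota // j0 leq_maxl.
rewrite addrC; have := sum_delta xpredT (fun k => (k%:R - m%:R) *: eps (m + k) x) (iota_uniq 1 M) jM.
rewrite scale1r => <-; rewrite linear_sum -big_split; apply: eq_big_seq => k; rewrite mem_iota => /andP[k0 _] /=.
by rewrite iota_eps // !eps_lin [eps (m + k) (eps j _)]epsC; lin.
Qed.

Lemma dd_eps m x : dd (eps m x) = Lop m x - eps m (dd x).
Proof. by rewrite Lop.unlock addrK. Qed.

(** * Bilinear and trilinear relations *)

Lemma pair_sum (N n : nat) (F : nat -> nat -> chain) : (N <= n)%N ->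
  \sum_(b < N.+1) F b (N - b)%N = \sum_(b < n.+1) \sum_(c < n.+1 | (b + c == N)%N) F b c.
Proof.
move=> Nn; rewrite (big_ord_widen n.+1 (fun b => F b (N - b)%N)) ?ltnS // big_mkcond.
apply: eq_bigr => b _; case: ltnP => [bN|Nb].
  have cn : (N - b < n.+1)%N by lia.
  by rewrite (big_pred1 (Ordinal cn)) // => c; rewrite /= -val_eqE /=; lia.
by rewrite big1 // => c /eqP; lia.
Qed.

Lemma phi_sum n x : phi n x = \sum_(a < n.+1) (n%:R - a%:R) *: eps a (eps (n - a) x).
Proof. by rewrite phi.unlock E2.unlock. Qed.

Lemma eps_phi i j x : eps i (phi j x) = phi j (eps i x).
Proof.
rewrite phi.unlock E2.unlock linear_sum; apply: eq_bigr => a _.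
by rewrite /= epsZ epsC [eps i (eps _ x)]epsC epsN opprK.
Qed.

Lemma phi_phi i j x : phi i (phi j x) = phi j (phi i x).
Proof.
rewrite {2 3}phi.unlock E2.unlock linear_sum; apply: eq_bigr => a _.
by rewrite /= phiZ -!eps_phi.
Qed.

Lemma phi_small n x : (n <= 2)%N -> phi n x = 0.
Proof.
move=> n2; rewrite phi.unlock; apply: E2_sym => a b a0 b0 ab.
by have [-> ->] : a = 1%N /\ b = 1%N by lia.
Qed.

HB.lock Definition E3 (n : nat) (p : nat -> nat -> nat -> rat) (x : chain) : chain :=
  \sum_(a < n.+1) \sum_(b < n.+1) \sum_(c < n.+1 | (a + b + c == n)%N)
     p a b c *: eps a (eps b (eps c x)).

Lemma E3_s12 n p x : E3 n p x = - E3 n (fun a b c => p b a c) x.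
Proof.
rewrite E3.unlock exchange_big -sumrN; apply: eq_bigr => a _.
rewrite -sumrN; apply: eq_bigr => b _; rewrite -sumrN.
by apply: eq_big => [c|c _]; rewrite ?[(b + a)%N]addnC // epsC scalerN.
Qed.

Lemma E3_s23 n p x : E3 n p x = - E3 n (fun a b c => p a c b) x.
Proof.
rewrite E3.unlock -sumrN; apply: eq_bigr => a _.
under eq_bigr do rewrite big_mkcond; rewrite exchange_big -sumrN; apply: eq_bigr => b _.
rewrite -big_mkcond -sumrN; apply: eq_big => [c|c _]; first by rewrite addnAC.
by rewrite [eps c (eps b x)]epsC epsN scalerN.
Qed.

Lemma E3D n p q x : E3 n (fun a b c => p a b c + q a b c) x = E3 n p x + E3 n q x.
Proof.
rewrite E3.unlock -big_split; apply: eq_bigr => a _; rewrite -big_split; apply: eq_bigr => b _.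
by rewrite -big_split; apply: eq_bigr => c _; rewrite scalerDl.
Qed.

Lemma E3Z n k p x : E3 n (fun a b c => k * p a b c) x = k *: E3 n p x.
Proof.
rewrite E3.unlock scaler_sumr; apply: eq_bigr => a _; rewrite scaler_sumr; apply: eq_bigr => b _.
by rewrite scaler_sumr; apply: eq_bigr => c _; rewrite scalerA.
Qed.

(** The six permutations of three anticommuting factors send [E3 n p] to itself up to sign, so only
    the full antisymmetrization of the weight counts. *)
Lemma E3_alt n p x :
  (forall a b c, (0 < a)%N -> (0 < b)%N -> (0 < c)%N -> (a + b + c = n)%N ->
     p a b c + p b c a + p c a b = p b a c + p a c b + p c b a) -> E3 n p x = 0.
Proof.
move=> h; pose alt a b c := (p a b c + p b c a + p c a b) - (p b a c + p a c b + p c b a).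
have e0 : E3 n alt x = 0.
  rewrite E3.unlock big1 // => a _; rewrite big1 // => b _; rewrite big1 // => c /eqP abc.
  have [->|a0] := posnP a; first by rewrite eps0 scaler0.
  have [->|b0] := posnP b; first by rewrite eps0 eps0r scaler0.
  have [->|c0] := posnP c; first by rewrite eps0 !eps0r scaler0.
  by rewrite /alt h // subrr scale0r.
have e1 : E3 n alt x = (6%:R : rat) *: E3 n p x.
  transitivity (E3 n p x + E3 n (fun a b c => p b c a) x + E3 n (fun a b c => p c a b) x
    + (-1) *: (E3 n (fun a b c => p b a c) x + E3 n (fun a b c => p a c b) x
    + E3 n (fun a b c => p c b a) x)).
    rewrite -!E3D -E3Z -E3D E3.unlock; apply: eq_bigr => a _; apply: eq_bigr => b _.
    by apply: eq_bigr => c _; rewrite /alt mulN1r.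
  have -> : E3 n (fun a b c => p c b a) x = - E3 n p x.
    by rewrite E3_s12 E3_s23 E3_s12 opprK.
  have -> : E3 n (fun a b c => p c a b) x = E3 n p x by rewrite E3_s23 E3_s12 opprK.
  have -> : E3 n (fun a b c => p b c a) x = E3 n p x by rewrite E3_s12 E3_s23 opprK.
  have -> : E3 n (fun a b c => p b a c) x = - E3 n p x by rewrite E3_s12.
  have -> : E3 n (fun a b c => p a c b) x = - E3 n p x by rewrite E3_s23.
  by lin.
apply/malgP => K; have := congr1 (mcoeff K) e1.
by rewrite e0 mcoeffZ mcoeff0; lra.
Qed.

(* Which weights [q] make these sums vanish decides which close factors can be straightened. *)
HB.lock Definition EF (n : nat) (q : nat -> rat) (x : chain) : chain :=
  \sum_(k < n.+1) q k *: eps k (phi (n - k) x).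

HB.lock Definition FF (n : nat) (q : nat -> rat) (x : chain) : chain :=
  \sum_(k < n.+1) q k *: phi k (phi (n - k) x).

(** The weight (n - a) - b that [phi (n - a)] gives to e_b ^ e_c is c. *)
Lemma EF_E3 n q x : EF n q x = E3 n (fun a b c => q a * c%:R) x.
Proof.
rewrite EF.unlock E3.unlock; apply: eq_bigr => a _.
have lea : (a <= n)%N by rewrite -ltnS.
rewrite phi.unlock E2.unlock linear_sum scaler_sumr.
rewrite (@pair_sum (n - a) n (fun b c => q a *:
   eps a (((n - a)%N%:R - b%:R) *: eps b (eps c x)))) ?leq_subr //.
apply: eq_bigr => b _; apply: eq_big => [c|c /eqP bc]; first lia.
by rewrite epsZ scalerA -bc natrD addrAC subrr add0r.
Qed.

Lemma EF_sum0 n x : EF n (fun _ => 1) x = 0.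
Proof. by rewrite EF_E3; apply: E3_alt => a b c _ _ _ _; ring. Qed.

Lemma EF_linear0 n x : EF n (fun k => k%:R) x = 0.
Proof. by rewrite EF_E3; apply: E3_alt => a b c _ _ _ _; ring. Qed.

(** As a - n = -(b + c), the trilinear weight is - a^2 b c - a^2 c^2, and each of its terms is
    symmetric in two of the three indices. *)
Lemma EF_cubic0 n x : EF n (fun k => k%:R ^+ 2 * (k%:R - n%:R)) x = 0.
Proof.
by rewrite EF_E3; apply: E3_alt => a b c _ _ _ <-; rewrite !natrD; ring.
Qed.

Lemma EFD n p q x : EF n (fun a => p a + q a) x = EF n p x + EF n q x.
Proof. by rewrite EF.unlock -big_split; apply: eq_bigr => a _; rewrite scalerDl. Qed.
Lemma EFZ n k q x : EF n (fun a => k * q a) x = k *: EF n q x.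
Proof. by rewrite EF.unlock scaler_sumr; apply: eq_bigr => a _; rewrite scalerA. Qed.
Lemma FFD n p q x : FF n (fun a => p a + q a) x = FF n p x + FF n q x.
Proof. by rewrite FF.unlock -big_split; apply: eq_bigr => a _; rewrite scalerDl. Qed.

Lemma eq_EF n q q' x : (forall k, (k <= n)%N -> q k = q' k) -> EF n q x = EF n q' x.
Proof. by move=> h; rewrite EF.unlock; apply: eq_bigr => k _; rewrite h // -ltnS. Qed.
Lemma eq_FF n q q' x : (forall k, (k <= n)%N -> q k = q' k) -> FF n q x = FF n q' x.
Proof. by move=> h; rewrite FF.unlock; apply: eq_bigr => k _; rewrite h // -ltnS. Qed.

Lemma EF_rel n (a b c : rat) q x :
  (forall k, (k <= n)%N -> q k = a + b * k%:R + c * (k%:R ^+ 2 * (k%:R - n%:R))) ->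
  EF n q x = 0.
Proof.
move=> h; transitivity (a *: EF n (fun _ => 1) x + b *: EF n (fun k => k%:R) x
  + c *: EF n (fun k => k%:R ^+ 2 * (k%:R - n%:R)) x).
  by rewrite -!EFZ -!EFD; apply: eq_EF => k kn; rewrite h // mulr1.
by rewrite EF_cubic0 EF_linear0 EF_sum0 !scaler0 !addr0.
Qed.

(** The difference of the two sides is the multiplication by delta(delta(e_m)). By [dl_eps] it is
    the difference of two sums of type [EF], whose weights are affine in k. *)
Lemma dl_phi m x : dl (phi m x) = phi m (dl x).
Proof.
apply/eqP; rewrite -subr_eq0; apply/eqP.
transitivity (EF m (fun k => k%:R) x - EF m (fun k => m%:R - k%:R) x); last first.
  rewrite EF_linear0 (@EF_rel _ m%:R (-1) 0) ?subrr // => k _; ring.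
have -> : EF m (fun k => k%:R) x =
    \sum_(a < m.+1) (m%:R - a%:R) *: phi a (eps (m - a) x).
  rewrite EF.unlock (reindex_inj rev_ord_inj); apply: eq_bigr => a _ /=.
  have lea : (a <= m)%N by rewrite -ltnS.
  by rewrite subSS subKn // eps_phi natrB.
rewrite EF.unlock ![phi m _]phi_sum linear_sum -!sumrB; apply: eq_bigr => a _ /=.
by rewrite dlZ !dl_eps eps_lin; lin.
Qed.

Lemma malg_ind (P : chain -> Prop) : P 0 -> (forall x y, P x -> P y -> P (x + y)) ->
  (forall c x, P x -> P (c *: x)) -> (forall i x, P x -> P (eps i x)) -> P (mono [::]) ->
  forall x, P x.
Proof.
move=> P0 PD PZ Pe P1 x; rewrite [x]malgE; apply: (big_ind P P0 PD) => K _.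
apply: PZ; rewrite -(monoK K); elim: (val K) => [|i s IH]; [exact: P1|].
by rewrite mono_cons; apply: Pe.
Qed.

Lemma unit_strict : strict1 [::]. Proof. by []. Qed.
Lemma mono_nil : mono [::] = << Sub [::] unit_strict : strict_part >>.
Proof. by rewrite -monoK SubK. Qed.

Lemma dl1 : dl (mono [::]) = 0.
Proof.
rewrite mono_nil (@dl_dlM_basis _ 0) => [|i]; last by rewrite SubK.
by rewrite /dlM big_nil.
Qed.

Lemma dd1 : dd (mono [::]) = 0.
Proof. by rewrite mono_nil ddK SubK /bd_mono big_ord0. Qed.

Lemma dd_eps1 m : dd (eps m (mono [::])) = 0.
Proof.
have [->|m0] := posnP m; first by rewrite eps0 dd0r.
have s1 : strict1 [:: m] by rewrite /strict1 /= m0.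
rewrite -mono_cons -[mono _]/(mono (val (Sub [:: m] s1 : strict_part))) monoK ddK SubK.
by rewrite /bd_mono big_ord_recl !big_ord0 addr0.
Qed.

Lemma dl_dl x : dl (dl x) = 0.
Proof.
elim/malg_ind: x => [|x y hx hy|c x hx|i x hx|]; last by rewrite dl1 dl0r.
- by rewrite !dl0r.
- by rewrite !dlD hx hy addr0.
- by rewrite !dlZ hx scaler0.
- by rewrite dl_eps dlB dl_phi dl_eps hx eps0r subr0 subrr.
Qed.

Lemma dl_EF n q x : dl (EF n q x) = FF n q x - EF n q (dl x).
Proof.
rewrite EF.unlock FF.unlock linear_sum -sumrB; apply: eq_bigr => k _ /=.
by rewrite dlZ dl_eps dl_phi scalerBr.
Qed.

Lemma EF_FF0 n q : (forall x, EF n q x = 0) -> forall x, FF n q x = 0.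
Proof.
by move=> h x; have := dl_EF n q x; rewrite !h dl0r subr0.
Qed.

(** * The commutation of the laplacian with the factors *)

HB.lock Definition Gam : chain -> chain := Gamma1.
Lemma GamE x : Gam x = dd (dl x) + dl (dd x).
Proof. by rewrite Gam.unlock dd.unlock dl.unlock. Qed.

Lemma Gam_is_linear : linear Gam.
Proof. by move=> c x y; rewrite !GamE !(ddD, ddZ, dlD, dlZ); lin. Qed.
HB.instance Definition _ := GRing.isLinear.Build rat chain chain _ Gam Gam_is_linear.
Lemma GamD x y : Gam (x + y) = Gam x + Gam y. Proof. exact: linearD. Qed.
Lemma GamB x y : Gam (x - y) = Gam x - Gam y. Proof. exact: linearB. Qed.
Lemma GamZ c x : Gam (c *: x) = c *: Gam x. Proof. exact: linearZZ. Qed.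
Lemma Gam0r : Gam 0 = 0. Proof. exact: linear0. Qed.

Lemma Gam_dl x : Gam (dl x) = dl (Gam x).
Proof. by rewrite !GamE dlD !dl_dl dd0r add0r addr0. Qed.

Lemma Gam1 : Gam (mono [::]) = 0.
Proof. by rewrite GamE dl1 dd1 dd0r dl0r addr0. Qed.

Lemma Lop_is_linear m : linear (Lop m).
Proof. by move=> c x y; rewrite Lop.unlock !(epsD, epsZ, ddD, ddZ); lin. Qed.
HB.instance Definition _ m := GRing.isLinear.Build rat chain chain _ (Lop m) (Lop_is_linear m).

Lemma LopB m x y : Lop m (x - y) = Lop m x - Lop m y. Proof. exact: linearB. Qed.
Lemma Lop0r m : Lop m 0 = 0. Proof. exact: linear0. Qed.

(** The weight of the commutator of [Lop m] with [phi j]. The first summand comes from the action on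
    the first factor of e_a ^ e_(j-a), with k = m + a, the second one from the action on the second
    factor, with k = a. *)
Definition cL (m j k : nat) : rat :=
  (m < k)%N%:R * ((m%:R + j%:R - k%:R) * (k%:R - 2 * m%:R))
  + (k < j)%N%:R * ((j%:R - k%:R) * (j%:R - k%:R - m%:R)).

Lemma Lop_phi m j x : (0 < m)%N -> Lop m (phi j x) = phi j (Lop m x) + E2 (m + j) (cL m j) x.
Proof.
move=> m0; have -> : E2 (m + j) (cL m j) x =
   \sum_(a < j.+1) (0 < a < j)%N%:R *: ((j%:R - a%:R) *:
     ((a%:R - m%:R) *: eps (m + a) (eps (j - a) x)
      + (j%:R - a%:R - m%:R) *: eps a (eps (m + j - a) x))).
  transitivity (\sum_(a < j.+1) ((0 < a < j)%N%:R * ((j%:R - a%:R) * (a%:R - m%:R)))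
       *: eps (m + a) (eps (j - a) x)
     + \sum_(a < j.+1) ((0 < a < j)%N%:R * ((j%:R - a%:R) * (j%:R - a%:R - m%:R)))
       *: eps a (eps (m + j - a) x)); last first.
    by rewrite -big_split; apply: eq_bigr => a _; rewrite /= !scalerDr !scalerA !mulrA.
  rewrite E2D; congr (_ + _).
    rewrite E2.unlock -(addnS m) big_split_ord /= big1 ?add0r => [|a _]; last first.
      by rewrite (_ : (m < a)%N = false) ?mul0r ?scale0r //; apply/negbTE; rewrite -leqNgt ltnW.
    apply: eq_bigr => a _; rewrite subnDl -{1}(addn0 m) ltn_add2l natrD.
    have := ltn_ord a; rewrite ltnS leq_eqVlt => /predU1P[->|->]; last first.
      by rewrite andbT; congr (_ *: _); ring.
    by rewrite subnn eps0 eps0r !scaler0.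
  have jmj : (j.+1 <= (m + j).+1)%N by rewrite ltnS leq_addl.
  rewrite E2.unlock [RHS](big_ord_widen _ (fun a : nat =>
     ((0 < a < j)%N%:R * ((j%:R - a%:R) * (j%:R - a%:R - m%:R)))
       *: eps a (eps (m + j - a) x)) jmj) [RHS]big_mkcond.
  apply: eq_bigr => a _; have [->|a0] := posnP a; first by rewrite /= eps0 !scaler0.
  case: (ltnP a j) => [aj|ja] /=; first by rewrite ltnS (ltnW aj).
  by rewrite !mul0r !scale0r if_same.
rewrite ![phi j _]phi_sum.
transitivity (\sum_(a < j.+1) (j%:R - a%:R) *: Lop m (eps a (eps (j - a) x))).
  rewrite Lop.unlock !linear_sum -big_split; apply: eq_bigr => a _ /=.
  by rewrite !(epsZ, ddZ) scalerDr.
rewrite -big_split; apply: eq_bigr => a _ /=.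
have [->|a0] := posnP a; first by rewrite !(eps0, eps0r, Lop0r, scaler0, scale0r, addr0).
have lea : (a <= j)%N by rewrite -ltnS.
have [->|ja] := eqVneq (nat_of_ord a) j.
  by rewrite ltnn /= subnn !(eps0, eps0r, Lop0r, scaler0, scale0r, addr0).
have aj : (a < j)%N by rewrite ltn_neqAle ja.
rewrite aj /= scale1r -!scalerDr; congr (_ *: _).
rewrite Lop_eps // Lop_eps ?subn_gt0 // !eps_lin natrB //.
by rewrite addnBA //; lin.
Qed.

Definition cB (i j k : nat) : rat :=
  (i%:R + j%:R - k%:R) * (3 * i%:R) - (k == i)%N%:R * (i%:R * j%:R)
  - (k < i)%N%:R * (3 * (i%:R + j%:R) * (i%:R - k%:R)).

HB.lock Definition Kop (m : nat) (x : chain) : chain := Gam (eps m x) - eps m (Gam x).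

Lemma KopE m x : Kop m x = dd (phi m x) - phi m (dd x) + dl (Lop m x) - Lop m (dl x).
Proof.
rewrite Kop.unlock !GamE dl_eps dd_eps ddB dlB dl_eps dd_eps epsD; lin.
Qed.

Lemma E2_cB0 i x : E2 i (cB i 0) x = 0.
Proof.
apply: E2_sym => a b a0 b0 <-; rewrite /cB natrD !mulr0 !addr0.
have [-> ->] : (a < a + b)%N /\ (b < a + b)%N by split; lia.
by rewrite /=; ring.
Qed.

Lemma E2_c0B j x : E2 j (cB 0 j) x = 0.
Proof. by apply: E2_sym => a b a0 b0 _; rewrite /cB !ltn0 /=; ring. Qed.

(** Anticommuting [Kop m] with e_j leaves only [L_j, phi_m] - [L_m, phi_j] + (j - m) phi_(m+j).
    Neither differential occurs in it any more, so it is a mere multiplication. *)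
Lemma Kop_eps m j x : Kop m (eps j x) = E2 (m + j) (cB m j) x - eps j (Kop m x).
Proof.
have [->|m0] := posnP m.
  by rewrite Kop.unlock !eps0 !Gam0r subr0 eps0r E2_c0B subr0.
have [->|j0] := posnP j.
  by rewrite Kop.unlock !eps0 !(eps0r, Gam0r) subr0 addn0 E2_cB0 subr0.
transitivity ((Lop j (phi m x) - phi m (Lop j x)) - (Lop m (phi j x) - phi j (Lop m x))
   + (j%:R - m%:R) *: phi (m + j) x - eps j (Kop m x)).
  rewrite !KopE -eps_phi dd_eps dl_eps dd_eps Lop_eps // LopB Lop_eps // dlD dlZ !dl_eps.
  by rewrite !(phiB, epsD, epsB) -!eps_phi; lin.
have -> : E2 (m + j) (cB m j) x =
    E2 (m + j) (cL j m) x - E2 (m + j) (cL m j) x + (j%:R - m%:R) *: phi (m + j) x.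
  (* The two weights agree only up to a symmetric part; they are polynomial on each region cut out
     by comparing a and b with m and j. *)
  rewrite phi.unlock -E2Z -scaleN1r -E2Z -!E2D; apply: eq_E2 => a b a0 b0 ab.
  have eb : j%:R = a%:R + b%:R - m%:R :> rat by rewrite -natrD ab natrD; ring.
  rewrite /cB /cL natrD eb.
  case: (ltngtP a m) => am; case: (ltngtP b m) => bm; case: (ltngtP a j) => aj;
  case: (ltngtP b j) => bj; try (exfalso; lia); rewrite /= ?am ?bm; ring.
rewrite !Lop_phi // [(j + m)%N]addnC; lin.
Qed.

Lemma bin3 m : 'C(m, 3)%:R = m%:R * (m%:R - 1) * (m%:R - 2%:R) / 6%:R :> rat.
Proof.
have h k : ('C(k, 2)%:R = k%:R * (k%:R - 1) / 2%:R :> rat)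
        /\ ('C(k, 3)%:R = k%:R * (k%:R - 1) * (k%:R - 2%:R) / 6%:R :> rat).
  elim: k => [|k [IH2 IH3]]; first by split; rewrite bin0n mulr0n !mul0r.
  by rewrite !binS !natrD IH2 IH3 bin1 -[k.+1%:R]natr1; split; field.
exact: (h m).2.
Qed.

Lemma Lop1 m : Lop m (mono [::]) = 0.
Proof. by rewrite Lop.unlock dd_eps1 dd1 eps0r addr0. Qed.

Lemma sum_sq (m : nat) t : \sum_(a < t.+1) (m%:R - a%:R) * (m%:R - a%:R - a%:R) =
  t.+1%:R * m%:R ^+ 2 - 3%:R * m%:R * (t%:R * (t%:R + 1)) / 2%:R
  + t%:R * (t%:R + 1) * (2%:R * t%:R + 1) / 3%:R :> rat.
Proof.
elim: t => [|t IH]; first by rewrite big_ord_recl big_ord0 /=; field.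
by rewrite big_ord_recr /= IH -[t.+2%:R]natr1 -[t.+1%:R]natr1; field.
Qed.

(** On the unit the commutator gives d(delta(e_m)), which is e_m times the sum of (b - a)^2 over a <
    b, a + b = m. This is the origin of the binomial coefficients in E(I). *)
Lemma Kop1 m : Kop m (mono [::]) = ('C(m, 3))%:R *: eps m (mono [::]).
Proof.
rewrite KopE Lop1 dl1 dd1 phi0r dl0r Lop0r !subr0 addr0 phi_sum linear_sum.
transitivity (\sum_(a < m.+1) ((0 < a)%N%:R * ((m%:R - a%:R) * (m%:R - a%:R - a%:R)))
   *: eps m (mono [::])).
  apply: eq_bigr => a _; rewrite /= ddZ dd_eps dd_eps1 eps0r subr0.
  have [->|a0] := posnP a; first by rewrite Lop.unlock !(eps0, dd0r, addr0, scaler0, mul0r, scale0r).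
  have lea : (a <= m)%N by rewrite -ltnS.
  have [->|ma] := eqVneq (nat_of_ord a) m.
    by rewrite subrr !(subnn, eps0, Lop0r, mul0r, mulr0, scale0r).
  rewrite Lop_eps ?subn_gt0 // ?ltn_neqAle ?ma // Lop1 eps0r add0r subnKC // natrB //.
  by rewrite scalerA mul1r.
rewrite -scaler_suml; congr (_ *: _).
rewrite big_ord_recl mul0r add0r.
transitivity (\sum_(a < m) (m%:R - a.+1%:R) * (m%:R - a.+1%:R - a.+1%:R) : rat).
  by apply: eq_bigr => a _; rewrite lift0 mul1r.
have := sum_sq m m; rewrite big_ord_recl.
rewrite (eq_bigr (fun a : 'I_m => (m%:R - a.+1%:R) *
  (m%:R - a.+1%:R - a.+1%:R : rat))) => [|a _]; last by rewrite lift0.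
move/(canRL (addKr _)) ->; rewrite bin3 -[m.+1%:R]natr1 /= mulr0n; by field.
Qed.

(** Removing the value on the unit makes D_m vanish there, and then [Dop_eps] determines it on all
    chains. *)
HB.lock Definition Dop (m : nat) (x : chain) : chain := Kop m x - ('C(m, 3))%:R *: eps m x.

Lemma Gam_eps m x : Gam (eps m x) = eps m (Gam x) + ('C(m, 3))%:R *: eps m x + Dop m x.
Proof. by rewrite Dop.unlock Kop.unlock; lin. Qed.

Lemma Dop_is_linear m : linear (Dop m).
Proof. by move=> c x y; rewrite Dop.unlock Kop.unlock !(epsD, epsZ, GamD, GamZ); lin. Qed.
HB.instance Definition _ m := GRing.isLinear.Build rat chain chain _ (Dop m) (Dop_is_linear m).

Lemma DopZ m c x : Dop m (c *: x) = c *: Dop m x. Proof. exact: linearZZ. Qed.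
Lemma Dop0r m : Dop m 0 = 0. Proof. exact: linear0. Qed.

Lemma Dop1 m : Dop m (mono [::]) = 0.
Proof. by rewrite Dop.unlock Kop1 subrr. Qed.

Lemma Dop_eps m j x : Dop m (eps j x) = E2 (m + j) (cB m j) x - eps j (Dop m x).
Proof. by rewrite Dop.unlock Kop_eps epsB epsZ [eps m (eps j x)]epsC; lin. Qed.

(** In the commutator of D_i with e_a ^ e_(j-a), this is the term in which e_a stays and D_i meets
    the second factor; [E3_right] treats the other term. *)
Lemma E3_left (i j : nat) (c : nat -> nat -> rat) x :
  \sum_(a < j.+1) (j%:R - a%:R) *: eps a (E2 (i + (j - a)) (c a) x) =
  E3 (i + j) (fun u v w => (u <= j)%N%:R * ((j%:R - u%:R) * c u v)) x.
Proof.
have le : (j.+1 <= (i + j).+1)%N by rewrite ltnS leq_addl.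
rewrite (big_ord_widen _ (fun a => (j%:R - a%:R) *: eps a (E2 (i + (j - a)) (c a) x)) le).
rewrite E3.unlock big_mkcond; apply: eq_bigr => u _.
case: ifP => uj; last first.
  rewrite big1 // => v _; rewrite big1 // => w _.
  by rewrite -ltnS uj mul0r scale0r.
rewrite E2.unlock linear_sum scaler_sumr.
rewrite (@pair_sum _ (i + j) (fun v w => (j%:R - u%:R) *: eps u (c u v *: eps v (eps w x)))).
  apply: eq_bigr => v _; apply: eq_big => [w|w _]; first lia.
  by rewrite epsZ scalerA -ltnS uj mul1r.
by lia.
Qed.

Lemma E3_right (i j : nat) (c : nat -> nat -> rat) x :
  \sum_(a < j.+1) (j%:R - a%:R) *: E2 (i + a) (c (j - a)%N) (eps (j - a) x) =
  E3 (i + j) (fun u v w => (w <= j)%N%:R * (w%:R * c w u)) x.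
Proof.
rewrite (reindex_inj rev_ord_inj) /=.
transitivity (\sum_(w < j.+1) w%:R *: E2 (i + (j - w)) (c w) (eps w x)).
  apply: eq_bigr => w _; have wj : (w <= j)%N by rewrite -ltnS.
  by rewrite subSS subKn // natrB // subKr.
have le : (j.+1 <= (i + j).+1)%N by rewrite ltnS leq_addl.
rewrite (big_ord_widen _ (fun w => w%:R *: E2 (i + (j - w)) (c w) (eps w x)) le).
transitivity (\sum_(w < (i + j).+1) \sum_(u < (i + j).+1) \sum_(v < (i + j).+1 | (u + v + w == i + j)%N)
   ((w <= j)%N%:R * (w%:R * c w u)) *: eps u (eps v (eps w x))).
  rewrite big_mkcond; apply: eq_bigr => w _; case: ifP => wj; last first.
    rewrite big1 // => v _; rewrite big1 // => u _.
    by rewrite -ltnS wj mul0r scale0r.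
  rewrite E2.unlock scaler_sumr.
  rewrite (@pair_sum _ (i + j) (fun u v => w%:R *: (c w u *: eps u (eps v (eps w x))))).
    apply: eq_bigr => v _; apply: eq_big => [u|u _]; first lia.
    by rewrite scalerA -ltnS wj mul1r.
  by lia.
rewrite E3.unlock exchange_big; apply: eq_bigr => u _.
under eq_bigr do rewrite big_mkcond.
by rewrite exchange_big; apply: eq_bigr => v _; rewrite -big_mkcond.
Qed.

(** The weight [cB] with a rational second index, so that [j - u] is a true difference even where
    truncated subtraction would not be. *)
Definition cBr (i : nat) (J : rat) (k : nat) : rat :=
  (i%:R + J - k%:R) * (3 * i%:R) - (k == i)%N%:R * (i%:R * J)
  - (k < i)%N%:R * (3 * (i%:R + J) * (i%:R - k%:R)).

(* The weight of the commutator of D_i with [phi j], normalised modulo [EF_rel] so as to be supported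
   on k <= i and k > j. *)
Definition qG (i j k : nat) : rat :=
  - ((k == i)%N%:R * (i%:R * j%:R))
  - (k < i)%N%:R * (3 * (i%:R - k%:R) * (j%:R + 2 * k%:R))
  - (j < k)%N%:R * (3 * (k%:R - j%:R) * (2 * k%:R - j%:R)).

(** An identity of weights modulo [E3_alt]: j is eliminated through a + b + c = i + j, and the rest
    is polynomial on each region cut out by comparing a, b, c with i and j. *)
Lemma EF_qG i j x :
  E3 (i + j) (fun u v w => (w <= j)%N%:R * (w%:R * cBr i (j%:R - w%:R) u)) x
  - E3 (i + j) (fun u v w => (u <= j)%N%:R * ((j%:R - u%:R) * cBr i (j%:R - u%:R) v)) x
  = EF (i + j) (qG i j) x.
Proof.
apply/eqP; rewrite -subr_eq0 EF_E3 -scaleN1r -E3Z -E3D -scaleN1r -E3Z -E3D; apply/eqP.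
apply: E3_alt => a b c a0 b0 c0 abc.
have ej : j%:R = a%:R + b%:R + c%:R - i%:R :> rat by rewrite -!natrD abc natrD; ring.
rewrite /qG /cBr ej.
case: (ltngtP a i) => ai; case: (ltngtP b i) => bi; case: (ltngtP c i) => ci;
case: (leqP a j) => aj; case: (leqP b j) => bj; case: (leqP c j) => cj;
try (exfalso; lia); rewrite /= ?ai ?bi ?ci; ring.
Qed.

Lemma Dop_phi i j x : Dop i (phi j x) = phi j (Dop i x) + EF (i + j) (qG i j) x.
Proof.
rewrite -EF_qG -(@E3_left i j (fun u => cBr i (j%:R - u%:R))).
rewrite -(@E3_right i j (fun w => cBr i (j%:R - w%:R))).
rewrite !phi_sum linear_sum -sumrB -big_split; apply: eq_bigr => a _ /=.
have lea : (a <= j)%N by rewrite -ltnS.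
have ea : cB i a = cBr i (j%:R - (j - a)%N%:R) by rewrite natrB // subKr.
have eb : cB i (j - a) = cBr i (j%:R - a%:R) by rewrite /cB natrB.
by rewrite DopZ !Dop_eps epsB -ea -eb; lin.
Qed.

(** Since delta commutes with Gamma and phi_m is the anticommutator of delta with e_m, the remainder
    in the commutator of Gamma with phi_m is the anticommutator of delta with D_m. *)
HB.lock Definition Dop' (m : nat) (x : chain) : chain := dl (Dop m x) + Dop m (dl x).

Lemma Gam_phi m x : Gam (phi m x) = phi m (Gam x) + ('C(m, 3))%:R *: phi m x + Dop' m x.
Proof.
have e y : phi m y = dl (eps m y) + eps m (dl y) by rewrite dl_eps subrK.
rewrite !e GamD Gam_dl !Gam_eps Gam_dl !dlD dlZ Dop'.unlock; lin.
Qed.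

Lemma Dop'1 m : Dop' m (mono [::]) = 0.
Proof. by rewrite Dop'.unlock Dop1 dl1 Dop0r dl0r addr0. Qed.

Lemma Dop'_phi i j x : Dop' i (phi j x) = phi j (Dop' i x) + FF (i + j) (qG i j) x.
Proof.
by rewrite Dop'.unlock dl_phi !Dop_phi dlD dl_phi dl_EF phiD; lin.
Qed.

(** * The order on words *)

(* A word is a product of factors e_i for i in [s] and delta(e_j) for j in [J]. *)
Definition word_dp (s J : seq nat) : seq nat * seq nat := (sort leq (s ++ J), sort leq J).

Lemma perm_msdiff (I J s : seq nat) : perm_eq I (J ++ s) -> perm_eq (msdiff I J) s.
Proof.
rewrite /msdiff; elim: J s => [|j J IH] s //= h.
have /IH/(perm_rem j) : perm_eq I (J ++ j :: s).
  by rewrite (permPl h) -(cat1s j (J ++ s)) -(cat1s j s) perm_catCA.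
by rewrite /= eqxx.
Qed.

Lemma msdiff_subseq I J : subseq (msdiff I J) I.
Proof.
by elim: J => [|j J IH] //=; apply: subseq_trans IH; apply: rem_subseq.
Qed.

Lemma sort_nat_sorted (s : seq nat) : sorted leq (sort leq s).
Proof. exact: (sort_sorted leq_total). Qed.

Lemma perm_sorted_eq (s t : seq nat) : sorted leq s -> sorted leq t -> perm_eq s t -> s = t.
Proof. exact: (sorted_eq leq_trans anti_leq). Qed.

Lemma sort_nat_id (s : seq nat) : sorted leq s -> sort leq s = s.
Proof. exact: (sorted_sort leq_trans). Qed.

Lemma perm_sort_eq (s t : seq nat) : perm_eq s t -> sort leq s = sort leq t.
Proof.
move=> st; apply: perm_sorted_eq; rewrite ?sort_nat_sorted //.
by rewrite perm_sort perm_sym perm_sort perm_sym.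
Qed.

Lemma msdiff_word_dp (s J : seq nat) :
  msdiff (word_dp s J).1 (word_dp s J).2 = sort leq s.
Proof.
apply: perm_sorted_eq; rewrite ?sort_nat_sorted //.
  exact: (subseq_sorted leq_trans (msdiff_subseq _ _) (sort_nat_sorted _)).
rewrite perm_sym perm_sort perm_sym; apply: perm_msdiff.
by rewrite perm_sort perm_catC perm_cat2r perm_sym perm_sort.
Qed.

(** These words have a distinguished pair; all others are zero as chains ([wd_bad]), so they may be
    dropped from any expansion. *)
Definition good (s J : seq nat) : bool := [&& uniq s, 0%N \notin s & 0%N \notin J].

Lemma all_pos (s : seq nat) : all (ltn 0) s = (0%N \notin s).
Proof.
apply/allP/idP => [h|h i si]; first by apply/negP => /h.
by rewrite /= lt0n; apply: contraNneq h => <-.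
Qed.

Lemma good_dist s J : good s J -> distinguished (word_dp s J).
Proof.
case/and3P=> us s0 J0; rewrite /distinguished msdiff_word_dp strict1_sort us s0 andbT.
rewrite /partition1 /= sort_nat_sorted all_sort all_pos mem_cat negb_or s0 J0 /=.
by rewrite andbT; apply: (subseq_sort leq_total leq_trans); apply: suffix_subseq.
Qed.

Definition cub (s : seq nat) : nat := sumn [seq (x ^ 3)%N | x <- s].
(** One third of the derivative of [cub] at [a] in the direction [b]. *)
Definition sqdot (a b : seq nat) : nat := sumn [seq (p.1 ^ 2 * p.2)%N | p <- zip a b].

Lemma cub_perm s t : perm_eq s t -> cub s = cub t.
Proof. by move=> st; apply: perm_sumn; apply: perm_map. Qed.

(* Abel summation; [m] bounds the parts of [a] from below and [d] is the accumulated difference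
   of the partial sums. *)
Lemma abel_dominance (a b : seq nat) (m d : nat) : path leq m a -> size b = size a ->
  (forall r, (sumn (take r b) <= sumn (take r a) + d)%N) -> sumn b = (sumn a + d)%N ->
  (m ^ 2 * d + cub a <= sqdot a b)%N.
Proof.
elim: a b m d => [|x a IH] [|y b] m d //=; first by rewrite /cub /sqdot /= => _ _ _; nia.
move=> /andP[mx pa] [szb] h sumb.
have h1 := h 1%N; rewrite /= take0 !addn0 in h1; rewrite take0 /= addn0 in h1.
have := IH b x (x + d - y)%N pa szb.
have H r : (sumn (take r b) <= sumn (take r a) + (x + d - y))%N.
  by have := h r.+1; rewrite /=; lia.
move=> /(_ H); rewrite /cub /sqdot /= -/(cub a) -/(sqdot a b) => IH'.
have {}IH' := IH' ltac:(lia).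
have e : (x ^ 2 * (x + d - y) + x ^ 2 * y = x ^ 3 + x ^ 2 * d)%N.
  by rewrite -mulnDr subnK // mulnDr -expnSr.
have : (m ^ 2 * d <= x ^ 2 * d)%N by rewrite leq_mul2r leq_sqr mx orbT.
lia.
Qed.

(** The cube is convex on nonnegative numbers: it lies above its tangent at x, strictly so away from
    x. *)
Lemma sqdot_cub (a b : seq nat) : size b = size a ->
  (3 * sqdot a b <= cub b + 2 * cub a ?= iff (a == b))%N.
Proof.
elim: a b => [|x a IH] [|y b] //= [/IH {}IH].
rewrite /sqdot /cub /= -/(sqdot a b) -/(cub a) -/(cub b) eqseq_cons.
have xy : (3 * (x ^ 2 * y) <= y ^ 3 + 2 * x ^ 3 ?= iff (x == y))%N.
  have aux k (C : bool) n : (k == 0)%N = C -> (n <= n + k ?= iff C)%N.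
    by move=> <-; split; rewrite ?leq_addr // -{1}[n]addn0 eqn_add2l eq_sym.
  have [le|/ltnW le] := leqP x y; have := subnKC le.
    set d := (y - x)%N => <-.
    have -> : ((x + d) ^ 3 + 2 * x ^ 3 = 3 * (x ^ 2 * (x + d)) + (3 * x + d) * d ^ 2)%N by lia.
    apply: aux; rewrite -{2}[x]addn0 eqn_add2l [RHS]eq_sym.
    have [->|d0] := posnP d; first by rewrite muln0.
    by rewrite !gtn_eqF // muln_gt0 addn_gt0 d0 orbT expn_gt0 d0.
  set d := (x - y)%N => <-.
  have -> : (y ^ 3 + 2 * (y + d) ^ 3 = 3 * ((y + d) ^ 2 * y) + (3 * y + 2 * d) * d ^ 2)%N by lia.
  apply: aux; rewrite -{3}[y]addn0 eqn_add2l.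
  have [->|d0] := posnP d; first by rewrite exp0n // muln0.
  by rewrite !gtn_eqF //; nia.
have := leqif_add xy IH; rewrite !mulnDr [(y ^ 3 + _ + _)%N](AC (2*2) ((1*3)*(2*4))) //.
Qed.

(** Abel summation and the tangent inequality give 3 [cub a] <= 3 [sqdot a b] < [cub b] + 2
    [cub a]. *)
Lemma cub_dominance (a b : seq nat) : sorted leq a -> size b = size a ->
  (forall r, (sumn (take r b) <= sumn (take r a))%N) -> sumn b = sumn a -> a <> b ->
  (cub a < cub b)%N.
Proof.
move=> sa szb h sumb nab; have pa : path leq 0 a by case: a sa {szb h sumb nab}.
have := @abel_dominance a b 0 0 pa szb; rewrite !addn0 => /(_ _ sumb) h1.
have {}h1 : (cub a <= sqdot a b)%N by apply: h1 => r; rewrite addn0.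
by have := ltn_leqif (sqdot_cub szb); rewrite (introF eqP nab) /= => h2; lia.
Qed.

(** Legendre duality: the sum of the r smallest parts of a sorted S is the maximum over t of r t
    minus the sum of the truncated differences t - l, attained at t = S_r ([sum_take_eq]). Dominance
    thus becomes a comparison of sums that do not see the order of the parts. *)
Lemma sum_take_ge (S : seq nat) (t r : nat) : (r <= size S)%N ->
  (r * t <= sumn (take r S) + sumn [seq t - l | l <- S])%N.
Proof.
elim: S r => [|l S IH] [|r] //=; rewrite ?ltnS ?take0 // => /IH h.
by rewrite mulSn; lia.
Qed.

Lemma sum_take_eq (S : seq nat) (r : nat) : sorted leq S -> (r < size S)%N ->
  (r * nth 0 S r = sumn (take r S) + sumn [seq nth 0 S r - l | l <- S])%N.
Proof.
move=> sS rS; set t := nth 0%N S r.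
rewrite -{2}(cat_take_drop r S) map_cat sumn_cat.
have -> : sumn [seq (t - l)%N | l <- drop r S] = 0%N.
  have zeros (T : seq nat) : all (leq t) T -> sumn [seq (t - l)%N | l <- T] = 0%N.
    by elim: T => //= l T IH /andP[/eqP-> /IH->].
  apply: zeros; have := drop_sorted r sS; rewrite (drop_nth 0%N rS) /= leqnn => p.
  exact: (order_path_min leq_trans p).
have sz : size (take r S) = r by rewrite size_takel // ltnW.
have : all (fun l => l <= t)%N (take r S).
  apply/(all_nthP 0%N) => i; rewrite sz => ir; rewrite nth_take //.
  apply: (sorted_leq_nth leq_trans leqnn 0%N sS); rewrite ?inE ?(ltn_trans ir) //.
  exact: ltnW.
rewrite addn0 -{2}sz; elim: (take r S) => [|l T IH] //= /andP[lt /IH].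
by rewrite mulSn; lia.
Qed.

Lemma sum_take_sort_le (S S' : seq nat) (r : nat) : size S' = size S -> sumn S' = sumn S ->
  (forall t, sumn [seq t - l | l <- S] <= sumn [seq t - l | l <- S'])%N ->
  (sumn (take r (sort leq S')) <= sumn (take r (sort leq S)))%N.
Proof.
move=> sz sm h; have [le|gt] := leqP (size S) r.
  rewrite !take_oversize ?size_sort ?sz // (perm_sumn (permEl (perm_sort _ _))).
  by rewrite (perm_sumn (permEl (perm_sort _ _))) sm.
have gt' : (r < size (sort leq S'))%N by rewrite size_sort sz.
have := sum_take_eq (sort_nat_sorted S') gt'; set t := nth _ _ _ => e.
have := @sum_take_ge (sort leq S) t r; rewrite size_sort => /(_ (ltnW gt)).
have ps (T : seq nat) : sumn [seq t - l | l <- sort leq T]%N = sumn [seq t - l | l <- T]%N.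
  by apply/perm_sumn/perm_map; rewrite perm_sort.
by move: e; rewrite !ps; have := h t; lia.
Qed.

Lemma dp_degree_word s J : dp_degree (word_dp s J) = sumn (s ++ J).
Proof. by rewrite /dp_degree; apply: perm_sumn; rewrite perm_sort. Qed.

Lemma dp_dim_word s J : dp_dim (word_dp s J) = (size s + 2 * size J)%N.
Proof. by rewrite /dp_dim /= !size_sort size_cat; lia. Qed.

(** Moving two parts apart with a fixed sum cannot decrease the sums of truncated differences t - l,
    which are convex in l; this gives case (ii). The cubes show that the partition really
    changes. *)
Lemma prec_spread (s J s' J' R : seq nat) (x y x' y' : nat) :
  good s J -> good s' J' -> size J' = size J ->
  perm_eq (s ++ J) [:: x, y & R] -> perm_eq (s' ++ J') [:: x', y' & R] ->
  (x' < x)%N -> (x <= y)%N -> (x' + y' = x + y)%N ->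
  prec_case (word_dp s' J') (word_dp s J).
Proof.
move=> g g' sJ pI pI' x'x xy exy.
have ncub : cub (s' ++ J') <> cub (s ++ J).
  rewrite (cub_perm pI) (cub_perm pI') /cub /= => e.
  have cube (a D f : nat) : (a ^ 3 + (a + 2 * D + f) ^ 3 =
      (a + D) ^ 3 + (a + D + f) ^ 3 + 3 * (D * ((D + f) * (2 * a + 2 * D + f))))%N.
    by lia.
  have D0 : (0 < x - x')%N by lia.
  have := cube x' (x - x')%N (y - x)%N.
  rewrite (_ : x' + 2 * (x - x') + (y - x) = y')%N; last by lia.
  rewrite subnKC ?(ltnW x'x) // subnKC // => h.
  have : (0 < (x - x') * ((x - x' + (y - x)) * (2 * x' + 2 * (x - x') + (y - x))))%N.
    by rewrite !(muln_gt0, addn_gt0) D0 orbT.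
  by move: h e; set Z := (X in (3 * X)%N) => h e Z0; move: h e Z0; rewrite -/Z; move: Z; lia.
have nI : (word_dp s' J').1 <> (word_dp s J).1.
  move=> e; apply: ncub; rewrite -(cub_perm (permEl (perm_sort leq _))) [sort _ _]e.
  by rewrite (cub_perm (permEl (perm_sort leq _))).
have sz : size (s' ++ J') = size (s ++ J) by rewrite (perm_size pI) (perm_size pI').
have sm : sumn (s' ++ J') = sumn (s ++ J).
  by rewrite (perm_sumn pI) (perm_sumn pI') /= !addnA exy.
split.
- by rewrite !good_dist.
- by move=> e; apply: nI; rewrite e.
- by rewrite !dp_degree_word.
- by rewrite !dp_dim_word; move: sz; rewrite !size_cat sJ => /addIn ->.
constructor 2; split => //; first by rewrite !size_sort.
move=> r _; apply: sum_take_sort_le => // t.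
rewrite (perm_sumn (perm_map _ pI)) (perm_sumn (perm_map _ pI')) /=.
by lia.
Qed.

Lemma prec_merge (s J : seq nat) (x y : nat) :
  good (x :: y :: s) J -> (x < y)%N ->
  prec_case (word_dp s (x + y :: J)%N) (word_dp (x :: y :: s) J).
Proof.
move=> g xy; have g' : good s (x + y :: J)%N.
  move: g; rewrite /good /= !inE !negb_or => /and3P[/andP[_ /andP[_ ->]]] /and3P[x0 y0 ->] ->.
  by rewrite andbT /= eq_sym; lia.
have nsz : size (word_dp s (x + y :: J)%N).1 != size (word_dp (x :: y :: s) J).1.
  by rewrite !size_sort /= !size_cat /=; lia.
split.
- by rewrite !good_dist.
- by move=> e; case/eqP: nsz; rewrite e.
- by rewrite !dp_degree_word /= !sumn_cat /=; lia.
- by rewrite !dp_dim_word /=; lia.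
constructor 3; split; first by rewrite !size_sort /= !size_cat /=; lia.
apply: rt_step; exists x, y; split => //.
- by rewrite msdiff_word_dp mem_sort inE eqxx.
- by rewrite msdiff_word_dp mem_sort !inE eqxx orbT.
rewrite /word_dp; congr (_, _); apply: perm_sort_eq => /=.
  rewrite -cat1s perm_catCA /= perm_cons perm_sym.
  have h1 : perm_eq (rem y (sort leq [:: x, y & s ++ J])) (x :: s ++ J).
    have h : perm_eq (sort leq [:: x, y & s ++ J]) [:: y, x & s ++ J].
      by rewrite perm_sort; apply/permP => a /=; lia.
    by move/(perm_rem y): h; rewrite /= eqxx.
  by move/(perm_rem x): h1; rewrite /= eqxx.
by rewrite perm_cons perm_sym perm_sort.
Qed.

Lemma sort_insert_lt (J : seq nat) (x y : nat) : (x < y)%N ->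
  ((sort leq (x :: J) : seqlexi nat) < sort leq (y :: J))%O.
Proof.
move=> xy; rewrite (perm_sort_eq (_ : perm_eq (x :: J) (x :: sort leq J))); last first.
  by rewrite perm_cons perm_sym perm_sort.
rewrite [sort leq (y :: J)](perm_sort_eq (_ : perm_eq (y :: J) (y :: sort leq J))); last first.
  by rewrite perm_cons perm_sym perm_sort.
have := sort_nat_sorted J; elim: (sort leq J) => [|z T IH] sT.
  by rewrite !sort_nat_id //= ltxi_cons !leEnat (ltnW xy) leqNgt xy.
have aT : all (leq z) T := order_path_min leq_trans sT.
have consE w : (z <= w)%N -> sort leq [:: w, z & T] = z :: sort leq (w :: T).
  move=> zw; apply: perm_sorted_eq; rewrite ?sort_nat_sorted //=.
    rewrite path_min_sorted ?sort_nat_sorted //; apply/allP => i; rewrite mem_sort inE.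
    by case/predU1P=> [->//|]; apply: (allP aT).
  by rewrite perm_sort -(cat1s w) -(cat1s z) perm_catCA perm_cons perm_sym perm_sort.

have [zx|xz] := leqP z x.
  rewrite !consE ?(leq_trans zx (ltnW xy)) // ltxi_cons lexx /=.
  by apply: IH; apply: path_sorted sT.
rewrite (sort_nat_id (_ : sorted leq [:: x, z & T])) /=; last by rewrite ltnW.
have [zy|yz] := leqP z y.
  by rewrite consE // ltxi_cons !leEnat (ltnW xz) leqNgt xz.
rewrite (sort_nat_id (_ : sorted leq [:: y, z & T])) /=; last by rewrite ltnW.
by rewrite ltxi_cons !leEnat (ltnW xy) leqNgt xy.
Qed.

Lemma prec_lex (s J s' J' J0 : seq nat) (x y : nat) :
  good s J -> good s' J' -> perm_eq (s ++ J) (s' ++ J') ->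
  perm_eq J (y :: J0) -> perm_eq J' (x :: J0) -> (x < y)%N ->
  prec_case (word_dp s' J') (word_dp s J).
Proof.
move=> g g' pI pJ pJ' xy.
have lt : ((sort leq J' : seqlexi nat) < sort leq J)%O.
  by rewrite (perm_sort_eq pJ) (perm_sort_eq pJ'); apply: sort_insert_lt.
have eI : sort leq (s' ++ J') = sort leq (s ++ J) by apply: perm_sort_eq; rewrite perm_sym.
split.
- by rewrite !good_dist.
- by case=> _ e; rewrite e ltxx in lt.
- by rewrite /dp_degree /= eI.
- by rewrite /dp_dim /= eI !size_sort (perm_size pJ) (perm_size pJ').
by constructor 1.
Qed.

(** * A rank that decreases along the order *)

Fixpoint lexval (n : nat) (J : seq nat) : nat :=
  if J is j :: J' then (j * n.+1 ^ size J' + lexval n J')%N else 0%N.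

Lemma lexval_bound n J : all (geq n) J -> (lexval n J < n.+1 ^ size J)%N.
Proof.
elim: J => [|j J IH] //= /andP[jn /IH h]; rewrite expnS mulSn.
by apply: (@leq_ltn_trans (n * n.+1 ^ size J + lexval n J)%N); [rewrite leq_add2r leq_mul2r jn orbT|lia].
Qed.

Lemma lexval_lt n (J' J : seq nat) : size J' = size J -> all (geq n) J' ->
  ((J' : seqlexi nat) < J)%O -> (lexval n J' < lexval n J)%N.
Proof.
elim: J' J => [|j' J' IH] [|j J] //= [sz] /andP[j'n aJ']; rewrite ltxi_cons !leEnat.
have [lt|gt|->] := ltngtP j' j; rewrite ?andbF //= => h; last by rewrite sz ltn_add2l IH.
apply: (@leq_trans (j'.+1 * n.+1 ^ size J)%N).
  by rewrite mulSn [X in (_ < X)%N]addnC -sz ltn_add2l lexval_bound.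
by apply: leq_trans (leq_addr _ _); rewrite leq_mul2r lt orbT.
Qed.

(* The sum of the cubes decides first, then [J] read in base n + 1; [rk] decreases along [prec]. *)
Definition rk (p : seq nat * seq nat) : nat :=
  let n := sumn p.1 in ((n ^ 3 - cub p.1) * n.+1 ^ n.+1 + lexval n p.2)%N.

Lemma cub_bound s : (cub s <= sumn s ^ 3)%N.
Proof.
elim: s => [|x s IH] //=; rewrite /cub /= -/(cub s).
by apply: leq_trans (_ : x ^ 3 + sumn s ^ 3 <= _)%N; [rewrite leq_add2l|nia].
Qed.

Lemma leq_sumn s i : i \in s -> (i <= sumn s)%N.
Proof. by move=> /perm_to_rem/perm_sumn ->; apply: leq_addr. Qed.

Lemma dist_pos p : distinguished p -> 0%N \notin p.1.
Proof. by case/and3P=> /andP[_]; rewrite all_pos. Qed.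

Lemma size_sumn s : 0%N \notin s -> (size s <= sumn s)%N.
Proof.
by elim: s => //= x s IH; rewrite inE negb_or => /andP[x0 /IH]; lia.
Qed.

Lemma lexval_dist p : distinguished p ->
  all (geq (sumn p.1)) p.2 /\ (lexval (sumn p.1) p.2 < (sumn p.1).+1 ^ (sumn p.1).+1)%N.
Proof.
move=> dp; have a : all (geq (sumn p.1)) p.2.
  case/and3P: dp => _ /mem_subseq sub _; apply/allP => i /sub; exact: leq_sumn.
split=> //; apply: leq_trans (lexval_bound a) _; rewrite leq_pexp2l // leqW //.
apply: leq_trans (size_sumn (dist_pos dp)).
by case/and3P: dp => _ sub _; apply: size_subseq.
Qed.

Lemma S_step_cub p p' : S_step p p' -> 0%N \notin p.1 ->
  (cub p.1 < cub p'.1)%N /\ 0%N \notin p'.1.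
Proof.
case=> x [y [xp yp xy ->]] p0 /=.
have {}xp := mem_subseq (msdiff_subseq _ _) xp; have {}yp := mem_subseq (msdiff_subseq _ _) yp.
have pI : perm_eq p.1 [:: y, x & rem x (rem y p.1)].
  rewrite (permPl (perm_to_rem yp)) perm_cons; apply: perm_to_rem.
  by move: xp; rewrite (perm_mem (perm_to_rem yp)) inE (ltn_eqF xy).
have x0 : x != 0%N by apply: contraNneq p0 => <-.
rewrite (cub_perm pI) (cub_perm (permEl (perm_sort _ _))) mem_sort /cub /=; split; first by nia.
rewrite inE negb_or; apply/andP; split; first by lia.
by apply: contraNN p0; rewrite (perm_mem pI) !inE => ->; rewrite !orbT.
Qed.

Lemma S_chain_cub p p' : clos_refl_trans _ S_step p p' -> 0%N \notin p.1 ->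
  (p' = p \/ (cub p.1 < cub p'.1)%N) /\ 0%N \notin p'.1.
Proof.
elim=> {p p'} [p p' st /(S_step_cub st)[]|p|p q r _ IH1 _ IH2 p0]; [by split; [right|]|by split; [left|]|].
have [h1 /IH2[h2 r0]] := IH1 p0; split=> //.
case: h1 h2 => [->|lt1] [->|lt2]; [by left|by right|by right|].
by right; apply: ltn_trans lt2.
Qed.

Lemma prec_case_cub p' p : prec_case p' p ->
  (p'.1 = p.1 /\ ((p'.2 : seqlexi nat) < p.2)%O) \/ (cub p.1 < cub p'.1)%N.
Proof.
case=> /andP[dp' dp] np dg dm [[e lt]|[nI sz h]|[sz st]]; [by left| |].
  right; have /andP[/andP[s _] _] : partition1 p.1 && true by case/and3P: dp => ->.
  apply: (cub_dominance s sz) => // [r|e]; last by apply: nI.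
  case: (posnP r) => [->|r0]; first by rewrite !take0.
  have [lt|ge] := ltnP r (size p.1); first by apply: h; rewrite r0.
  by rewrite !take_oversize ?sz // [sumn _]dg.
right; case: (S_chain_cub st (dist_pos dp)) => [[e|//] _].
by rewrite e ltnn in sz.
Qed.

Lemma prec_case_rk p' p : prec_case p' p -> (rk p' < rk p)%N.
Proof.
move=> h; have := prec_case_cub h; case: h => /andP[dp' dp] _ dg dm _.
have [a' b'] := lexval_dist dp'; have [a b] := lexval_dist dp.
have dg' : sumn p'.1 = sumn p.1 := dg.
rewrite /rk dg' in a' b' *; case=> [[e lt]|lt].
  rewrite e ltn_add2l; apply: lexval_lt => //.
  by move: dm; rewrite /dp_dim e => /addnI.
have le' := cub_bound p'.1; rewrite dg' in le'.
have : ((sumn p.1 ^ 3 - cub p'.1).+1 <= sumn p.1 ^ 3 - cub p.1)%N by lia.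
rewrite -(leq_pmul2r (_ : 0 < (sumn p.1).+1 ^ (sumn p.1).+1)%N) ?expn_gt0 // mulSn.
lia.
Qed.

Lemma precP p' p : prec p' p ->
  [/\ (rk p' < rk p)%N, dp_degree p' = dp_degree p, dp_dim p' = dp_dim p &
    p'.1 = p.1 \/ (cub p.1 < cub p'.1)%N].
Proof.
elim=> {p' p} [p' p h|p q r _ [h1 h2 h3 h4] _ [k1 k2 k3 k4]].
  split; [exact: prec_case_rk|by case: h|by case: h|].
  by case: (prec_case_cub h) => [[? _]|]; [left|right].
split; [exact: ltn_trans k1|by rewrite h2|by rewrite h3|].
case: h4 k4 => [->|lt1] [e|lt2]; [by left|by right|by right; rewrite -e|].
by right; apply: ltn_trans lt1.
Qed.

Lemma prec_trans p q r : prec p q -> prec q r -> prec p r.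
Proof. exact: t_trans. Qed.

(** * Leading parts of a nonsingular partition *)

Lemma nonsingular_sorted i I : nonsingular1 (i :: I) ->
  [/\ (0 < i)%N, nonsingular1 I & all (leq (i + 3)%N) I].
Proof.
case/andP=> /andP[/= pI /andP[i0 aI]] gI; rewrite /nonsingular1 /partition1 aI.
rewrite (path_sorted pI) (path_sorted gI) i0; split=> //.
move: gI; elim: I {pI aI} i i0 => //= j I IH i i0 /andP[ij gI]; rewrite ij /=.
apply: sub_all (IH j _ gI) => [k|]; last by lia.
by apply: leq_trans; lia.
Qed.

Lemma nonsingular_ltn I : nonsingular1 I -> sorted ltn I.
Proof.
case/andP=> _; apply: sub_sorted => a b /=.
by apply: leq_trans; rewrite addn3 ltnS leqW // leqW.
Qed.

Lemma nonsingular_uniq I : nonsingular1 I -> uniq I.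
Proof. by move=> /nonsingular_ltn; rewrite ltn_sorted_uniq_leq => /andP[]. Qed.

Lemma block_heads I : nonsingular1 I ->
  [seq head 0%N B | B <- blocks I] = [seq i <- I | (i < 3)%N || (i - 3 \notin I)%N].
Proof.
elim: I => [|i I IH] // /nonsingular_sorted[i0 nI aI].
have {}IH := IH nI; have [fI bI _] := blocksP nI; have uI := nonsingular_uniq nI.
have tailE : [seq k <- I | (k < 3)%N || (k - 3 \notin i :: I)%N] =
    [seq k <- [seq k <- I | (k < 3)%N || (k - 3 \notin I)%N] | k != i + 3]%N.
  rewrite -filter_predI; apply: eq_in_filter => k kI; have := allP aI _ kI => /= ik.
  have k3 : (k < 3)%N = false by lia.
  have ki : (k - 3 == i)%N = (k == i + 3)%N by lia.
  by rewrite inE negb_or k3 ki.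
have -> : [seq k <- i :: I | (k < 3)%N || (k - 3 \notin i :: I)%N] =
    i :: [seq k <- I | (k < 3)%N || (k - 3 \notin i :: I)%N].
  rewrite /=; case: ltnP => //= i3; rewrite inE negb_or.
  have -> : (i - 3 != i)%N by lia.
  suff -> : (i - 3)%N \notin I by [].
  by apply/negP => /(allP aI); lia.
rewrite tailE -IH /=; case: (blocks I) fI bI IH => [|[|j B] Bs] //= fI bI IH.
have hd k : k \in j :: [seq head 0%N B0 | B0 <- Bs] -> k \in I.
  by rewrite IH mem_filter => /andP[].
have jI : j \in I by apply: hd; rewrite mem_head.
have uj : uniq (j :: [seq head 0%N B0 | B0 <- Bs]) by rewrite IH filter_uniq.
case: eqP => [ej|nj] /=.
  congr (_ :: _); apply/esym/all_filterP/allP => k kB; apply: contraTneq uj => ek.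
  by rewrite /= ej -ek kB.
congr (_ :: _ :: _); apply/esym/all_filterP/allP => k kB; apply/negP => /eqP ek.
have kI : (i + 3)%N \in I by rewrite -ek; apply: hd; rewrite inE kB orbT.
case: I {IH hd uj tailE uI} fI nI aI jI kI => // j' I /= [<- _] nI aI _.
rewrite inE => /predU1P[e|kI]; first by case: nj; rewrite e.
have /andP[ij _] := aI; have [_ _ aI'] := nonsingular_sorted nI.
by have := allP aI' _ kI => /=; lia.
Qed.

(** A local description in place of the recursive [blocks]. The guard drops the first part of a main
    run, which is 1 or 2. *)
Lemma leading_partsE I : nonsingular1 I ->
  leading_parts I = [seq i <- I | (2 < i)%N && (i - 3 \notin I)%N].
Proof.
move=> nI; rewrite /leading_parts /normal_form.
have := block_heads nI; case: I nI => [|i I] //= nI.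
have [i0 nI' aI] := nonsingular_sorted nI.
have tl : [seq k <- I | (k < 3)%N || (k - 3 \notin i :: I)%N] =
    [seq k <- I | (2 < k)%N && (k - 3 \notin i :: I)%N].
  by apply: eq_in_filter => k /(allP aI) /= ik; rewrite ltnNge (_ : (2 < k)%N) //; lia.
have inot : (i - 3)%N \notin i :: I.
  by rewrite inE negb_or; apply/andP; split; [lia|apply/negP => /(allP aI) /=; lia].
rewrite inot orbT andbT leqNgt tl; case: (ltnP 2 i) => i2 //=.
by case: (X in map _ X = _ -> _) => [|B Bs] /= [].
Qed.

(** * Straightening *)

Lemma tau_comb_is_linear : linear tau_comb.
Proof. exact: linext_is_linear. Qed.
HB.instance Definition _ :=
  GRing.isLinear.Build rat {malg rat[ns_dpart]} chain _ tau_comb tau_comb_is_linear.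

Definition spanned (D : seq nat * seq nat -> Prop) (x : chain) : Prop :=
  exists2 l : {malg rat[ns_dpart]}, (forall p, p \in msupp l -> D (val p)) & x = tau_comb l.

Lemma spanned0 D : spanned D 0.
Proof. by exists 0; rewrite ?linear0 // => p; rewrite msupp0 inE. Qed.

Lemma spannedD D x y : spanned D x -> spanned D y -> spanned D (x + y).
Proof.
case=> l lD -> [m mD ->]; exists (l + m); last by rewrite linearD.
move=> p /(fsubsetP (msuppD_le l m)); rewrite inE => /orP[/lD//|/mD//].
Qed.

Lemma spannedZ D c x : spanned D x -> spanned D (c *: x).
Proof.
case=> l lD ->; exists (c *: l); last by rewrite linearZZ.
by move=> p /(fsubsetP (msuppZ_le c l)) /lD.
Qed.

Lemma spannedN D x : spanned D x -> spanned D (- x).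
Proof. by rewrite -scaleN1r; apply: spannedZ. Qed.

Lemma spanned_sum D (I : Type) (r : seq I) (P : pred I) (F : I -> chain) :
  (forall i, P i -> spanned D (F i)) -> spanned D (\sum_(i <- r | P i) F i).
Proof. by move=> h; apply: big_ind => //; [exact: spanned0|exact: spannedD]. Qed.

Lemma sub_spanned (D D' : seq nat * seq nat -> Prop) x :
  (forall p, D p -> D' p) -> spanned D x -> spanned D' x.
Proof. by move=> h [l lD ->]; exists l => // p /lD /h. Qed.

Lemma spanned_tau D (p : ns_dpart) : D (val p) -> spanned D (tau_mono (val p)).
Proof.
move=> Dp; exists << p >>; last by rewrite /tau_comb linextU.
by move=> q; rewrite msuppU oner_eq0 inE => /eqP ->.
Qed.

Definition epw (s : seq nat) (x : chain) : chain := foldr eps x s.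
Definition phw (J : seq nat) (x : chain) : chain := foldr phi x J.
(** The factors delta(e_j) commute with everything, so they can be collected on the right.
    Reordering the other factors costs a scalar, whose value never matters for spans ([wd_perm]). *)
Definition wd (s J : seq nat) : chain := epw s (phw J (mono [::])).

Lemma epw_cat s t x : epw (s ++ t) x = epw s (epw t x).
Proof. by rewrite /epw foldr_cat. Qed.

Lemma epwZ s c x : epw s (c *: x) = c *: epw s x.
Proof. by elim: s => //= i s ->; rewrite epsZ. Qed.
Lemma epwD s x y : epw s (x + y) = epw s x + epw s y.
Proof. by elim: s => //= i s ->; rewrite epsD. Qed.
Lemma epwN s x : epw s (- x) = - epw s x.
Proof. by elim: s => //= i s ->; rewrite epsN. Qed.
Lemma epw0 s : epw s 0 = 0.
Proof. by elim: s => //= i s ->; rewrite eps0r. Qed.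
Lemma epw_sum s (I : Type) (r : seq I) (P : pred I) (F : I -> chain) :
  epw s (\sum_(i <- r | P i) F i) = \sum_(i <- r | P i) epw s (F i).
Proof. by apply: (big_morph (epw s) (epwD s) (epw0 s)). Qed.

Lemma phwZ s c x : phw s (c *: x) = c *: phw s x.
Proof. by elim: s => //= i s ->; rewrite phiZ. Qed.
Lemma phwD s x y : phw s (x + y) = phw s x + phw s y.
Proof. by elim: s => //= i s ->; rewrite phiD. Qed.
Lemma phw0 s : phw s 0 = 0.
Proof. by elim: s => //= i s ->; rewrite phi0r. Qed.
Lemma phw_sum s (I : Type) (r : seq I) (P : pred I) (F : I -> chain) :
  phw s (\sum_(i <- r | P i) F i) = \sum_(i <- r | P i) phw s (F i).
Proof. by apply: (big_morph (phw s) (phwD s) (phw0 s)). Qed.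

Lemma epw_phi s j x : epw s (phi j x) = phi j (epw s x).
Proof. by elim: s => //= i s ->; rewrite eps_phi. Qed.
Lemma phw_phi s j x : phw s (phi j x) = phi j (phw s x).
Proof. by elim: s => //= i s ->; rewrite phi_phi. Qed.
Lemma phw_eps s j x : phw s (eps j x) = eps j (phw s x).
Proof. by elim: s => //= i s ->; rewrite eps_phi. Qed.

Lemma wd_phi s j J : phi j (wd s J) = wd s (j :: J).
Proof. by rewrite /wd /= epw_phi. Qed.

Lemma epw_comm s t : exists c : rat, forall x, epw s (epw t x) = c *: epw t (epw s x).
Proof.
have h i : exists c : rat, forall x, eps i (epw t x) = c *: epw t (eps i x).
  elim: t => [|j t [c IH]]; first by exists 1 => x; rewrite scale1r.
  by exists (- c) => x; rewrite /= epsC IH epsZ scaleNr.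
elim: s => [|i s [c IH]]; first by exists 1 => x; rewrite scale1r.
have [d hd] := h i; exists (c * d) => x.
by rewrite /= IH epsZ hd scalerA.
Qed.

Lemma epw_perm s t : perm_eq s t -> exists c : rat, forall x, epw s x = c *: epw t x.
Proof.
move=> st; pose P u := exists c : rat, forall x, epw s x = c *: epw u x.
apply: (catCA_perm_ind (P := P) _ st); last by exists 1 => x; rewrite scale1r.
move=> s1 s2 s3 [c h]; have [d hd] := epw_comm s1 s2; exists (c * d) => x.
by rewrite h !epw_cat hd scalerA.
Qed.

Lemma phw_perm s t x : perm_eq s t -> phw s x = phw t x.
Proof.
move=> st; pose P u := phw s x = phw u x; apply: (catCA_perm_ind (P := P) _ st) => //.
move=> s1 s2 s3; rewrite /P => ->; rewrite /phw !foldr_cat -!/(phw _ _).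
by elim: s1 => //= i s1 ->; rewrite phw_phi.
Qed.

Lemma wd_perm s s' J J' : perm_eq s s' -> perm_eq J J' -> exists c : rat, wd s J = c *: wd s' J'.
Proof.
by move=> /epw_perm[c h] JJ'; exists c; rewrite /wd h (phw_perm _ JJ').
Qed.

Lemma word_dp_perm s s' J J' : perm_eq s s' -> perm_eq J J' -> word_dp s J = word_dp s' J'.
Proof.
by move=> ss JJ; congr (_, _); apply: perm_sort_eq => //; apply: perm_cat.
Qed.

Lemma good_perm s s' J J' : perm_eq s s' -> perm_eq J J' -> good s J = good s' J'.
Proof.
by move=> ss JJ; rewrite /good (perm_uniq ss) (perm_mem ss) (perm_mem JJ).
Qed.

Lemma wd_small s J j : j \in J -> (j <= 2)%N -> wd s J = 0.
Proof.
move=> /perm_to_rem JJ j2; have [c ->] := wd_perm (perm_refl s) JJ.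
by rewrite /wd /= phi_small // epw0 scaler0.
Qed.

Lemma wd_bad s J : ~~ good s J -> wd s J = 0.
Proof.
rewrite !negb_and !negbK => /or3P[us|s0|J0]; last by apply: (wd_small s J0).
  elim: s us => //= i s IH; rewrite negb_and negbK => /orP[si|/IH]; last first.
    by rewrite /wd /= => ->; rewrite eps0r.
  have [c e] := epw_perm (perm_to_rem si).
  by rewrite /wd /= e /= epsZ eps2 scaler0.
by have [c e] := epw_perm (perm_to_rem s0); rewrite /wd e /= eps0 scaler0.
Qed.

Lemma mono1_phi j : dl (mono [:: j]) = phi j (mono [::]).
Proof. by rewrite mono_cons dl_eps dl1 eps0r subr0. Qed.

Lemma wedgeDl x y z : wedge (x + y) z = wedge x z + wedge y z.
Proof. exact: (linearD (linext (fun K : strict_part =>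
    linext (fun K' : strict_part => mono (val K ++ val K')) z))). Qed.
Lemma wedgeZl c x z : wedge (c *: x) z = c *: wedge x z.
Proof. exact: (linearZZ (linext (fun K : strict_part =>
    linext (fun K' : strict_part => mono (val K ++ val K')) z))). Qed.
Lemma wedge0l z : wedge 0 z = 0.
Proof. exact: (linear0 (linext (fun K : strict_part =>
    linext (fun K' : strict_part => mono (val K ++ val K')) z))). Qed.

Lemma mono_epw s : mono s = epw s (mono [::]).
Proof. by elim: s => //= i s <-; rewrite mono_cons. Qed.

Lemma wedge_basis (K : strict_part) z : wedge << K >> z = epw (val K) z.
Proof.
rewrite /wedge linextU [z in RHS]malgE epw_sum; apply: eq_bigr => K' _.
by rewrite epwZ mono_epw epw_cat -mono_epw monoK.
Qed.

Lemma wedge_mono s z : wedge (mono s) z = epw s z.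
Proof.
have [/andP[us s0]|] := boolP (uniq s && (0%N \notin s)); last first.
  move=> h; have e J : wd s J = 0.
    by apply: wd_bad; apply: contraNN h => /and3P[-> ->].
  have z0 : forall y, epw s y = 0.
    elim/malg_ind => [|x y hx hy|d x hx|i x hx|]; rewrite ?epw0 ?epwD ?epwZ //.
    + by rewrite hx hy addr0.
    + by rewrite hx scaler0.
    + have [d ed] := epw_comm s [:: i]; have /= -> := ed x.
      by rewrite hx eps0r scaler0.
    + exact: (e [::]).
  by rewrite mono_epw !z0 wedge0l.
have [K _ Ks] := umono_basis us s0.
have sK : perm_eq s (val K) by rewrite perm_sym.
have [c e] := epw_perm sK.
by rewrite mono_epw e wedgeZl -mono_epw monoK wedge_basis e.
Qed.

Lemma wedge_phi j z : wedge (phi j (mono [::])) z = phi j z.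
Proof.
rewrite !phi_sum.
have wsum (I : Type) (r : seq I) (P : pred I) (F : I -> chain) :
    wedge (\sum_(i <- r | P i) F i) z = \sum_(i <- r | P i) wedge (F i) z.
  exact: (big_morph (wedge^~ z) (fun x y => wedgeDl x y z) (wedge0l z)).
rewrite wsum; apply: eq_bigr => a _; rewrite wedgeZl; congr (_ *: _).
by have := wedge_mono [:: nat_of_ord a; (j - a)%N] z; rewrite mono_epw.
Qed.

Lemma tau_monoE I J : tau_mono (I, J) =
  wd [seq i <- I | i \notin J] [seq i <- I | i \in J].
Proof.
rewrite /tau_mono /= unlock /=; elim: I => [|i I IH] //=; rewrite IH.
case: ifP => iJ /=; last by rewrite mono_cons -mono_cons (wedge_mono [:: i]).
have := mono1_phi i; rewrite dl.unlock => ->.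
by rewrite wedge_phi wd_phi.
Qed.

Lemma nonsingular_dpP I J : nonsingular_dp (I, J) ->
  [/\ nonsingular1 I, uniq I, subseq J I, J = [seq i <- I | i \in J] &
      {in J, forall j, (2 < j)%N && (j - 3 \notin I)%N}].
Proof.
case/andP=> /= nI; rewrite leading_partsE // => sub; have uI := nonsingular_uniq nI.
have sJ : subseq J I by apply: subseq_trans sub (filter_subseq _ _).
split=> //; first by apply/subseq_uniqP.
by move=> j /(mem_subseq sub); rewrite mem_filter => /andP[].
Qed.

Lemma tau_mono_wd I J : nonsingular_dp (I, J) ->
  tau_mono (I, J) = wd [seq i <- I | i \notin J] J.
Proof. by move=> /nonsingular_dpP[_ _ _ eJ _]; rewrite tau_monoE -eJ. Qed.

Lemma ns_word_dp I J : nonsingular_dp (I, J) ->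
  word_dp [seq i <- I | i \notin J] J = (I, J) /\ good [seq i <- I | i \notin J] J.
Proof.
move=> ns; have [nI uI sJ eJ _] := nonsingular_dpP ns.
have [/andP[/andP[sI aI] _]] := nI.
have sJ' : sorted leq J := subseq_sorted leq_trans sJ sI.
rewrite all_pos in aI; split; last first.
  rewrite /good filter_uniq // (contra _ aI) ?(contra _ aI) // => [/(mem_subseq sJ)//|].
  by rewrite mem_filter => /andP[].
rewrite /word_dp (sort_nat_id sJ'); congr (_, _).
rewrite -[RHS](sort_nat_id sI); apply: perm_sort_eq.
by rewrite {2}eJ perm_catC perm_filterC.
Qed.

(** Interpolation in the three-dimensional space of weights of [EF_rel]; the last hypothesis keeps
    x0 away from the third root n - x1 - x2. *)
Lemma EF_solve (n x0 x1 x2 : nat) : x0 != x1 -> x0 != x2 -> (x0 + x1 + x2 != n)%N ->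
  exists q, [/\ forall x, EF n q x = 0, q x0 = 1, q x1 = 0 & q x2 = 0].
Proof.
move=> n1 n2 n3; pose r (i : nat) : rat := i%:R.
have d1 : r x0 - r x1 != 0 by rewrite subr_eq0 eqr_nat.
have d2 : r x0 - r x2 != 0 by rewrite subr_eq0 eqr_nat.
have d3 : r x0 + r x1 + r x2 - r n != 0 by rewrite subr_eq0 -!natrD eqr_nat.
pose D := (r x0 - r x1) * (r x0 - r x2) * (r x0 + r x1 + r x2 - r n).
have D0 : D != 0 by rewrite !mulf_neq0.
(* The monic cubic with roots x1, x2 and n - x1 - x2 has quadratic coefficient - n. *)
exists (fun k => (r k - r x1) * (r k - r x2) * (r k + r x1 + r x2 - r n) / D); split.
- move=> x; apply: (@EF_rel n (r x1 * r x2 * (r x1 + r x2 - r n) / D)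
     ((r x1 * r x2 - (r x1 + r x2) * (r x1 + r x2 - r n)) / D) D^-1) => k _.
  by rewrite /r; field.
- by rewrite divff.
- by rewrite subrr !mul0r.
- by rewrite subrr mulr0 !mul0r.
Qed.

Lemma FF_rev n q x : FF n q x = FF n (fun k => q (n - k)%N) x.
Proof.
rewrite FF.unlock (reindex_inj rev_ord_inj); apply: eq_bigr => k _ /=.
have lek : (k <= n)%N by rewrite -ltnS.
by rewrite subSS subKn // phi_phi.
Qed.

(** The factors [phi] commute, so a weight may be added to its reversal, and k^2 (k - n) plus its
    reversal is - n k (n - k). *)
Lemma FF_rel n (a b : rat) q x : (0 < n)%N ->
  (forall k, (k <= n)%N -> q k = a + b * (k%:R * (n%:R - k%:R))) -> FF n q x = 0.
Proof.
move=> n0 h; have n0' : n%:R != 0 :> rat by rewrite pnatr_eq0 -lt0n.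
have f1 y : FF n (fun k => a + 0 * k%:R + 0 * (k%:R ^+ 2 * (k%:R - n%:R))) y = 0.
  by apply: EF_FF0 => z; apply: EF_rel => k _.
pose q2 k : rat := 0 + 0 * k%:R + (- b / n%:R) * (k%:R ^+ 2 * (k%:R - n%:R)).
have f2 y : FF n q2 y = 0 by apply: EF_FF0 => z; apply: EF_rel => k _.
transitivity (FF n (fun k => a + 0 * k%:R + 0 * (k%:R ^+ 2 * (k%:R - n%:R))) x
   + (FF n q2 x + FF n (fun k => q2 (n - k)%N) x)).
  rewrite -!FFD; apply: eq_FF => k kn; rewrite h // /q2 natrB //.
  by field.
by rewrite -FF_rev f1 f2 !addr0.
Qed.

(** The value k (n - k) identifies the unordered pair of k and n - k, and weights affine in it
    separate one such pair from another. *)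
Lemma FF_solve (n x0 x1 : nat) : (0 < n)%N -> (x0 <= n)%N -> (x1 <= n)%N ->
  (x0 * (n - x0) != x1 * (n - x1))%N ->
  exists q, [/\ forall x, FF n q x = 0,
    forall k, (k <= n)%N -> (k * (n - k) = x0 * (n - x0))%N -> q k = 1
  & forall k, (k <= n)%N -> (k * (n - k) = x1 * (n - x1))%N -> q k = 0].
Proof.
move=> n0 l0 l1 ne; pose v (k : nat) : rat := k%:R * (n%:R - k%:R).
have vE k : (k <= n)%N -> v k = (k * (n - k))%N%:R by move=> kn; rewrite natrM natrB.
have D0 : v x0 - v x1 != 0 by rewrite !vE // subr_eq0 eqr_nat.
exists (fun k => (v k - v x1) / (v x0 - v x1)); split.
- move=> x; apply: (@FF_rel n (- v x1 / (v x0 - v x1)) (v x0 - v x1)^-1) => // k _.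
  by rewrite -/(v k) mulrBl addrC mulNr [RHS]addrC [_^-1 * _]mulrC addrC.
- by move=> k kn e; rewrite vE // e -vE // divff.
- by move=> k kn e; rewrite vE // e -vE // subrr mul0r.
Qed.

(** The term [T k0] may occur several times, as the terms k and n - k coincide in [FF]. The
    occurrences with coefficient 1 are gathered and their number is divided out. *)
Lemma elim_span D n (q : nat -> rat) (T : nat -> chain) (k0 : nat) :
  \sum_(k < n.+1) q k *: T k = 0 -> (k0 <= n)%N -> q k0 = 1 ->
  (forall k, (k <= n)%N -> [\/ T k = T k0 /\ q k = 1, q k = 0 | spanned D (T k)]) ->
  spanned D (T k0).
Proof.
move=> sum0 k0n q0 h; pose A (k : 'I_n.+1) := (T k == T k0) && (q k == 1).
move: sum0; rewrite (bigID A) /= (eq_bigr (fun _ => T k0)) => [|k /andP[/eqP-> /eqP->]]; last first.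
  by rewrite scale1r.
rewrite sumr_const => /eqP; rewrite addrC addr_eq0 => /eqP e.
have A0 : (0 < #|A|)%N.
  by apply/card_gt0P; exists (inord k0); rewrite unfold_in /A inordK // eqxx q0 eqxx.
have -> : T k0 = - (#|A|%:R^-1 *: (- (T k0 *+ #|A|))).
  by rewrite scalerN opprK -scaler_nat scalerA mulVf ?scale1r // pnatr_eq0 -lt0n.
rewrite -e; apply/spannedN/spannedZ/spanned_sum => k nA.
have kn : (k <= n)%N by rewrite -ltnS.
case: (h k kn) => [[eT eq]|->|]; last exact: spannedZ; last by rewrite scale0r; apply: spanned0.
by move: nA; rewrite /A eT eq !eqxx.
Qed.

(** Together the conditions on the three kinds of pairs say that gaps are at least 3 and that no
    part lies exactly 3 below a part of [J], which makes the parts of [J] leading. *)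
Lemma word_nonsingular s J : good s J -> {in J, forall j, (2 < j)%N} ->
  {in s &, forall x y, (x < y)%N -> (x + 3 <= y)%N} ->
  {in s & J, forall k l, (l + 2 < k)%N || (k + 3 < l)%N} ->
  (forall x y, x \in J -> y \in rem x J -> (x <= y)%N -> (x + 3 < y)%N) ->
  nonsingular_dp (word_dp s J).
Proof.
move=> g h4 h1 h2 h3; have /and3P[us s0 J0] := g.
have uJ : uniq J.
  have : forall x, x \in J -> x \notin rem x J.
    by move=> x xJ; apply/negP => /(h3 x x xJ)/(_ (leqnn x)); lia.
  elim: (J) => //= x T IH hT; have := hT x; rewrite mem_head eqxx => -> //=.
  apply: IH => y yT; have := hT y; rewrite inE yT orbT => /(_ isT); case: eqP => [_|_].
    by apply: contraNN; apply: mem_rem.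
  by rewrite inE negb_or => /andP[].
have uL : uniq (s ++ J).
  rewrite cat_uniq us uJ andbT /=; apply/hasPn => l lJ; apply/negP => ls.
  by have := h2 l l ls lJ; lia.
have gap : {in s ++ J &, forall a b, (a < b)%N -> (a + 3 <= b)%N}.
  move=> a b; rewrite !mem_cat => /orP[as_|aJ] /orP[bs|bJ] ab; [exact: h1| | |].
  - by have := h2 _ _ as_ bJ; lia.
  - by have := h2 _ _ bs aJ; lia.
  - suff bR : b \in rem a J by have := h3 _ _ aJ bR (ltnW ab); lia.
    by rewrite mem_rem_uniq // !inE bJ gtn_eqF.
have nI : nonsingular1 (word_dp s J).1.
  case/and3P: (good_dist g) => p1 _ _; rewrite /nonsingular1 p1 /=.
  apply: (@sub_in_sorted _ (mem (s ++ J)) ltn); last first.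
  - by rewrite ltn_sorted_uniq_leq sort_uniq uL sort_nat_sorted.
  - by apply/allP => i; rewrite mem_sort.
  - by move=> a b aL bL; apply: gap.
rewrite /nonsingular_dp nI leading_partsE //=.
have sJ : sorted leq (sort leq J) := sort_nat_sorted J.
have -> : [seq i <- sort leq (s ++ J) | (2 < i)%N & (i - 3)%N \notin sort leq (s ++ J)] =
  sort leq [seq i <- s ++ J | (2 < i)%N & (i - 3)%N \notin sort leq (s ++ J)].
  by rewrite (filter_sort leq_total leq_trans).
apply: (subseq_sort leq_total leq_trans).
apply: subseq_trans (_ : subseq [seq j <- J | (2 < j)%N & (j - 3)%N \notin sort leq (s ++ J)] _).
  rewrite (_ : [seq j <- J | _] = J) //; apply/all_filterP/allP => j jJ.
  rewrite h4 //= mem_sort mem_cat negb_or; have j2 := h4 _ jJ; apply/andP; split; apply/negP.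
    by move=> /h2/(_ jJ); lia.
  move=> j3; have jR : j \in rem (j - 3)%N J by rewrite mem_rem_uniq // !inE jJ andbT; lia.
  by have := h3 _ _ j3 jR; lia.
by rewrite filter_cat suffix_subseq.
Qed.

Definition word_span (s J : seq nat) (q : seq nat * seq nat) : Prop :=
  q = word_dp s J \/ prec q (word_dp s J).

Section Straighten.
Variables (s J : seq nat).
Hypothesis IH : forall s' J', good s' J' -> prec_case (word_dp s' J') (word_dp s J) ->
  spanned (word_span s' J') (wd s' J').
Hypothesis g : good s J.

Let low x := spanned (fun q => prec q (word_dp s J)) x.

Lemma low_word s' J' : (good s' J' -> prec_case (word_dp s' J') (word_dp s J)) -> low (wd s' J').
Proof.
move=> h; have [g'|ng] := boolP (good s' J'); last by rewrite wd_bad //; apply: spanned0.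
have pc := h g'; apply: sub_spanned (IH g' pc) => q [->|qp]; first exact: t_step.
by apply: prec_trans qp _; apply: t_step.
Qed.

Lemma low_of_perm s1 J1 : perm_eq s s1 -> perm_eq J J1 -> low (wd s1 J1) -> low (wd s J).
Proof. by move=> ss JJ; have [c ->] := wd_perm ss JJ; apply: spannedZ. Qed.

(** As j - i <= 2, no pair of distinct indices with the same sum lies strictly between i and j. So
    every other term of the expansion of phi_(i+j) is spread further apart, and phi_(i+j) itself is
    a merge. *)
Lemma straighten_ee (i j : nat) : i \in s -> j \in s -> (i < j)%N -> (j <= i + 2)%N -> low (wd s J).
Proof.
move=> is_ js ij ji.
have jr : j \in rem i s by move: js; rewrite (perm_mem (perm_to_rem is_)) inE (gtn_eqF ij).
have ss : perm_eq s [:: i, j & rem j (rem i s)].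
  by rewrite (permPl (perm_to_rem is_)) perm_cons; apply: perm_to_rem.
move: (rem j _) ss => s0 ss {is_ js jr}.
apply: (low_of_perm ss (perm_refl J)).
have gg : good [:: i, j & s0] J by rewrite -(good_perm ss (perm_refl J)).
have eP : word_dp s J = word_dp [:: i, j & s0] J := word_dp_perm ss (perm_refl J).
have i0 : (0 < i)%N by case/and3P: gg => _; rewrite inE negb_or lt0n eq_sym => /andP[].
pose n := (i + j)%N; pose T k := wd [:: k, (n - k)%N & s0] J.
have TE : T i = wd [:: i, j & s0] J by rewrite /T /n addKn.
have le : (i <= n)%N by rewrite leq_addr.
pose c (k : nat) : rat := (2 * k < n)%N%:R * (n%:R - 2 * k%:R).
have e : E2 n c (wd s0 J) = phi n (wd s0 J).
  rewrite phi.unlock; apply: eq_E2 => a b a0 b0 ab; rewrite /c -ab natrD.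
  have [-> ->] : (2 * a < a + b)%N = (a < b)%N /\ (2 * b < a + b)%N = (b < a)%N by split; lia.
  by case: (ltngtP a b) => [_|_|->] /=; ring.
rewrite -TE; have ci : c i != 0.
  rewrite /c (_ : (2 * i < n)%N) /n; last by lia.
  by rewrite mul1r subr_eq0 -natrM eqr_nat; lia.
have eT : c i *: T i = phi n (wd s0 J) - \sum_(k < n.+1 | k != inord i) c k *: T k.
  rewrite -e E2.unlock (bigD1 (inord i)) //= inordK // addrK.
  by [].
suff : low (c i *: T i) by move/(spannedZ (c i)^-1); rewrite scalerA mulVf // scale1r.
rewrite eT; apply: spannedD.
  rewrite wd_phi; apply: low_word => _; rewrite eP; exact: prec_merge.
apply/spannedN/spanned_sum => -[k kn]; rewrite -val_eqE /= inordK // => ki.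
have [lt|ge] := ltnP k i; last first.
  (* Here the bound on j - i enters: the first index beyond i has already reached the middle, where
     the weight is zero. *)
  have h : (n <= 2 * k)%N by rewrite /n; move/eqP: ki; lia.
  by rewrite /c ltnNge h mul0r scale0r; apply: spanned0.
apply/spannedZ/low_word => gk; rewrite eP.
by apply: (@prec_spread _ _ _ _ (s0 ++ J) i j k (n - k)%N) => //; rewrite /n; lia.
Qed.

Lemma straighten_ef (k0 l0 : nat) : k0 \in s -> l0 \in J -> (2 < l0)%N ->
  (k0 <= l0 + 2)%N -> (l0 <= k0 + 3)%N -> low (wd s J).
Proof.
move=> ks lJ l2 kl lk; have ss := perm_to_rem ks; have JJ := perm_to_rem lJ.
move: (rem k0 s) (rem l0 J) ss JJ => s0 J0 ss JJ {ks lJ}.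
apply: (low_of_perm ss JJ).
have gg : good (k0 :: s0) (l0 :: J0) by rewrite -(good_perm ss JJ).
have eP := word_dp_perm ss JJ.
have k00 : (0 < k0)%N by case/and3P: gg => _; rewrite inE negb_or lt0n eq_sym => /andP[].
pose n := (k0 + l0)%N; pose T k := wd (k :: s0) ((n - k)%N :: J0).
have TE : T k0 = wd (k0 :: s0) (l0 :: J0) by rewrite /T /n addKn.
pose m := (n %/ 2)%N.
have [nm1 nm2] : (2 * m <= n)%N /\ (n <= 2 * m + 1)%N by rewrite /m; lia.
have m2 : (1 < m)%N by rewrite /n in nm2; lia.
have [x1 [x2 [d1 d2 d3 cov]]] : exists x1 x2, [/\ k0 != x1, k0 != x2, (k0 + x1 + x2 != n)%N &
    forall k, (m.-1 <= k <= m.+1)%N -> [|| k == k0, k == x1 | k == x2]].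
  have [e|[e|e]] : k0 = m.-1 \/ k0 = m \/ k0 = m.+1 by rewrite /n in nm1 nm2; lia.
  - by exists m, m.+1; split; [lia|lia|lia|move=> k; rewrite e; lia].
  - by exists m.-1, m.+1; split; [lia|lia|lia|move=> k; rewrite e; lia].
  - by exists m.-1, m; split; [lia|lia|lia|move=> k; rewrite e; lia].
have [q [q0 qk qx1 qx2]] := EF_solve d1 d2 d3.
rewrite -TE; apply: (@elim_span _ n q T) => //; [|by rewrite leq_addr|].
  apply: etrans (q0 (wd s0 J0)); rewrite EF.unlock; apply: eq_bigr => k _.
  by rewrite wd_phi.
move=> k kn; have [near|far] := boolP (m.-1 <= k <= m.+1)%N.
  have /or3P[/eqP->|/eqP->|/eqP->] := cov k near; [by constructor 1|by constructor 2|by constructor 2].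
constructor 3; apply: low_word => gk; rewrite eP.
(* At k = l0 the two factors exchange their kinds. As this k is not near the middle, l0 = k0 + 3, so
   the doubled part becomes smaller and case (i) applies. *)
have [e|ne] := eqVneq k l0.
  have k0E : (n - k)%N = k0 by rewrite e /n addnK.
  move: gk; rewrite e -e k0E e => gk.
  apply: (@prec_lex _ _ _ _ J0 k0 l0) => //; last by rewrite /n in nm1 nm2; lia.
  by apply/permP => a; rewrite /= !count_cat /=; lia.
apply: (@prec_spread _ _ _ _ (s0 ++ J0) (minn k0 l0) (maxn k0 l0) (minn k (n - k)) (maxn k (n - k))) => //.
- by case: leqP => _; apply/permP => a; rewrite /= !count_cat /=; lia.
- by case: leqP => _; apply/permP => a; rewrite /= !count_cat /=; lia.
- by rewrite /n in nm1 nm2 kn *; lia.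
- by lia.
- by rewrite /n in kn *; lia.
Qed.

(** For a given sum there are two unordered pairs at distance at most 3, and the relations are just
    enough to solve for either of them. *)
Lemma straighten_ff (k0 l0 : nat) : k0 \in J -> l0 \in rem k0 J -> (2 < k0)%N ->
  (k0 <= l0)%N -> (l0 <= k0 + 3)%N -> low (wd s J).
Proof.
move=> kJ lJ k2 kl lk.
have JJ : perm_eq J [:: k0, l0 & rem l0 (rem k0 J)].
  by rewrite (permPl (perm_to_rem kJ)) perm_cons; apply: perm_to_rem.
move: (rem l0 _) JJ => J0 JJ {kJ lJ}; have ss := perm_refl s.
apply: (low_of_perm ss JJ).
have gg : good s [:: k0, l0 & J0] by rewrite -(good_perm ss JJ).
have eP := word_dp_perm ss JJ.
pose n := (k0 + l0)%N; pose T k := wd s [:: k, (n - k)%N & J0].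
have TE : T k0 = wd s [:: k0, l0 & J0] by rewrite /T /n addKn.
have Tsym k : (k <= n)%N -> T (n - k)%N = T k.
  move=> kn; rewrite /T /wd /= subKn //; congr (epw s _); exact: phi_phi.
pose m := (n %/ 2)%N.
have [nm1 nm2] : (2 * m <= n)%N /\ (n <= 2 * m + 1)%N by rewrite /m; lia.
have m2 : (2 < m)%N by rewrite /n in nm2; lia.
pose v k := (k * (n - k))%N.
have vsym a b : (a <= n)%N -> (b <= n)%N -> v a = v b -> a = b \/ a = (n - b)%N.
  rewrite /v => an bn; have [e|ne] := eqVneq a b; first by left.
  right; have : (a + b = n)%N; last by lia.
  have : (a * (n - a) = b * (n - b))%N by []; clear -ne an bn.
  have [A e1] : exists A, n = (a + A)%N by exists (n - a)%N; lia.
  have [B e2] : exists B, n = (b + B)%N by exists (n - b)%N; lia.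
  by rewrite {1}e1 {1}e2 !addKn => h; nia.
have [x1 [l1 vx cov]] : exists x1, [/\ (x1 <= n)%N, v k0 != v x1 &
    forall k, (k <= n)%N -> (k <= n - k + 3)%N && (n - k <= k + 3)%N -> v k = v k0 \/ v k = v x1].
  (* The near pairs are then {M + 1, n - M - 1} and {M, n - M}, at distances 0 and 2 or 1 and 3. *)
  have [M e] : exists M, n = (2 * M + 2)%N \/ n = (2 * M + 3)%N.
    by exists m.-1; clear -nm1 nm2 m2; lia.
  have near k : (k <= n)%N -> (k <= n - k + 3)%N && (n - k <= k + 3)%N ->
      v k = v M \/ v k = v M.+1.
    move=> kn nk; have [ek|[ek|[ek|ek]]] : k = M \/ k = M.+1 \/ k = M.+2 \/ n = (2 * M + 3)%N /\ k = M.+3.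
    - by clear -nk e kn; lia.
    - by left; rewrite ek.
    - by right; rewrite ek.
    - rewrite /v ek; case: e => ->; [left|right].
        by rewrite (_ : 2 * M + 2 - M.+2 = M)%N; [rewrite (_ : 2 * M + 2 - M = M.+2)%N|]; lia.
      by rewrite (_ : 2 * M + 3 - M.+2 = M.+1)%N; [rewrite (_ : 2 * M + 3 - M.+1 = M.+2)%N|]; lia.
    - case: ek => en ->; left; rewrite /v en.
      by rewrite (_ : 2 * M + 3 - M.+3 = M)%N; [rewrite (_ : 2 * M + 3 - M = M.+3)%N|]; lia.
  have ne : v M != v M.+1.
    rewrite /v; case: e => ->.
      by rewrite (_ : 2 * M + 2 - M = M.+2)%N; [rewrite (_ : 2 * M + 2 - M.+1 = M.+1)%N|]; lia.
    by rewrite (_ : 2 * M + 3 - M = M.+3)%N; [rewrite (_ : 2 * M + 3 - M.+1 = M.+2)%N|]; lia.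
  have [ek|ek] : k0 = M \/ k0 = M.+1 by rewrite /n in e; clear -e kl lk; lia.
    exists M.+1; rewrite ek; split=> //; by clear -e; lia.
  exists M; rewrite ek; split=> //; [by clear -e; lia|by rewrite eq_sym|].
  by move=> k kn /(near k kn) [->|->]; [right|left].
have n0 : (0 < n)%N by rewrite /n; lia.
have kn0 : (k0 <= n)%N by rewrite leq_addr.
have [q [q0 qk qx]] := FF_solve n0 kn0 l1 vx.
rewrite -TE; apply: (@elim_span _ n q T) => //; [|exact: qk|].
  apply: etrans (etrans (congr1 (epw s) (q0 (phw J0 (mono [::])))) (epw0 s)).
  by rewrite FF.unlock epw_sum; apply: eq_bigr => k _; rewrite epwZ.
move=> k kn; have [near|far] := boolP ((k <= n - k + 3)%N && (n - k <= k + 3)%N).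
  have [e|e] := cov k kn near; last by constructor 2; apply: qx.
  constructor 1; split; last exact: qk.
  by have [->|->] := vsym k k0 kn kn0 e; rewrite ?Tsym.
constructor 3; apply: low_word => gk; rewrite eP.
apply: (@prec_spread _ _ _ _ (s ++ J0) k0 l0 (minn k (n - k)) (maxn k (n - k))) => //.
- by apply/permP => a; rewrite /= !count_cat /=; lia.
- by case: leqP => _; apply/permP => a; rewrite /= !count_cat /=; lia.
- by rewrite /n in nm1 nm2 kn far *; lia.
- by rewrite /n in kn *; lia.
Qed.

End Straighten.

Lemma wd_nonsingular s J : nonsingular_dp (word_dp s J) -> good s J ->
  exists c : rat, wd s J = c *: tau_mono (word_dp s J).
Proof.
move=> ns g; rewrite [word_dp s J]surjective_pairing in ns *.
rewrite (tau_mono_wd ns); apply: wd_perm; last by rewrite perm_sym perm_sort.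
have [_ uI _ eJ _] := nonsingular_dpP ns.
rewrite -(perm_cat2r J); set I := (word_dp s J).1; set J' := (word_dp s J).2.
have pI : perm_eq I (s ++ J) by rewrite perm_sort.
have pJ : perm_eq J' J by rewrite perm_sort.
rewrite -(permPl pI) perm_sym; apply: perm_trans (_ : perm_eq ([seq i <- I | i \notin J'] ++ J') _).
  by rewrite perm_cat2l perm_sym.
by move: eJ; rewrite -/J' -/I => eJ; rewrite {2}eJ perm_catC perm_filterC.
Qed.

Theorem straighten s J : good s J -> spanned (word_span s J) (wd s J).
Proof.
have [N] := ubnP (rk (word_dp s J)); elim: N s J => // N IHN s J rkN g.
have IH s' J' : good s' J' -> prec_case (word_dp s' J') (word_dp s J) ->
    spanned (word_span s' J') (wd s' J').
  by move=> g' /prec_case_rk lt; apply: IHN g'; apply: leq_trans lt _; rewrite -ltnS.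
have lowS : spanned (fun q => prec q (word_dp s J)) (wd s J) -> spanned (word_span s J) (wd s J).
  by apply: sub_spanned => q; right.
have [/hasP[j jJ j2]|small] := boolP (has (fun j => j <= 2)%N J).
  by rewrite (wd_small s jJ j2); apply: spanned0.
have J2 : {in J, forall j, (2 < j)%N}.
  by move=> j jJ; rewrite ltnNge; apply: contra small => j2; apply/hasP; exists j.
have [/hasP[x xs /hasP[y ys /andP[xy yx]]]|nee] :=
    boolP (has (fun x => has (fun y => (x < y)%N && (y <= x + 2)%N) s) s).
  exact/lowS/(straighten_ee IH g xs ys).
have [/hasP[k ks /hasP[l lJ /andP[kl lk]]]|nef] :=
    boolP (has (fun k => has (fun l => (k <= l + 2)%N && (l <= k + 3)%N) J) s).
  exact/lowS/(straighten_ef IH g ks lJ (J2 _ lJ)).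
have [/hasP[x xJ /hasP[y yJ /andP[xy yx]]]|nff] :=
    boolP (has (fun x => has (fun y => (x <= y)%N && (y <= x + 3)%N) (rem x J)) J).
  exact/lowS/(straighten_ff IH g xJ yJ (J2 _ xJ)).
have ns : nonsingular_dp (word_dp s J).
  apply: word_nonsingular => //.
  - move=> x y xs ys xy; have /hasPn/(_ _ xs)/hasPn/(_ _ ys) := nee.
    by rewrite xy /= -ltnNge; lia.
  - move=> k l ks lJ; have /hasPn/(_ _ ks)/hasPn/(_ _ lJ) := nef.
    by rewrite negb_and -!ltnNge.
  - move=> x y xJ yJ xy; have /hasPn/(_ _ xJ)/hasPn/(_ _ yJ) := nff.
    by rewrite xy /= -ltnNge.
have [c ->] := wd_nonsingular ns g; apply/spannedZ.
have -> : word_dp s J = val (Sub (word_dp s J) ns : ns_dpart) by rewrite SubK.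
by apply: spanned_tau; left; rewrite SubK.
Qed.

Definition low (p : seq nat * seq nat) (x : chain) : Prop := spanned (fun q => prec q p) x.

Lemma low_wd p s' J' : (good s' J' -> prec_case (word_dp s' J') p) -> low p (wd s' J').
Proof.
move=> h; have [g'|ng] := boolP (good s' J'); last by rewrite wd_bad //; apply: spanned0.
have pc := h g'; apply: sub_spanned (straighten g') => q [->|qp]; first exact: t_step.
by apply: prec_trans qp _; apply: t_step.
Qed.

(** * Triangularity of the laplacian *)

(** The energy in a form that follows the removal of the first factor: the products with the later
    parts are what D_i produces on its way to the unit. *)
Fixpoint en (s : seq nat) : rat :=
  if s is i :: s' then 'C(i, 3)%:R + en s' - i%:R * (sumn s')%:R else 0.

Lemma wd_cat c s J : epw c (wd s J) = wd (c ++ s) J.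
Proof. by rewrite /wd epw_cat. Qed.

Lemma wd_catJ c J1 J : epw c (phw J1 (phw J (mono [::]))) = wd c (J1 ++ J).
Proof. by rewrite /wd /phw foldr_cat. Qed.

(** The term k = m gives back the word itself with the coefficient - m j. The weight must vanish at
    all other k between m and j, for only pairs outside this interval are spread apart. *)
Lemma low_EF (m j : nat) c J1 J : good (rcons c m) (J1 ++ j :: J) ->
  low (word_dp (rcons c m) (J1 ++ j :: J))
    (epw c (phw J1 (EF (m + j) (qG m j) (phw J (mono [::]))))
     + (m * j)%N%:R *: wd (rcons c m) (J1 ++ j :: J)).
Proof.
move=> g; pose n := (m + j)%N; pose y := phw J (mono [::]).
have m0 : (0 < m)%N by case/and3P: g => _; rewrite mem_rcons inE negb_or lt0n eq_sym => /andP[].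
have j0 : (0 < j)%N.
  by case/and3P: g => _ _; rewrite mem_cat inE !negb_or lt0n eq_sym => /and3P[].
have [q [eq qm qz]] : exists q, [/\ EF n (qG m j) y = EF n q y, q m = - (m * j)%N%:R &
    forall k, (minn m j <= k)%N -> (k <= maxn m j)%N -> k != m -> q k = 0].
  have [mj|jm] := leqP m j.
    exists (qG m j); split => // [|k mk kj km]; rewrite /qG.
      by rewrite eqxx ltnn (leq_gtF mj) natrM /=; ring.
    by rewrite (negPf km) (leq_gtF mk) (leq_gtF kj) /=; ring.
  (* For j < k < m both quadratic pieces of [qG] are present, and their sum is the affine function -
     (a + b k); adding a + b k is allowed by [EF_rel]. *)
  pose a : rat := 3 * (m%:R * j%:R + j%:R ^+ 2); pose b : rat := 3 * (2 * m%:R - 4 * j%:R).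
  exists (fun k => qG m j k + (a + b * k%:R + 0 * (k%:R ^+ 2 * (k%:R - n%:R)))); split.
  - by rewrite EFD [X in _ = _ + X](@EF_rel n a b 0) ?addr0.
  - by rewrite /qG eqxx ltnn jm natrM /= /a /b; ring.
  - move=> k jk km nkm; have {}km : (k < m)%N by rewrite ltn_neqAle nkm.
    rewrite /qG (negPf nkm) km /= /a /b.
    by move: jk; rewrite leq_eqVlt => /predU1P[<-|jk]; rewrite ?ltnn ?jk /=; ring.
rewrite eq EF.unlock phw_sum epw_sum.
rewrite (bigD1 (Ordinal (leq_addr j m : (m < n.+1)%N))) //=.
have TE k : epw c (phw J1 (q k *: eps k (phi (n - k) y))) =
    q k *: wd (rcons c k) (J1 ++ (n - k)%N :: J).
  rewrite phwZ epwZ phw_eps -cats1 -wd_cat -[eps k _]/(epw [:: k] _) -epw_cat wd_cat -wd_catJ.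
  by [].
rewrite TE qm /n addKn addrAC scaleNr addNr add0r.
apply: spanned_sum => -[k kn]; rewrite -val_eqE /= => km; rewrite TE.
have [h|h] := boolP ((minn m j <= k)%N && (k <= maxn m j)%N).
  by case/andP: h => h1 h2; rewrite qz // scale0r; apply: spanned0.
apply/spannedZ/low_wd => g'.
apply: (@prec_spread _ _ _ _ (c ++ J1 ++ J) (minn m j) (maxn m j) (minn k (n - k)) (maxn k (n - k))) => //.
- by rewrite !size_cat.
- by rewrite -cats1; case: leqP => _; apply/permP => a; rewrite /= !count_cat /= ?count_cat /=; lia.
- by rewrite -cats1; case: leqP => _; apply/permP => a; rewrite /= !count_cat /= ?count_cat /=; lia.
- by rewrite /n in kn *; lia.
- by lia.
- by rewrite /n in kn *; lia.
Qed.

(** With the doubled factors taken in nondecreasing order, m <= j holds, and [qG] needs no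
    correction. *)
Lemma low_FF (m j : nat) c J1 J : good c (J1 ++ [:: m, j & J]) -> (m <= j)%N ->
  low (word_dp c (J1 ++ [:: m, j & J]))
    (epw c (phw J1 (FF (m + j) (qG m j) (phw J (mono [::]))))
     + (m * j)%N%:R *: wd c (J1 ++ [:: m, j & J])).
Proof.
move=> g mj; pose n := (m + j)%N; pose y := phw J (mono [::]).
have TE k : epw c (phw J1 (qG m j k *: phi k (phi (n - k) y))) =
    qG m j k *: wd c (J1 ++ [:: k, (n - k)%N & J]).
  by rewrite phwZ epwZ -wd_catJ.
rewrite FF.unlock phw_sum epw_sum.
rewrite (bigD1 (Ordinal (leq_addr j m : (m < n.+1)%N))) //= TE.
have -> : qG m j m = - (m * j)%N%:R.
  by rewrite /qG eqxx ltnn (leq_gtF mj) natrM /=; ring.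
rewrite /n addKn addrAC scaleNr addNr add0r.
apply: spanned_sum => -[k kn]; rewrite -val_eqE /= => km; rewrite TE.
have [h|h] := boolP ((m <= k)%N && (k <= j)%N).
  case/andP: h => h1 h2; rewrite /qG (negPf km) (leq_gtF h1) (leq_gtF h2) /=.
  by rewrite !mul0r oppr0 !subr0 scale0r; apply: spanned0.
apply/spannedZ/low_wd => g'.
apply: (@prec_spread _ _ _ _ (c ++ J1 ++ J) m j (minn k (n - k)) (maxn k (n - k))) => //.
- by rewrite !size_cat.
- by apply/permP => a; rewrite /= !count_cat /= ?count_cat /=; lia.
- by case: leqP => _; apply/permP => a; rewrite /= !count_cat /= ?count_cat /=; lia.
- by rewrite /n in kn *; lia.
- by rewrite /n in kn *; lia.
Qed.

(** The multiple of phi_n merges the two factors; the rest is supported on k <= m, that is on the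
    word itself and on pairs spread further apart. *)
Lemma low_E2 (m j : nat) c s J : good (c ++ [:: m, j & s]) J -> (m < j)%N ->
  low (word_dp (c ++ [:: m, j & s]) J)
    (epw c (E2 (m + j) (cB m j) (wd s J)) + (m * j)%N%:R *: wd (c ++ [:: m, j & s]) J).
Proof.
move=> g mj; pose n := (m + j)%N; pose y := wd s J.
pose q k : rat := - ((k == m)%N%:R * (m%:R * j%:R))
  - (k < m)%N%:R * (3 * (m%:R + j%:R) * (m%:R - k%:R)).
have -> : E2 n (cB m j) y = (3 * m%:R) *: phi n y + E2 n q y.
  rewrite phi.unlock -E2Z -E2D E2.unlock; apply: eq_bigr => k _; congr (_ *: _).
  by rewrite /cB /q natrD; ring.
rewrite epwD epwZ -addrA; apply: spannedD.
  apply: spannedZ; rewrite /y wd_phi wd_cat; apply: low_wd => g'.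
  have pc : perm_eq (c ++ [:: m, j & s]) [:: m, j & c ++ s].
    by apply/permP => a; rewrite /= !count_cat /=; lia.
  rewrite (word_dp_perm pc (perm_refl J)); apply: prec_merge => //.
  by rewrite -(good_perm pc (perm_refl J)).
have TE k : epw c (q k *: eps k (eps (n - k) y)) = q k *: wd (c ++ [:: k, (n - k)%N & s]) J.
  by rewrite epwZ -wd_cat.
rewrite E2.unlock epw_sum.
rewrite (bigD1 (Ordinal (leq_addr j m : (m < n.+1)%N))) //= TE.
have -> : q m = - (m * j)%N%:R by rewrite /q eqxx ltnn natrM /=; ring.
rewrite {1}/n addKn addrAC scaleNr addNr add0r.
apply: spanned_sum => -[k kn]; rewrite -val_eqE /= => km; rewrite TE.
have [km'|h] := ltnP k m; last first.
  by rewrite /q (negPf km) (leq_gtF h) /= !mul0r oppr0 subr0 scale0r; apply: spanned0.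
apply/spannedZ/low_wd => g'.
apply: (@prec_spread _ _ _ _ (c ++ s ++ J) m j k (n - k)%N) => //.
- by apply/permP => a; rewrite /= !count_cat /= ?count_cat /=; lia.
- by apply/permP => a; rewrite /= !count_cat /= ?count_cat /=; lia.
- by rewrite ltnW.
- by rewrite /n in kn *; lia.
Qed.

Arguments wd : simpl never.

Lemma lowD p x y : low p x -> low p y -> low p (x + y).
Proof. exact: spannedD. Qed.
Lemma lowN p x : low p x -> low p (- x).
Proof. exact: spannedN. Qed.

Lemma low_perm s J s' J' x : perm_eq s s' -> perm_eq J J' ->
  low (word_dp s' J') x -> low (word_dp s J) x.
Proof. by move=> ss JJ; rewrite (word_dp_perm ss JJ). Qed.

(** The factors already passed by D_m are kept in [J1]. The induction carries D_m to the unit, where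
    it vanishes, and collects - m j at each factor. *)
Lemma low_Dop_phw (m : nat) c J1 J : good (rcons c m) (J1 ++ J) ->
  low (word_dp (rcons c m) (J1 ++ J))
    (epw c (phw J1 (Dop m (phw J (mono [::])))) + (m * sumn J)%N%:R *: wd (rcons c m) (J1 ++ J)).
Proof.
elim: J J1 => [|j J IH] J1 g /=.
  by rewrite Dop1 phw0 epw0 muln0 scale0r addr0; apply: spanned0.
have pJ : perm_eq (J1 ++ j :: J) (rcons J1 j ++ J) by rewrite cat_rcons.
have h1 := low_EF g; have g2 := g; rewrite (good_perm (perm_refl _) pJ) in g2.
have h2 := IH _ g2; rewrite -/(phw J _) Dop_phi phwD epwD mulnDr natrD scalerDl.
have eJ : phw J1 (phi j (Dop m (phw J (mono [::])))) = phw (rcons J1 j) (Dop m (phw J (mono [::]))).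
  by rewrite /phw -cats1 foldr_cat.
rewrite eJ addrACA [X in _ + X]addrC -[X in low _ X]addrA addrC -addrA.
move: h2; rewrite cat_rcons => h2; move: (lowD h1 h2); congr low.
by lin.
Qed.

Lemma low_Dop_wd (m : nat) c s J : good (c ++ m :: s) J -> path ltn m s ->
  low (word_dp (c ++ m :: s) J)
    (epw c (Dop m (wd s J)) + (m * sumn (s ++ J))%N%:R *: wd (c ++ m :: s) J).
Proof.
elim: s c => [|j s IH] c g.
  by have := @low_Dop_phw m c [::] J; rewrite -cats1 => h _; apply: h.
move=> /= /andP[mj pj].
have ps : perm_eq (c ++ [:: m, j & s]) (rcons c j ++ m :: s).
  by rewrite -cats1; apply/permP => a; rewrite !count_cat /=; lia.
have g2 : good (rcons c j ++ m :: s) J by rewrite -(good_perm ps (perm_refl J)).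
have pm : path ltn m s.
  by case: (s) pj => //= k s' /andP[jk ->]; rewrite (ltn_trans mj jk).
have h2 := low_perm ps (perm_refl J) (IH _ g2 pm).
have h1 := low_E2 g mj.
have -> : wd (j :: s) J = eps j (wd s J) by [].
rewrite Dop_eps epwD epwN mulnDr natrD scalerDl.
have e1 : epw c (eps j (Dop m (wd s J))) = epw (rcons c j) (Dop m (wd s J)).
  by rewrite -cats1 epw_cat.
(* This sign cancels the one that D_m picks up in passing e_j. *)
have e2 : wd (rcons c j ++ m :: s) J = - wd (c ++ [:: m, j & s]) J.
  by rewrite cat_rcons -!wd_cat /wd /= epsC epwN.
rewrite e1; move: (lowD h1 (lowN h2)); congr low; rewrite e2; lin.
Qed.

Lemma low_Dop'_phw (m : nat) c J1 J : good c (J1 ++ m :: J) -> path leq m J ->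
  low (word_dp c (J1 ++ m :: J))
    (epw c (phw J1 (Dop' m (phw J (mono [::])))) + (m * sumn J)%N%:R *: wd c (J1 ++ m :: J)).
Proof.
elim: J J1 => [|j J IH] J1 g.
  by rewrite Dop'1 phw0 epw0 muln0 scale0r addr0 => _; apply: spanned0.
move=> /= /andP[mj pj].
have pJ : perm_eq (J1 ++ [:: m, j & J]) (rcons J1 j ++ m :: J).
  by rewrite -cats1; apply/permP => a; rewrite !count_cat /=; lia.
have g2 : good c (rcons J1 j ++ m :: J) by rewrite -(good_perm (perm_refl c) pJ).
have pm : path leq m J.
  by case: (J) pj => //= k s' /andP[jk ->]; rewrite (leq_trans mj jk).
have h2 := low_perm (perm_refl c) pJ (IH _ g2 pm).
have h1 := low_FF g mj.
rewrite -/(phw J _) Dop'_phi phwD epwD mulnDr natrD scalerDl.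
have e1 : phw J1 (phi j (Dop' m (phw J (mono [::])))) = phw (rcons J1 j) (Dop' m (phw J (mono [::]))).
  by rewrite /phw -cats1 foldr_cat.
have e2 : wd c (rcons J1 j ++ m :: J) = wd c (J1 ++ [:: m, j & J]).
  by rewrite /wd; congr epw; apply: phw_perm; rewrite perm_sym.
by rewrite e1; move: (lowD h1 h2); congr low; rewrite e2; lin.
Qed.

Lemma low_Gam_phw c J1 J : good c (J1 ++ J) -> sorted leq J ->
  low (word_dp c (J1 ++ J))
    (epw c (phw J1 (Gam (phw J (mono [::])))) - en J *: wd c (J1 ++ J)).
Proof.
elim: J J1 => [|m J IH] J1 g sJ.
  by rewrite Gam1 phw0 epw0 scale0r subr0; apply: spanned0.
have g2 : good c (rcons J1 m ++ J) by rewrite cat_rcons.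
have := IH _ g2 (path_sorted sJ); rewrite cat_rcons => h2.
have h1 := low_Dop'_phw g sJ.
have e0 : phw (m :: J) (mono [::]) = phi m (phw J (mono [::])) by [].
rewrite e0 Gam_phi !phwD !epwD phwZ epwZ.
have e1 x : phw J1 (phi m x) = phw (rcons J1 m) x by rewrite /phw -cats1 foldr_cat.
have e2 : epw c (phw J1 (phi m (phw J (mono [::])))) = wd c (J1 ++ m :: J) by rewrite -wd_catJ.
rewrite e2 e1; move: (lowD h1 h2); congr low.
by rewrite [en (_ :: _)]/= natrM; lin.
Qed.

Lemma low_Gam_wd c s J : good (c ++ s) J -> sorted ltn s -> sorted leq J ->
  low (word_dp (c ++ s) J) (epw c (Gam (wd s J)) - en (s ++ J) *: wd (c ++ s) J).
Proof.
elim: s c => [|m s IH] c g ss sJ.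
  rewrite cats0 in g *; exact: (@low_Gam_phw c [::] J).
have g2 : good (rcons c m ++ s) J by rewrite cat_rcons.
have := IH _ g2 (path_sorted ss) sJ; rewrite cat_rcons => h2.
have h1 := low_Dop_wd g ss.
have -> : wd (m :: s) J = eps m (wd s J) by [].
rewrite Gam_eps !epwD epwZ.
have e1 x : epw c (eps m x) = epw (rcons c m) x by rewrite -cats1 epw_cat.
have e2 : epw c (eps m (wd s J)) = wd (c ++ m :: s) J by rewrite -wd_cat.
rewrite e2 e1; move: (lowD h1 h2); congr low.
by rewrite [en ((m :: s) ++ J)]/= natrM; lin.
Qed.

(** This is C(i, 3) + i^2 / 2: the products of two different parts sum to half of |I|^2 minus half
    of the sum of squares. *)
Definition en_part (i : nat) : rat := (i%:R ^+ 3 + 2 * i%:R) / 6.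

Lemma enE s : en s = \sum_(i <- s) en_part i - (sumn s)%:R ^+ 2 / 2.
Proof.
elim: s => [|i s IH] /=; first by rewrite big_nil mulr0n; ring.
by rewrite big_cons IH bin3 natrD /en_part; field.
Qed.

Lemma en_perm s t : perm_eq s t -> en s = en t.
Proof. by move=> st; rewrite !enE (perm_big _ st) (perm_sumn st). Qed.

Lemma energyE I : energy I = en I.
Proof.
elim: I => [|i I IH]; first by rewrite /energy !big_ord0 subr0.
rewrite [en _]/= -IH /energy /= !big_ord_recl /= big_ord0 add0r.
rewrite [X in _ - X = _](_ : _ = i%:R * (sumn I)%:R +
   \sum_(b < size I) \sum_(a < b) (nth 0 I a * nth 0 I b)%N%:R).
  by ring.
rewrite [(sumn I)%:R](_ : _ = \sum_(b < size I) (nth 0%N I b)%:R).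
  rewrite mulr_sumr -big_split; apply: eq_bigr => b _ /=.
  by rewrite big_ord_recl /= natrM.
by rewrite sumnE natr_sum (big_nth 0%N) big_mkord.
Qed.

Lemma Gam_tau (p : ns_dpart) :
  low (val p) (Gam (tau_mono (val p)) - energy (val p).1 *: tau_mono (val p)).
Proof.
case: p => [[I J] /= ns]; rewrite (tau_mono_wd ns).
have [eP g] := ns_word_dp ns; have [nI uI sJ eJ _] := nonsingular_dpP ns.
have [/andP[/andP[sI _] _]] := nI.
have h := @low_Gam_wd [::] _ _ g; rewrite /= eP in h.
rewrite energyE (en_perm (_ : perm_eq I ([seq i <- I | i \notin J] ++ J))).
  apply: h; last exact: (subseq_sorted leq_trans sJ sI).
  by apply: (sorted_filter ltn_trans); apply: nonsingular_ltn.
have eI : I = sort leq ([seq i <- I | i \notin J] ++ J) := congr1 fst (esym eP).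
by rewrite {1}eI perm_sort.
Qed.

(** * Counting the nonsingular monomials *)

Section Counting.
Local Open Scope nat_scope.

(* [Bq a b N n] is the coefficient at x^N q^n of the series B_(a,b) defined by
   B_(a,b) = B_(a+1,b) + x q^a B_(a+3,b+3) and B_(a,b) = B_(a,b+1) + x^2 q^b B_(a+3,b+4). The first
   rule is used while a <= n, and the second is proved to hold always in [Bq_rel2]. B_(k,k+1)
   counts the words whose factors e_i have i >= k and whose factors delta(e_j) have j > k. *)
Fixpoint Bfuel (h a b N n : nat) : nat :=
  if h is h'.+1 then
    if a <= n then Bfuel h' a.+1 b N n + (if 0 < N then Bfuel h' a.+3 b.+3 N.-1 (n - a) else 0)
    else if b <= n then
      Bfuel h' a b.+1 N n + (if 1 < N then Bfuel h' a.+3 b.+4 N.-2 (n - b) else 0)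
    else (N == 0) && (n == 0)
  else 0%N.

Definition Bq (a b N n : nat) : nat := Bfuel (2 * n + 3) a b N n.

Lemma Bfuel_irr h h' a b N n : ((n.+1 - a) + (n.+1 - b) < h)%N ->
  ((n.+1 - a) + (n.+1 - b) < h')%N -> Bfuel h a b N n = Bfuel h' a b N n.
Proof.
elim: h h' a b N n => [|h IH] [|h'] a b N n //= lt lt'.
case: (leqP a n) => an.
  rewrite (IH h'); [|lia|lia].
  by case: ifP => // _; rewrite (IH h'); lia.
case: (leqP b n) => bn //.
rewrite (IH h'); [|lia|lia].
by case: ifP => // _; rewrite (IH h'); lia.
Qed.

Lemma Bq_first a b N n : (a <= n)%N ->
  Bq a b N n = (Bq a.+1 b N n + (if 0 < N then Bq a.+3 b.+3 N.-1 (n - a) else 0))%N.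
Proof.
move=> an; rewrite {1}/Bq addnS /= an; congr addn; first by apply: Bfuel_irr; lia.
by case: ifP => // _; apply: Bfuel_irr; lia.
Qed.

Lemma Bq_second a b N n : (n < a)%N -> (b <= n)%N ->
  Bq a b N n = (Bq a b.+1 N n + (if 1 < N then Bq a.+3 b.+4 N.-2 (n - b) else 0))%N.
Proof.
move=> an bn; rewrite {1}/Bq addnS /= [a <= n]leqNgt an bn; congr addn; first by apply: Bfuel_irr; lia.
by case: ifP => // _; apply: Bfuel_irr; lia.
Qed.

Lemma Bq_base a b N n : (n < a)%N -> (n < b)%N -> Bq a b N n = ((N == 0) && (n == 0))%N.
Proof. by move=> an bn; rewrite /Bq addnS /= [a <= n]leqNgt an [b <= n]leqNgt bn. Qed.

(* Multiplication by [x ^ k * q ^ c] of the series with coefficients [F N n] at [x ^ N * q ^ n]. *)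
Definition shiftc (k c : nat) (F : nat -> nat -> nat) (N n : nat) : nat :=
  if (k <= N) && (c <= n) then F (N - k) (n - c) else 0%N.

Lemma Bq_large a b N n : (n < a)%N -> Bq a b N n = Bq a.+1 b N n.
Proof.
have [m] := ubnP (n.+1 - b); elim: m a b N n => // m IH a b N n bm an.
have [bn|nb] := leqP b n; last by rewrite !Bq_base // ltnW.
rewrite Bq_second // [Bq a.+1 b N n]Bq_second //; last by rewrite ltnW.
rewrite (IH a) //; [|lia]; congr addn.
by case: ifP => // _; apply: IH; lia.
Qed.

Lemma Bq_rel1 a b N n : Bq a b N n = (Bq a.+1 b N n + shiftc 1 a (Bq a.+3 b.+3) N n)%N.
Proof.
rewrite /shiftc; have [an|na] := leqP a n; last by rewrite andbF addn0 Bq_large.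
by rewrite Bq_first // andbT subn1.
Qed.

(** The two rules are compatible: applied in either order, they produce the same mixed term x^3
    q^(a+b+3) B_(a+6,b+7). So the second rule is inherited from the bound a + 1. *)
Lemma Bq_rel2 a b N n : Bq a b N n = (Bq a b.+1 N n + shiftc 2 b (Bq a.+3 b.+4) N n)%N.
Proof.
have [m] := ubnP (n.+1 - a); elim: m a b N n => // m IH a b N n am.
have [an|na] := leqP a n; last first.
  rewrite /shiftc; have [bn|nb] := leqP b n; first by rewrite Bq_second // andbT subn2.
  by rewrite andbF addn0 !Bq_base // ltnW.
rewrite !(Bq_rel1 a) (IH a.+1); last by lia.
rewrite -!addnA; congr addn.
have h1 : shiftc 1 a (Bq a.+3 b.+3) N n =
    (shiftc 1 a (Bq a.+3 b.+4) N n + shiftc 3 (a + b.+3) (Bq a.+4.+2 b.+4.+3) N n)%N.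
  rewrite /shiftc an; case: N => [|N] //=; rewrite subn1 /= IH; last by lia.
  congr addn; rewrite /shiftc; case: N => [|[|N]] //=.
  have -> : (b.+3 <= n - a)%N = (a + b.+3 <= n)%N by lia.
  by rewrite subnDA.
have h2 : shiftc 2 b (Bq a.+3 b.+4) N n =
    (shiftc 2 b (Bq a.+4 b.+4) N n + shiftc 3 (a + b.+3) (Bq a.+4.+2 b.+4.+3) N n)%N.
  clear h1; rewrite /shiftc; case: N => [|[|N]] //=; case: (leqP b n) => bn /=; last first.
    by case: N => [|N] //=; rewrite (_ : (a + b.+3 <= n)%N = false) //; lia.
  rewrite (Bq_rel1 a.+3) subn2 /=; congr addn; rewrite /shiftc.
  have -> : (a.+3 <= n - b)%N = (a + b.+3 <= n)%N by lia.
  by case: N => //= N; rewrite -subnDA (_ : b + a.+3 = a + b.+3)%N //; lia.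
by rewrite h1 h2; lia.
Qed.

Lemma Bq_N0 a b n : Bq a b 0 n = (n == 0%N).
Proof.
have [m] := ubnP ((n.+1 - a) + (n.+1 - b)); elim: m a b n => // m IH a b n lt.
have [an|na] := leqP a n; first by rewrite Bq_first // addn0 IH //; lia.
have [bn|nb] := leqP b n; first by rewrite Bq_second // addn0 IH //; lia.
by rewrite Bq_base.
Qed.

(** In terms of series, B_(a+1,b+2)(x) = B_(a,b)(x q): lowering the degree by the dimension moves
    e_i by one and delta(e_j) by two. *)
Lemma Bq_shift a b N n :
  Bq a.+1 b.+2 N n = if (N <= n)%N then Bq a b N (n - N) else 0%N.
Proof.
have [m] := ubnP ((n.+1 - a) + (n.+1 - b)); elim: m a b N n => // m IH a b N n lt.
have [an|na] := leqP a.+1 n.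
  rewrite Bq_rel1 (IH a.+1 b); last by lia.
  rewrite [in RHS]Bq_rel1 /shiftc an andbT; case: N => [|N]; first by rewrite /= !addn0.
  rewrite subn1 /= (IH a.+3 b.+3); last by lia.
  have [Nn|nN] := leqP N.+1 n; last by rewrite (_ : (N <= n - a.+1)%N = false) //; lia.
  congr addn; have -> : (N <= n - a.+1)%N = (a <= n - N.+1)%N by lia.
  by case: ifP => // _; congr Bq; lia.
have [bn|nb] := leqP b.+2 n.
  rewrite Bq_rel2 (IH a b.+1); last by lia.
  rewrite [in RHS]Bq_rel2 /shiftc bn andbT; case: N => [|[|N]].
  - by rewrite /= !addn0.
  - by rewrite /= !addn0.
  rewrite subn2 /= (IH a.+3 b.+4); last by lia.
  have [Nn|nN] := leqP N.+2 n; last by rewrite (_ : (N <= n - b.+2)%N = false) //; lia.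
  congr addn; have -> : (N <= n - b.+2)%N = (b <= n - N.+2)%N by lia.
  by case: ifP => // _; congr Bq; lia.
rewrite Bq_base //; case: N => [|N]; first by rewrite leq0n subn0 Bq_N0.
case: leqP => // Nn /=; have [lt2|ge] := ltnP (n - N.+1) b; first by rewrite Bq_base //; lia.
(* Only degree b + 1 and dimension 1 remain; the second rule would need dimension 2 and adds
   nothing. *)
have N0 : N = 0%N by lia.
rewrite N0 Bq_second; [|lia|lia].
by rewrite addn0 Bq_base //; lia.
Qed.

(** The words beginning with e_1 are added by hand, because B_(1,2) would also count those beginning
    with delta(e_2), which is zero. *)
Definition Wq (N n : nat) : nat := (Bq 2 3 N n + shiftc 1 1 (Bq 4 5) N n)%N.

Lemma shiftcD k c F G H N n : (forall N n, F N n = G N n + H N n)%N ->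
  shiftc k c F N n = (shiftc k c G N n + shiftc k c H N n)%N.
Proof. by move=> h; rewrite /shiftc; case: ifP. Qed.

Lemma shiftc_shiftc k c k' c' F N n :
  shiftc k c (shiftc k' c' F) N n = shiftc (k + k') (c + c') F N n.
Proof.
rewrite /shiftc; have [kN|Nk] := leqP k N; last by rewrite (_ : (k + k' <= N)%N = false) //; lia.
have [cn|nc] := leqP c n; last by rewrite (_ : (c + c' <= n)%N = false) ?andbF //; lia.
by rewrite /= -!leq_subRL // -!subnDA leq_subRL // leq_subRL.
Qed.

(* W(x) = (1 + x q) W(x q), the functional equation of the product of the 1 + x q ^ i. *)
Lemma Wq_rec N n : (0 < N)%N ->
  Wq N n = if (N <= n)%N then (Wq N (n - N) + Wq N.-1 (n - N))%N else 0%N.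
Proof.
move=> N0.
(* The left-hand side is W with the bounds shifted by 1 and 2, so it is W(x q) by [Bq_shift]. *)
have e1 M k : Bq 3 5 M k + shiftc 1 2 (Bq 5 7) M k = (if (M <= k)%N then Wq M (k - M) else 0)%N.
  rewrite Bq_shift /Wq /shiftc; case: (leqP M k) => Mk.
    congr addn; case: M Mk => [|M] //= Mk; rewrite subn1 /= Bq_shift.
    case: (ltnP 1 k) => k2; last by rewrite (_ : (0 < k - M.+1)%N = false) //; lia.
    have -> : (M <= k - 2)%N = (0 < k - M.+1)%N by lia.
    by case: ifP => // h; congr Bq; lia.
  case: M Mk => //= M Mk; rewrite Bq_shift; case: ifP => // k2.
  by rewrite (_ : (M - 0 <= k - 2)%N = false) //; lia.
have r1 := fun M k => Bq_rel1 2 3 M k; have r2 := fun M k => Bq_rel2 3 3 M k.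
have r3 := fun M k => Bq_rel2 3 4 M k.
have r4 := @shiftcD 1 1 _ _ _ N n (Bq_rel1 3 5); rewrite shiftc_shiftc in r4.
have r5 := @shiftcD 1 2 _ _ _ N n (Bq_rel2 5 6); rewrite shiftc_shiftc in r5.
have r6 := @shiftcD 2 3 _ _ _ N n (Bq_rel1 5 7); rewrite shiftc_shiftc in r6.
(* Both sides expand to B_(3,5) + x q B_(4,5) + x q^2 B_(5,7) + x^2 q^3 B_(6,7) + x^2 q^4 B_(6,8) +
   x^3 q^8 B_(8,10). *)
transitivity (Bq 3 5 N n + shiftc 1 2 (Bq 5 7) N n
    + shiftc 1 1 (fun M k => Bq 3 5 M k + shiftc 1 2 (Bq 5 7) M k) N n)%N.
  rewrite (shiftcD _ _ _ _ (fun _ _ => erefl)) shiftc_shiftc /Wq r1 r2 r3; move: r4 r5 r6.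
  by rewrite -[1 + 1]/2 -[1 + 3]/4 -[1 + 2]/3 -[2 + 6]/8 -[2 + 1]/3 -[3 + 5]/8; lia.
rewrite e1 [X in (_ + X)%N](_ : _ = if (N <= n)%N then Wq N.-1 (n - N) else 0)%N.
  by case: ifP.
rewrite /shiftc N0 /= e1 subn1; case: (posnP n) => [->|n0] /=; first by rewrite leqNgt N0.
have -> : (N.-1 <= n - 1)%N = (N <= n)%N by lia.
by case: ifP => // _; congr Wq; lia.
Qed.

Lemma Wq_0 n : Wq 0 n = (n == 0%N).
Proof. by rewrite /Wq Bq_N0 /shiftc addn0. Qed.

(** Strict partitions generated as in [Wq_rec]: lowering all parts by one makes a part 1 disappear.
    The fuel [h] bounds the recursion. *)
Fixpoint strict_list (h N n : nat) : seq (seq nat) :=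
  if h is h'.+1 then
    if N == 0 then (if n == 0 then [:: [::]] else [::])
    else if N <= n then
      [seq map S s | s <- strict_list h' N (n - N)]
      ++ [seq 1 :: map S s | s <- strict_list h' N.-1 (n - N)]
    else [::]
  else [::].

Lemma size_strict_list h N n : n + N < h -> size (strict_list h N n) = Wq N n.
Proof.
elim: h N n => // h IH [|N] n lt /=; first by rewrite Wq_0; case: eqP.
rewrite Wq_rec //; case: ifP => // Nn.
by rewrite size_cat !size_map !IH //; lia.
Qed.

Lemma strict_list_mem h N n s : s \in strict_list h N n ->
  [/\ strict1 s, sumn s = n & size s = N].
Proof.
have sumS (t : seq nat) : sumn (map S t) = sumn t + size t.
  by elim: t => //= x t ->; lia.
have strictS (t : seq nat) : strict1 t -> strict1 (map S t) && strict1 (1 :: map S t).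
  case/andP=> st at_; rewrite /strict1 /=.
  have -> : all (ltn 0) (map S t) by apply/allP => i /mapP[j _ ->].
  have sS : sorted ltn (map S t) by rewrite sorted_map.
  rewrite sS /= andbT path_min_sorted //.
  by apply/allP => i /mapP[j jt ->]; apply: (allP at_).
elim: h N n s => // h IH N n s /=; case: eqP => [->|/eqP N0].
  by case: eqP => [->|//]; rewrite inE => /eqP ->.
case: ifP => // Nn; rewrite mem_cat => /orP[] /mapP[t /IH[st sm sz] ->].
  by have /andP[h1 _] := strictS t st; rewrite sumS size_map h1 sm sz; split=> //; lia.
by have /andP[_ h2] := strictS t st; rewrite /= sumS size_map h2 sm sz; split=> //; lia.
Qed.

Lemma strict_list_uniq h N n : uniq (strict_list h N n).
Proof.
elim: h N n => // h IH N n /=; case: eqP => _; first by case: eqP.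
case: ifP => // _; have injS : injective (map S) by apply: inj_map => a b [].
rewrite cat_uniq !map_inj_uniq ?IH //=; last by move=> a b [] /injS.
rewrite andbT; apply/hasPn => s /mapP[t tL ->]; apply/mapP => -[[|x u] uL] //= [ex].
by case: (strict_list_mem uL) => /andP[_ /=]; rewrite -ex.
Qed.

(* [(i, b)] stands for the factor [e_i], doubled into [delta e_i] when [b] holds; the second argument
   bounds the index of the first factor from below, by one more for a doubled factor. *)
Fixpoint wok (k : nat) (w : seq (nat * bool)) : bool :=
  if w is (i, b) :: w' then (k + b <= i) && wok (i + 3) w' else true.

Definition wwt (w : seq (nat * bool)) : nat := sumn [seq (nat_of_bool p.2).+1 | p <- w].
Definition wdeg (w : seq (nat * bool)) : nat := sumn [seq p.1 | p <- w].

(** One use of each rule leads from B_(k,k+1) to B_(k+1,k+2), B_(k+3,k+4) and B_(k+4,k+5), so this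
    family is closed under the recursion. *)
Fixpoint word_list (h k N n : nat) : seq (seq (nat * bool)) :=
  if h is h'.+1 then
    if n < k then (if (N == 0) && (n == 0) then [:: [::]] else [::])
    else word_list h' k.+1 N n
      ++ (if 0 < N then [seq (k, false) :: w | w <- word_list h' k.+3 N.-1 (n - k)] else [::])
      ++ (if (1 < N) && (k < n) then
            [seq (k.+1, true) :: w | w <- word_list h' k.+4 N.-2 (n - k.+1)] else [::])
  else [::].

Lemma size_word_list h k N n : n.+1 - k < h -> size (word_list h k N n) = Bq k k.+1 N n.
Proof.
elim: h k N n => // h IH k N n lt /=; case: ltnP => nk.
  by rewrite Bq_base //; [case: (N == 0); case: (n == 0)|lia].
rewrite Bq_rel1 Bq_rel2 !size_cat IH; last by lia.
rewrite -addnA; congr addn; rewrite addnC; congr addn; rewrite /shiftc ?nk ?andbT.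
  by case: ifP => // _; rewrite size_map IH ?subn2 //; lia.
by case: ifP => // _; rewrite size_map IH ?subn1 //; lia.
Qed.

Lemma word_list_mem h k w : wdeg w + 1 - k < h -> wok k w ->
  w \in word_list h k (wwt w) (wdeg w).
Proof.
have deg_ge m v : wok m v -> v != [::] -> m <= wdeg v.
  by case: v => [|[i b] v] //= /andP[mi _] _; rewrite /wdeg /=; lia.
elim: h k w => // h IH k w lt ok /=; case: ltnP => [wk|kw].
  by case: w wk {lt} ok => [|[i b] w] //= wk ok; have := deg_ge k ((i, b) :: w) ok isT; lia.
case: w lt ok kw => [|[i b] w] lt ok kw.
  rewrite mem_cat; apply/orP; left.
  by have := IH k.+1 [::]; rewrite /wdeg /=; apply => //; move: lt kw; rewrite /wdeg /=; lia.
have /= /andP[ki ok'] := ok; rewrite !mem_cat.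
have [e|ne] := eqVneq i (k + b); last first.
  apply/orP; left; apply: IH; first by move: kw lt; lia.
  by rewrite /= ok' andbT; lia.
apply/orP; right; case: b e ok lt kw {ki} => e ok lt kw.
  rewrite addn1 in e; subst i; apply/orP; right.
  have -> : (1 < wwt ((k.+1, true) :: w)) && (k < wdeg ((k.+1, true) :: w)).
    by rewrite /wwt /wdeg /=; lia.
  apply/mapP; exists w => //; rewrite /wwt /wdeg /= -/(wwt w) -/(wdeg w) add0n.
  rewrite addKn; apply: IH; last by rewrite addnC in ok'.
  by move: lt; rewrite /wdeg /= -/(wdeg w); lia.
rewrite addn0 in e; subst i; apply/orP; left.
apply/mapP; exists w => //; rewrite -/(wwt w) add0n /wdeg /= -/(wdeg w).
rewrite addKn; apply: IH; last by rewrite addnC in ok'.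
by move: lt; rewrite /wdeg /= -/(wdeg w); lia.
Qed.

Definition all_words (N n : nat) : seq (seq (nat * bool)) :=
  word_list n.+2 2 N n
  ++ (if (0 < N) && (0 < n) then [seq (1, false) :: w | w <- word_list n.+2 4 N.-1 n.-1] else [::]).

Lemma size_all_words N n : size (all_words N n) = Wq N n.
Proof.
rewrite /all_words size_cat size_word_list; last by lia.
rewrite /Wq /shiftc; case: ifP => // _; rewrite size_map size_word_list ?subn1 //; lia.
Qed.

Arguments strict_list : simpl never.
Arguments word_list : simpl never.

Definition dp_word (p : seq nat * seq nat) : seq (nat * bool) := [seq (i, i \in p.2) | i <- p.1].

Lemma dp_word_inj : {in nonsingular_dp &, injective dp_word}.
Proof.
move=> [I J] [I' J'] ns ns' e.
have [_ _ _ eJ _] := nonsingular_dpP ns; have [_ _ _ eJ' _] := nonsingular_dpP ns'.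
have eI : I = I'.
  by have := congr1 (map fst) e; rewrite -!map_comp !map_id.
congr (_, _) => //; rewrite eJ eJ' -eI; apply: eq_in_filter => i iI.
have := congr1 (fun w => nth (0, false) w (index i I)) e.
rewrite /dp_word -eI /= !(nth_map 0) ?index_mem //; case.
by rewrite nth_index.
Qed.

Lemma dp_word_mem I J : nonsingular_dp (I, J) ->
  dp_word (I, J) \in all_words (size I + size J) (sumn I).
Proof.
move=> ns; have [nI uI sJ eJ hJ] := nonsingular_dpP ns.
have dE : wdeg (dp_word (I, J)) = sumn I.
  by rewrite /wdeg /dp_word -map_comp map_id.
have wE : wwt (dp_word (I, J)) = size I + size J.
  rewrite {2}eJ size_filter /wwt /dp_word -map_comp /=.
  elim: (I) => //= i s; rewrite /comp /= => ->.
  by case: (i \in J) => /=; lia.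
have tl i s : {subset i :: s <= I} -> nonsingular1 (i :: s) -> wok (i + 3) (dp_word (s, J)).
  elim: s i => //= j s IH i sub nij.
  have [_ nj /andP[ij _]] := nonsingular_sorted nij.
  rewrite /dp_word /= -/(dp_word (s, J)) (IH j) ?andbT //; last first.
    by move=> k kj; apply: sub; rewrite inE kj orbT.
  have [jJ|] := boolP (j \in J); last by rewrite addn0.
  have /andP[_ j3] := hJ _ jJ; have iI : i \in I by apply: sub; rewrite mem_head.
  rewrite addn1 ltn_neqAle ij andbT; apply: contraNneq j3 => <-.
  by rewrite addnK.
rewrite -wE -dE; case: I nI hJ tl {ns uI sJ eJ dE wE} => [|i I] nI hJ tl.
  by rewrite /all_words /wdeg /wwt /dp_word /=.
have [i0 _ _] := nonsingular_sorted nI.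
have ok := tl i I (fun _ => id) nI.
have -> : dp_word (i :: I, J) = (i, i \in J) :: dp_word (I, J) by [].
rewrite mem_cat; have [e|ne] := eqVneq i 1; last first.
  apply/orP; left; apply: word_list_mem; first by lia.
  rewrite /= ok andbT; have [iJ|] := boolP (i \in J); last by rewrite addn0; lia.
  by have /andP[] := hJ _ iJ; lia.
subst i; have nJ : 1 \in J = false by apply/negP => /hJ.
rewrite nJ; apply/orP; right; move: ok; set w := dp_word (I, J) => ok.
have e1 : (wwt ((1, false) :: w)).-1 = wwt w by [].
have e2 : wdeg ((1, false) :: w) = (wdeg w).+1 by [].
have e3 : (0 < wwt ((1, false) :: w)) && (0 < (wdeg w).+1) by [].
rewrite e2 e3 e1; apply: map_f; apply: word_list_mem => //; lia.
Qed.

(** The comparison passes through W in each dimension: pairs inject into the words counted by W, and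
    equally many distinct strict partitions are listed. Dimensions up to 2 n suffice since [size J]
    <= [size I] <= n. *)
Theorem count_nonsingular (n : nat) (L : seq ns_dpart) : uniq L ->
  (forall p, p \in L -> dp_degree (val p) = n) -> size L <= size (strict_parts n).
Proof.
move=> uL dL; pose R := iota 0 (2 * n).+1.
apply: (@leq_trans (\sum_(N <- R) Wq N n)).
  have -> : \sum_(N <- R) Wq N n = size (flatten [seq all_words N n | N <- R]).
    rewrite size_flatten /shape -map_comp sumnE big_map; apply: eq_bigr => N _ /=.
    by rewrite size_all_words.
  rewrite -(size_map (fun p : ns_dpart => dp_word (val p))); apply: uniq_leq_size.
    rewrite map_inj_in_uniq // => p q _ _ e; apply: val_inj.
    by apply: dp_word_inj e; [exact: (valP p)|exact: (valP q)].
  move=> w /mapP[p /dL dp ->]; apply/flattenP.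
  case: p dp => [[I J] ns] dp; exists (all_words (size I + size J) (sumn I)); last exact: (dp_word_mem ns).
  have {}dp : sumn I = n := dp.
  rewrite dp; apply: (map_f (fun N => all_words N n)); rewrite mem_iota add0n ltnS.
  have [nI _ sJ _ _] := nonsingular_dpP ns; have [/andP[/andP[_ aI] _]] := nI.
  rewrite all_pos in aI; have h1 : size I <= sumn I := size_sumn aI.
  have h2 : size J <= size I := size_subseq sJ.
  by rewrite dp in h1; rewrite leq0n mul2n -addnn leq_add // (leq_trans h2).
have -> : \sum_(N <- R) Wq N n = size (flatten [seq strict_list (n + N).+1 N n | N <- R]).
  rewrite size_flatten /shape -map_comp sumnE big_map; apply: eq_bigr => N _.
  by apply/esym/size_strict_list.
rewrite -(size_map val (strict_parts n)); apply: uniq_leq_size; last first.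
  move=> s /flattenP[_ /mapP[N _ ->]] /strict_list_mem[ss sm _].
  by apply/mapP; exists (Sub s ss); rewrite ?mem_strict_parts ?SubK // sm.
have : uniq R by apply: iota_uniq.
elim: R => //= N R IH /andP[NR uR]; rewrite cat_uniq strict_list_uniq IH // andbT /=.
apply/hasPn => s /flattenP[_ /mapP[M MR ->]] sM; apply/negP => sN.
case: (strict_list_mem sM) => _ _ e1; case: (strict_list_mem sN) => _ _ e2.
by move: NR; rewrite -e2 e1 MR.
Qed.

End Counting.

(** * The basis of tau-monomials *)

Fixpoint subs (l : seq nat) : seq (seq nat) :=
  if l is x :: l' then [seq x :: J | J <- subs l'] ++ subs l' else [:: [::]].

Lemma size_subs l : size (subs l) = (2 ^ size l)%N.
Proof. by elim: l => //= x l IH; rewrite size_cat size_map IH expnS mul2n addnn. Qed.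

Lemma mem_subs l J : (J \in subs l) = subseq J l.
Proof.
elim: l J => [|x l IH] J; first by rewrite inE subseq0.
rewrite mem_cat IH; case: J => [|y J]; first by rewrite sub0seq orbT.
rewrite [subseq _ (x :: l)]/=; case: eqP => [->|nyx].
  rewrite mem_map => [|a b []//]; rewrite IH; apply/orP/idP => [[//|]|->]; last by left.
  by apply: subseq_trans; apply: subseq_cons.
by rewrite orbC (_ : (y :: J \in _) = false) ?orbF //; apply/mapP => -[J' _ [/nyx]].
Qed.

Lemma subs_uniq l : uniq l -> uniq (subs l).
Proof.
elim: l => //= x l IH /andP[xl ul]; rewrite cat_uniq IH // andbT map_inj_uniq ?IH //=; last by move=> a b [].
apply/hasPn => J; rewrite mem_subs => JI; apply/mapP => -[J' _ e].
by move: xl; rewrite (mem_subseq JI) // e mem_head.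
Qed.

Definition ns_list (n : nat) : seq ns_dpart :=
  undup (pmap insub (flatten [seq [seq (A, J) | J <- subs (leading_parts A)]
    | A <- nonsingular_parts n])).

Lemma mem_ns_list n p : (p \in ns_list n) = (dp_degree (val p) == n).
Proof.
rewrite mem_undup mem_pmap_sub; case: p => [[I J] /= ns]; apply/flattenP/idP.
  case=> _ /mapP[I' I'n ->] /mapP[J' _ [eI _]].
  by move: I'n; rewrite mem_nonsingular_parts -eI => /andP[].
move=> dn; have /andP[nI sJ] := ns; exists [seq (I, J') | J' <- subs (leading_parts I)].
  by apply: (map_f (fun A => [seq (A, J) | J <- subs (leading_parts A)]));
    rewrite mem_nonsingular_parts; apply/andP.
by apply: map_f; rewrite mem_subs.
Qed.

Definition homog (n q : nat) (x : chain) : Prop :=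
  forall K : strict_part, x@_K != 0 -> sumn (val K) = n /\ size (val K) = q.

Lemma homogD n q x y : homog n q x -> homog n q y -> homog n q (x + y).
Proof.
move=> hx hy K; rewrite mcoeffD; have [->|xK] := eqVneq (x@_K) 0; last by move=> _; apply: hx.
by rewrite add0r; apply: hy.
Qed.

Lemma homogZ n q c x : homog n q x -> homog n q (c *: x).
Proof. by move=> hx K; rewrite mcoeffZ mulf_eq0 negb_or => /andP[_ /hx]. Qed.

Lemma homog0 n q : homog n q 0.
Proof. by move=> K; rewrite mcoeff0 eqxx. Qed.

Lemma homog_sum n q (I : Type) (r : seq I) (P : pred I) (F : I -> chain) :
  (forall i, P i -> homog n q (F i)) -> homog n q (\sum_(i <- r | P i) F i).
Proof. by move=> h; apply: big_ind => //; [exact: homog0|exact: homogD]. Qed.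

Lemma homog_mono s : homog (sumn s) (size s) (mono s).
Proof.
move=> K h; split; first exact: mono_degree h.
move: h; rewrite /mono; case: insubP => [L _ sL|_]; last by rewrite mcoeff0 eqxx.
rewrite mcoeffZ mcoeffU; case: (L =P K) => [<- _|_]; last by rewrite mulr0 eqxx.
by rewrite sL size_sort.
Qed.

Lemma homog_eps m n q x : homog n q x -> homog (m + n) q.+1 (eps m x).
Proof.
move=> hx; rewrite [x]malgE linear_sum /=; rewrite big_seq_cond; apply: homog_sum => K /andP[Kx _].
rewrite epsZ; apply: homogZ; rewrite -monoK -mono_cons.
have [<- <-] := hx K (etrans (mcoeff_neq0 _ _) Kx).
exact: homog_mono.
Qed.

Lemma homog_phi m n q x : homog n q x -> homog (m + n) q.+2 (phi m x).
Proof.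
move=> hx; rewrite phi_sum; apply: homog_sum => a _; apply: homogZ.
have lea : (a <= m)%N by rewrite -ltnS.
have -> : (m + n = a + (m - a + n))%N by lia.
exact/homog_eps/homog_eps.
Qed.

Lemma homog_wd s J : homog (sumn (s ++ J)) (size s + 2 * size J) (wd s J).
Proof.
elim: s => [|i s IH] /=; last exact: homog_eps.
elim: J => [|j J IH] /=; first exact (@homog_mono [::]).
by rewrite mulnS; apply: homog_phi.
Qed.

Lemma homog_tau (p : ns_dpart) : homog (dp_degree (val p)) (dp_dim (val p)) (tau_mono (val p)).
Proof.
case: p => [[I J] /= ns]; rewrite (tau_mono_wd ns).
have [<- _] := ns_word_dp ns; rewrite dp_degree_word dp_dim_word.
have := @homog_wd [seq i <- I | i \notin (sort leq J)] J.
by rewrite (eq_filter (a2 := fun i => i \notin J)) // => i; rewrite mem_sort.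
Qed.

Lemma basis_word (K : strict_part) : spanned (fun q => dp_degree q = sumn (val K)) << K >>.
Proof.
have [_ uK zK] := strictE K.
have g : good (val K) [::] by rewrite /good uK zK.
have -> : << K >> = wd (val K) [::] by rewrite -monoK mono_epw.
have dK : dp_degree (word_dp (val K) [::]) = sumn (val K) by rewrite dp_degree_word cats0.
by apply: sub_spanned (straighten g) => q [->|/precP[_ -> _ _]].
Qed.

Lemma tau_comb_surj x : exists c, x = tau_comb c.
Proof.
suff [l _ ->] : spanned (fun _ => True) x by exists l.
rewrite [x]malgE; apply: spanned_sum => K _; apply: spannedZ.
by apply: sub_spanned (basis_word K).
Qed.

Lemma mcoeff_tau_comb c K : (tau_comb c)@_K = \sum_(p <- msupp c) c@_p * (tau_mono (val p))@_K.
Proof. exact: mcoeff_linext. Qed.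

(* The expansions of the monomials give a left inverse of the matrix of the tau-monomials of degree
   [n]; the count makes it square. *)
Lemma tau_comb_eq0 c : tau_comb c = 0 -> c = 0.
Proof.
move=> c0; apply/malgP => p0; rewrite mcoeff0.
have [p0c|/mcoeff_outdom//] := boolP (p0 \in msupp c); exfalso.
pose n := dp_degree (val p0); pose L := ns_list n; pose S := strict_parts n.
have uL : uniq L by apply: undup_uniq.
have uS : uniq S by apply: strict_parts_uniq.
have leLS : (size L <= size S)%N.
  by apply: count_nonsingular => // p; rewrite mem_ns_list => /eqP.
pose Li (i : 'I_(size L)) := tnth (in_tuple L) i.
pose Sj (j : 'I_(size S)) := tnth (in_tuple S) j.
have degS j : sumn (val (Sj j)) = n by apply/eqP; rewrite -mem_strict_parts mem_tnth.
pose T := \matrix_(i < size L, j < size S) (tau_mono (val (Li i)))@_(Sj j).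
have sumL (d : {malg rat[ns_dpart]}) j :
    \sum_i d@_(Li i) * T i j = (tau_comb d)@_(Sj j).
  rewrite mcoeff_tau_comb.
  under eq_bigr do rewrite mxE.
  rewrite -(big_tuple _ _ (in_tuple L) xpredT (fun p => d@_p * (tau_mono (val p))@_(Sj j))) /=.
  rewrite [RHS](bigID (mem L)) /= [X in _ = _ + X]big1 ?addr0 => [|p pL]; last first.
    have [->|/homog_tau[]] := eqVneq ((tau_mono (val p))@_(Sj j)) 0; first by rewrite mulr0.
    by rewrite degS => e; move: pL; rewrite mem_ns_list e eqxx.
  rewrite [LHS](bigID (mem (msupp d))) /= [X in _ + X = _]big1 ?addr0 => [|p /mcoeff_outdom->];
    last by rewrite mul0r.
  rewrite -big_filter -[RHS]big_filter; apply/perm_big/uniq_perm; rewrite ?filter_uniq ?fset_uniq //.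
  by move=> p; rewrite !mem_filter andbC.
have [M hM] : exists M : 'M_(size S, size L), M *m T = 1%:M.
  have /fin_all_exists[f hf] : forall j, exists d : {malg rat[ns_dpart]}, << Sj j >> = tau_comb d.
    by move=> j; apply: tau_comb_surj.
  exists (\matrix_(j, i) (f j)@_(Li i)); apply/matrixP => j k; rewrite !mxE.
  under eq_bigr do rewrite mxE.
  rewrite sumL -hf mcoeffU; congr (1 *+ _); congr nat_of_bool.
  apply/eqP/eqP => [/eqP|-> //].
  by rewrite /Sj !(tnth_nth (Sub [::] unit_strict : strict_part)) /= nth_uniq // => /eqP /val_inj.
have rT : row_free T.
  rewrite /row_free eqn_leq rank_leq_row /=; apply: leq_trans leLS _.
  by rewrite -{1}(mxrank1 rat (size S)) -hM mxrankM_maxr.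
pose v := \row_i c@_(Li i).
have : v *m T = 0.
  apply/rowP => j; rewrite !mxE; under eq_bigr do rewrite mxE.
  by rewrite sumL c0 mcoeff0.
move/eqP; rewrite mulmx_free_eq0 // => /eqP /rowP v0.
have p0L : p0 \in L by rewrite mem_ns_list.
have [i ei] := tnthP (in_tuple L) p0 p0L.
by have := v0 i; rewrite !mxE /Li -ei => /eqP; rewrite mcoeff_eq0 p0c.
Qed.

Lemma tau_comb_inj : injective tau_comb.
Proof.
by move=> c d e; apply/eqP; rewrite -subr_eq0; apply/eqP/tau_comb_eq0; rewrite linearB /= e subrr.
Qed.

(** Discarding the coefficients of the wrong grade does not change the chain, hence by injectivity
    there were none. *)
Lemma tau_comb_graded (g : strict_part -> nat) (gp : seq nat * seq nat -> nat) q x c :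
  (forall (p : ns_dpart) K, (tau_mono (val p))@_K != 0 -> g K = gp (val p)) ->
  (forall K, K \in msupp x -> g K = q) -> x = tau_comb c ->
  forall p, p \in msupp c -> gp (val p) = q.
Proof.
move=> hg hx xc p pc.
pose c' : {malg rat[ns_dpart]} := \sum_(p <- msupp c | gp (val p) == q) c@_p *: << p >>.
have cE p' : c'@_p' = if gp (val p') == q then c@_p' else 0.
  rewrite raddf_sum /= big_mkcond; have [p'c|p'c] := boolP (p' \in msupp c).
    rewrite (bigD1_seq p') ?fset_uniq //= mcoeffZ mcoeffU eqxx mulr1 big1 ?addr0 //.
    by move=> r rp; case: ifP => // _; rewrite mcoeffZ mcoeffU (negPf rp) mulr0.
  rewrite (mcoeff_outdom p'c) if_same big_seq big1 // => r rc; case: ifP => // _.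
  by rewrite mcoeffZ mcoeffU; case: eqP => [e|_]; [rewrite -e rc in p'c|rewrite mulr0].
have -> : gp (val p) = q <-> (gp (val p) == q) by split => /eqP.
have -> : (gp (val p) == q) = (p \in msupp c').
  by rewrite -mcoeff_neq0 cE; case: ifP => _; rewrite ?eqxx // mcoeff_neq0 pc.
suff -> : c' = c by [].
apply: tau_comb_inj; rewrite -xc; apply/malgP => K.
have sub : (msupp c' `<=` msupp c)%fset.
  apply/fsubsetP => r; rewrite -!mcoeff_neq0 cE; case: ifP => // _; by rewrite eqxx.
rewrite mcoeff_tau_comb (big_fset_incl _ sub) => [|r _ /mcoeff_outdom->]; last by rewrite mul0r.
have [gK|gK] := eqVneq (g K) q.
  rewrite xc mcoeff_tau_comb; apply: eq_bigr => r _; rewrite cE; case: ifP => // /eqP gr.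
  have [->|/hg e] := eqVneq ((tau_mono (val r))@_K) 0; first by rewrite !mulr0.
  by rewrite -e gK in gr.
rewrite (mcoeff_outdom (_ : K \notin msupp x)); last by apply: contraNN gK => /hx ->.
rewrite big1 // => r _; rewrite cE; case: ifP => [/eqP gr|_]; last by rewrite mul0r.
have [->|/hg e] := eqVneq ((tau_mono (val r))@_K) 0; first by rewrite mulr0.
by rewrite e gr eqxx in gK.
Qed.

Lemma tau_comb_degree n x c : has_degree n x -> x = tau_comb c ->
  forall p, p \in msupp c -> dp_degree (val p) = n.
Proof.
by apply: (tau_comb_graded (g := fun K => sumn (val K))) => p K /homog_tau[].
Qed.

Lemma tau_comb_dim q x c : has_dim q x -> x = tau_comb c ->
  forall p, p \in msupp c -> dp_dim (val p) = q.
Proof.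
by apply: (tau_comb_graded (g := fun K => size (val K))) => p K /homog_tau[].
Qed.

(** * Eigenvectors *)

Lemma energy_cub I : energy I =
  ((cub I)%:R + 2 * (sumn I)%:R) / 6 - (sumn I)%:R ^+ 2 / 2.
Proof.
rewrite energyE enE; congr (_ - _); rewrite /cub; elim: I => [|i I IH].
  by rewrite big_nil /= mulr0n; ring.
by rewrite big_cons IH /= !natrD natrX /en_part; field.
Qed.

Lemma prec_energy p' p : prec p' p -> p'.1 <> p.1 -> energy p.1 < energy p'.1.
Proof.
case/precP=> _ dg _ [->//|lt] _; rewrite !energy_cub [sumn p'.1]dg /dp_degree.
have : (cub p.1)%:R < (cub p'.1)%:R :> rat by rewrite ltr_nat.
by lra.
Qed.

Lemma inner_eq0 x : inner x x = 0 -> x = 0.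
Proof.
move=> h; apply/malgP => K; rewrite mcoeff0.
have [Kx|/mcoeff_outdom//] := boolP (K \in msupp x).
move: h; rewrite /inner => /eqP; rewrite big_seq_cond psumr_eq0 => [|L _]; last by rewrite -expr2 sqr_ge0.
move=> /allP/(_ K Kx); rewrite Kx /= mulf_eq0 orbb => /eqP //.
Qed.

Lemma dl_adjoint_sym x y : inner (dl x) y = inner x (dd y).
Proof. by rewrite innerC -dl_adjoint innerC. Qed.

Lemma Gam_sym x y : inner (Gam x) y = inner x (Gam y).
Proof.
have e : inner (Gam x) y = inner (dd (dl x)) y + inner (dl (dd x)) y.
  by rewrite GamE innerC innerDr ![inner y _]innerC.
by rewrite e GamE innerDr (dl_adjoint (dl x) y) (dl_adjoint_sym (dd x) y)
  -(dl_adjoint_sym x (dl y)) -(dl_adjoint x (dd y)).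
Qed.

Lemma innerNr x y : inner x (- y) = - inner x y.
Proof. by rewrite -scaleN1r innerZ mulN1r. Qed.

(** For y = (Gamma - a) x, the product of y with itself is that of x with (Gamma - a) y = 0. *)
Lemma Gam_semisimple a x : Gam (Gam x - a *: x) = a *: (Gam x - a *: x) -> Gam x = a *: x.
Proof.
move=> h; apply/eqP; rewrite -subr_eq0; apply/eqP/inner_eq0.
set y := Gam x - a *: x; rewrite /y innerDr innerNr innerZ -/y.
rewrite -Gam_sym h -/y [inner (a *: y) x]innerC innerZ innerC subrr //.
Qed.

Definition eigsum (p : seq nat * seq nat) (x : chain) : Prop :=
  exists2 r : seq (rat * chain),
    (forall t, t \in r -> Gam t.2 = t.1 *: t.2 /\ low p t.2) & x = \sum_(t <- r) t.2.

Lemma eigsum0 p : eigsum p 0.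
Proof. by exists [::]; rewrite ?big_nil. Qed.

Lemma eigsumD p x y : eigsum p x -> eigsum p y -> eigsum p (x + y).
Proof.
case=> r hr -> [s hs ->]; exists (r ++ s); last by rewrite big_cat.
by move=> t; rewrite mem_cat => /orP[/hr|/hs].
Qed.

Lemma eigsumZ p c x : eigsum p x -> eigsum p (c *: x).
Proof.
case=> r hr ->; exists [seq (t.1, c *: t.2) | t <- r]; last by rewrite big_map scaler_sumr.
move=> _ /mapP[t /hr[h1 h2] ->]; split; last exact: spannedZ.
by rewrite GamZ h1 !scalerA mulrC.
Qed.

Lemma eigsum1 p a x : Gam x = a *: x -> low p x -> eigsum p x.
Proof. by move=> h l; exists [:: (a, x)]; [move=> t; rewrite inE => /eqP ->|rewrite big_seq1]. Qed.

Lemma etilde_ex (p : ns_dpart) : exists x, etilde (val p) x.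
Proof.
have [N] := ubnP (rk (val p)); elim: N p => // N IH p rkN.
have lowE x : low (val p) x -> eigsum (val p) x.
  case=> l hl ->; rewrite /tau_comb /linext big_seq.
  apply: big_ind => [||q ql]; [exact: eigsum0|exact: eigsumD|].
  apply: eigsumZ; have qp := hl q ql; have [rkq _ _ _] := precP qp.
  have {ql hl l x} : exists2 M, (rk (val q) < M)%N & (M <= N)%N.
    by exists N => //; apply: leq_trans rkq _; rewrite -ltnS.
  (* An inner induction on the rank of q: its monomial is its eigenvector minus monomials of smaller
     rank. The bound M <= N keeps the outer hypothesis applicable. *)
  case=> M; elim: M q qp rkq => // M IHM q qp rkq qM MN.
  have [y [gy [m [hm ym]]]] : exists x, etilde (val q) x by apply: IH; apply: leq_trans MN.
  have ly : low (val p) y.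
    rewrite ym; apply: spannedD; first exact: spanned_tau.
    by exists m => // r rm; apply: prec_trans (hm r rm) qp.
  have -> : tau_mono (val q) = y + (-1) *: tau_comb m by rewrite ym; lin.
  apply: eigsumD; first by apply: eigsum1 ly; rewrite Gam.unlock; exact: gy.
  apply: eigsumZ; rewrite /tau_comb /linext big_seq.
  apply: big_ind => [||r rm]; [exact: eigsum0|exact: eigsumD|].
  have rq := hm r rm; have [rkr _ _ _] := precP rq.
  apply/eigsumZ/(IHM r); [exact: prec_trans rq qp|exact: ltn_trans rkq| |exact: ltnW].
  exact: leq_trans rkr _.
have [r hr er] := lowE _ (Gam_tau p).
set E := energy _ in er.
(* (Gam - E) e_p is a sum of eigenvectors; [w] removes those of eigenvalue other than E, and then
   (Gam - E)^2 kills what remains. *)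
pose w := \sum_(t <- r | t.1 != E) (t.1 - E)^-1 *: t.2.
pose u := tau_mono (val p) - w.
have eu : Gam u - E *: u = \sum_(t <- r | t.1 == E) t.2.
  have ew : Gam w - E *: w = \sum_(t <- r | t.1 != E) t.2.
    rewrite /w linear_sum scaler_sumr -sumrB big_seq_cond [RHS]big_seq_cond.
    apply: eq_bigr => t /andP[/hr[ht _] nt] /=; rewrite GamZ ht !scalerA -scalerBl.
    have d0 : t.1 - E != 0 by rewrite subr_eq0.
    by rewrite -[RHS]scale1r; congr (_ *: _); field.
  rewrite /u GamB scalerBr opprD addrACA -[X in _ + X]opprD ew er (bigID (fun t => t.1 == E)) /=.
  by rewrite addrK.
exists u; split.
  rewrite -[Gamma1]Gam.unlock; apply: Gam_semisimple; rewrite -/E eu.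
  rewrite linear_sum scaler_sumr big_seq_cond [RHS]big_seq_cond.
  by apply: eq_bigr => t /andP[/hr[ht _] /eqP <-].
have [l hl el] : low (val p) (- w).
  apply/spannedN; rewrite /w big_seq_cond; apply: spanned_sum => t /andP[/hr[_ ht] _].
  exact: spannedZ.
by exists l; split=> //; rewrite /u el.
Qed.

(** A choice is involved: [etilde] need not determine the vector, since adding an eigenvector of a
    smaller (I;J') with the same I preserves the triangular form. *)
Definition et (p : ns_dpart) : chain := proj1_sig (constructive_indefinite_description _ (etilde_ex p)).
Lemma etP p : etilde (val p) (et p).
Proof. by rewrite /et; case: constructive_indefinite_description. Qed.

Definition et_comb : {malg rat[ns_dpart]} -> chain := linext et.
Lemma et_comb_is_linear : linear et_comb.
Proof. exact: linext_is_linear. Qed.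
HB.instance Definition _ :=
  GRing.isLinear.Build rat {malg rat[ns_dpart]} chain _ et_comb et_comb_is_linear.

Lemma Gam_et p : Gam (et p) = energy (val p).1 *: et p.
Proof. by rewrite Gam.unlock; have [] := etP p. Qed.

(** For such D the tau-monomials and the eigenvectors indexed by D span the same space, as the
    change of basis is triangular. *)
Definition down_closed (D : seq nat * seq nat -> Prop) : Prop :=
  forall p q : ns_dpart, D (val p) -> prec (val q) (val p) -> D (val q).

Lemma et_spanned D (p : ns_dpart) : down_closed D -> D (val p) -> spanned D (et p).
Proof.
move=> dD Dp; have [_ [l [hl ->]]] := etP p; apply: spannedD; first exact: spanned_tau.
by exists l => // q /hl; apply: dD.
Qed.

Lemma et_comb_spanned D d : down_closed D -> (forall p, p \in msupp d -> D (val p)) ->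
  spanned D (et_comb d).
Proof.
move=> dD hd; rewrite /et_comb /linext big_seq; apply: spanned_sum => p pd.
by apply: spannedZ; apply: et_spanned => //; apply: hd.
Qed.

Definition et_span (D : seq nat * seq nat -> Prop) (x : chain) : Prop :=
  exists2 d : {malg rat[ns_dpart]}, (forall p, p \in msupp d -> D (val p)) & x = et_comb d.

Lemma et_spanB D x y : et_span D x -> et_span D y -> et_span D (x - y).
Proof.
case=> l lD -> [m mD ->]; exists (l - m); last by rewrite linearB.
by move=> p /(fsubsetP (msuppB_le l m)); rewrite inE => /orP[/lD//|/mD//].
Qed.

Lemma et_span_comb D (c : {malg rat[ns_dpart]}) :
  (forall p, p \in msupp c -> et_span D (tau_mono (val p))) -> et_span D (tau_comb c).
Proof.
move=> h; rewrite /tau_comb /linext big_seq; apply: big_ind => [|x y|p pc].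
- by exists 0; rewrite ?linear0 // => p; rewrite msupp0 inE.
- case=> l lD -> [m mD ->]; exists (l + m); last by rewrite linearD.
  by move=> p /(fsubsetP (msuppD_le l m)); rewrite inE => /orP[/lD//|/mD//].
have [d dD ->] := h p pc; exists (c@_p *: d); last by rewrite linearZZ.
by move=> q /(fsubsetP (msuppZ_le _ d)) /dD.
Qed.

Lemma et_span_tau D (p : ns_dpart) : down_closed D -> D (val p) -> et_span D (tau_mono (val p)).
Proof.
move=> dD; have [N] := ubnP (rk (val p)); elim: N p => // N IH p rkN Dp.
have [_ [l [hl e]]] := etP p.
have -> : tau_mono (val p) = et p - tau_comb l by rewrite e addrK.
apply: et_spanB.
  exists << p >>; last by rewrite /et_comb linextU.
  by move=> q; rewrite msuppU oner_eq0 inE => /eqP ->.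
apply: et_span_comb => q /hl qp; apply: IH; last exact: dD qp.
by have [rkq _ _ _] := precP qp; apply: leq_trans rkq _.
Qed.

Lemma spanned_et D x : down_closed D -> spanned D x -> et_span D x.
Proof. by move=> dD [l lD ->]; apply: et_span_comb => p /lD; apply: et_span_tau. Qed.

(** Triangular substitution leaves the coefficients of the maximal pairs unchanged and enlarges the
    support only downwards. *)
Lemma et_tau_comb d : exists2 c, et_comb d = tau_comb c &
  (forall p, (forall q, q \in msupp d -> ~ prec (val p) (val q)) -> c@_p = d@_p) /\
  (forall p, p \in msupp c -> p \in msupp d \/ exists2 q, q \in msupp d & prec (val p) (val q)).
Proof.
have el q : exists l, (forall p' : ns_dpart, p' \in msupp l -> prec (val p') (val q)) /\
    et q = tau_mono (val q) + tau_comb l.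
  by have [_ [l h]] := etP q; exists l.
pose f q := proj1_sig (constructive_indefinite_description _ (el q)).
have fP q : (forall p' : ns_dpart, p' \in msupp (f q) -> prec (val p') (val q)) /\
    et q = tau_mono (val q) + tau_comb (f q).
  by rewrite /f; case: constructive_indefinite_description.
have cE : et_comb d = tau_comb (d + \sum_(q <- msupp d) d@_q *: f q).
  rewrite linearD linear_sum /= /et_comb /tau_comb /linext -big_split; apply: eq_bigr => q _ /=.
  have [_ ->] := fP q; rewrite scalerDr; congr (_ + _).
  by rewrite -linearZZ.
exists (d + \sum_(q <- msupp d) d@_q *: f q) => //; split=> p h.
  rewrite mcoeffD raddf_sum /= big_seq big1 ?addr0 // => q qd.
  rewrite mcoeffZ; have [pq|/mcoeff_outdom->] := boolP (p \in msupp (f q)); last by rewrite mulr0.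
  by case: (h q qd); apply: (fP q).1.
have [|pd] := boolP (p \in msupp d); [by left|right].
have [/hasP[q qd pq]|/hasPn hq] := boolP (has (fun q => p \in msupp (f q)) (msupp d)).
  by exists q => //; apply: (fP q).1.
move: h; rewrite -mcoeff_neq0 mcoeffD (mcoeff_outdom pd) add0r raddf_sum /= big_seq big1 ?eqxx // => q qd.
by rewrite mcoeffZ (mcoeff_outdom (hq q qd)) mulr0.
Qed.

Lemma max_rk (d : {malg rat[ns_dpart]}) : d != 0 ->
  exists2 p, p \in msupp d & forall q, q \in msupp d -> (rk (val q) <= rk (val p))%N.
Proof.
move=> d0; have [p0 p0d] : exists p, p \in msupp d.
  apply/fset0Pn; apply: contraNneq d0 => e; apply/eqP/malgP => p.
  by rewrite mcoeff_outdom ?mcoeff0 // e.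
have pS (s : seq ns_dpart) p : p \in s -> exists2 p, p \in s & forall q, q \in s -> (rk (val q) <= rk (val p))%N.
  elim: s p => // a s IH p _; case: s IH => [|b s] IH.
    by exists a; rewrite ?inE // => q; rewrite inE => /eqP ->.
  have [m ms hm] := IH b (mem_head _ _).
  case: (leqP (rk (val a)) (rk (val m))) => h.
    by exists m => [|q]; rewrite inE ?ms ?orbT // => /orP[/eqP->|/hm].
  exists a; first exact: mem_head.
  by move=> q; rewrite inE => /orP[/eqP->//|/hm /leq_trans->//]; apply: ltnW.
exact: pS p0d.
Qed.

Lemma et_comb_eq0 d : et_comb d = 0 -> d = 0.
Proof.
move=> e; apply/eqP; apply: contra_eqT e => d0; have [p pd hp] := max_rk d0.
have [c -> [cE _]] := et_tau_comb d; apply: contraTneq pd => c0.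
rewrite -mcoeff_neq0 -(cE p) => [|q /hp]; first by rewrite (tau_comb_eq0 c0) mcoeff0 eqxx.
by move=> h /precP[/leq_trans/(_ h)]; rewrite ltnn.
Qed.

Lemma et_comb_inj : injective et_comb.
Proof.
by move=> c d e; apply/eqP; rewrite -subr_eq0; apply/eqP/et_comb_eq0; rewrite linearB /= e subrr.
Qed.

Lemma et_supp D d : down_closed D -> spanned D (et_comb d) -> forall p, p \in msupp d -> D (val p).
Proof. by move=> dD /(spanned_et dD)[d' hd' /et_comb_inj ->]. Qed.

(** The diagonal operator with entries [f] in coordinates of the eigenbasis: the energy gives Gamma,
    and an indicator function gives a projection. *)
Definition tw (f : ns_dpart -> rat) (d : {malg rat[ns_dpart]}) : {malg rat[ns_dpart]} :=
  \sum_(p <- msupp d) (f p * d@_p) *: << p >>.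

Lemma mcoeff_tw f d p : (tw f d)@_p = f p * d@_p.
Proof.
rewrite raddf_sum /=; have [pd|pd] := boolP (p \in msupp d).
  rewrite (bigD1_seq p) ?fset_uniq //= mcoeffZ mcoeffU eqxx mulr1 big1 ?addr0 //.
  by move=> r rp; rewrite mcoeffZ mcoeffU (negPf rp) mulr0.
rewrite (mcoeff_outdom pd) mulr0 big_seq big1 // => r rd.
by rewrite mcoeffZ mcoeffU; case: eqP => [e|_]; [rewrite -e rd in pd|rewrite mulr0].
Qed.

Lemma tw_supp f d p : p \in msupp (tw f d) -> p \in msupp d /\ f p != 0.
Proof. by rewrite -mcoeff_neq0 mcoeff_tw mulf_eq0 negb_or mcoeff_neq0 => /andP[]. Qed.

Lemma Gam_et_comb d : Gam (et_comb d) = et_comb (tw (fun p => energy (val p).1) d).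
Proof.
rewrite /tw !linear_sum /=; apply: eq_bigr => p _.
by rewrite GamZ Gam_et [et_comb _]linearZZ /= /et_comb linextU scalerA mulrC.
Qed.

Lemma et_eigen a d : Gam (et_comb d) = a *: et_comb d <->
  forall p, p \in msupp d -> energy (val p).1 = a.
Proof.
rewrite Gam_et_comb -linearZZ; split=> [/et_comb_inj /malgP h p pd|h].
  have := h p; rewrite mcoeff_tw mcoeffZ => /mulIf; apply.
  by rewrite mcoeff_neq0.
congr et_comb; apply/malgP => p; rewrite mcoeff_tw mcoeffZ.
by have [/h ->//|/mcoeff_outdom->] := boolP (p \in msupp d); rewrite !mulr0.
Qed.

Lemma down_degree n : down_closed (fun p => dp_degree p = n).
Proof. by move=> p q <- /precP[_ ->]. Qed.

Lemma down_dim n : down_closed (fun p => dp_dim p = n).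
Proof. by move=> p q <- /precP[_ _ ->]. Qed.

Lemma has_degreeP n x : has_degree n x <-> spanned (fun p => dp_degree p = n) x.
Proof.
split=> [h|[l hl ->] K].
  by have [c e] := tau_comb_surj x; exists c => //; apply: tau_comb_degree e.
rewrite -mcoeff_neq0 mcoeff_tau_comb => /eqP K0; apply/eqP; apply/negPn/negP => nK; apply: K0.
rewrite big_seq big1 // => p /hl dp; have [->|/homog_tau[]] := eqVneq ((tau_mono (val p))@_K) 0;
  first by rewrite mulr0.
by rewrite dp => e; rewrite e eqxx in nK.
Qed.

Lemma has_dimP q x : has_dim q x <-> spanned (fun p => dp_dim p = q) x.
Proof.
split=> [h|[l hl ->] K].
  by have [c e] := tau_comb_surj x; exists c => //; apply: tau_comb_dim e.
rewrite -mcoeff_neq0 mcoeff_tau_comb => /eqP K0; apply/eqP; apply/negPn/negP => nK; apply: K0.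
rewrite big_seq big1 // => p /hl dp; have [->|/homog_tau[]] := eqVneq ((tau_mono (val p))@_K) 0;
  first by rewrite mulr0.
by rewrite dp => _ e; rewrite e eqxx in nK.
Qed.

Lemma et_comb_surj x : exists d, x = et_comb d.
Proof.
have [c ->] := tau_comb_surj x.
have [d _ e] : et_span (fun _ => True) (tau_comb c) by apply: spanned_et => //; exists c.
by exists d.
Qed.

Lemma et_comb_degree n d : has_degree n (et_comb d) <-> forall p, p \in msupp d -> dp_degree (val p) = n.
Proof.
have dc := @down_degree n; split=> [/has_degreeP h|h]; first exact: (et_supp (D := fun p => dp_degree p = n)).
by apply/has_degreeP; apply: (et_comb_spanned (D := fun p => dp_degree p = n)).
Qed.

Lemma et_comb_dim n d : has_dim n (et_comb d) <-> forall p, p \in msupp d -> dp_dim (val p) = n.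
Proof.
have dc := @down_dim n; split=> [/has_dimP h|h]; first exact: (et_supp (D := fun p => dp_dim p = n)).
by apply/has_dimP; apply: (et_comb_spanned (D := fun p => dp_dim p = n)).
Qed.

(** Pairs below some (I;J) with another partition have strictly larger energy, so they cannot occur
    in an eigenvector for E(I). *)
Lemma eigenspace_ofP I x : eigenspace_of I x <->
  exists2 d, (forall p, p \in msupp d -> (val p).1 = I) & x = et_comb d.
Proof.
pose D (p : seq nat * seq nat) := p.1 = I \/ exists2 J, nonsingular_dp (I, J) & prec p (I, J).
have dD : down_closed D.
  move=> p q [pI|[J ns pJ]] qp; right; last by exists J => //; apply: prec_trans qp pJ.
  by exists (val p).2; rewrite -pI -surjective_pairing //; apply: valP.
split=> [[_ ge [c xc hc]]|[d hd ->]].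
  have [d hd e] : et_span D x by apply: spanned_et => //; exists c.
  exists d => // p pd; have [//|[J _ pJ]] := hd p pd.
  move: ge; rewrite -Gam.unlock e => /et_eigen/(_ p pd) en.
  have [//|/eqP ne] := eqVneq (val p).1 I.
  by have := prec_energy pJ ne; rewrite en ltxx.
split; first by apply/et_comb_degree => p /hd; rewrite /dp_degree => ->.
  by rewrite -Gam.unlock; apply/et_eigen => p /hd ->.
have [c hc ->] : spanned D (et_comb d) by apply: et_comb_spanned => // p /hd; left.
by exists c.
Qed.

Lemma subspace_dim_et (P : chain -> Prop) (L : seq ns_dpart) : uniq L ->
  (forall x, P x <-> exists2 d, (forall p, p \in msupp d -> p \in L) & x = et_comb d) ->
  subspace_dim P (size L).
Proof.
move=> uL hP; pose Li (i : 'I_(size L)) := tnth (in_tuple L) i.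
have Linj : injective Li.
  by move=> i j /eqP; rewrite /Li !(tnth_nth (Li i)) /= nth_uniq // => /eqP /val_inj.
have combE c : \sum_i c i *: et (Li i) = et_comb (\sum_i c i *: << Li i >>).
  by rewrite linear_sum; apply: eq_bigr => i _ /=; rewrite [et_comb _]linearZZ /= /et_comb linextU.
have coefE c i : (\sum_i c i *: << Li i >> : {malg rat[ns_dpart]})@_(Li i) = c i.
  rewrite raddf_sum (bigD1 i) //= mcoeffZ mcoeffU eqxx mulr1 big1 ?addr0 // => j ji.
  by rewrite mcoeffZ mcoeffU (inj_eq Linj) (negPf ji) mulr0.
exists (fun i => et (Li i)); split=> [c|x].
  by rewrite combE => /et_comb_eq0 e i; rewrite -(coefE c i) e mcoeff0.
apply: iff_trans (hP x) _; split=> [[d hd ->]|[c ->]]; last first.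
  exists (\sum_i c i *: << Li i >>); last by rewrite combE.
  move=> p; rewrite -mcoeff_neq0 => /eqP h; apply/negPn/negP => pL; apply: h.
  rewrite raddf_sum big1 // => i _ /=; rewrite mcoeffZ mcoeffU.
  by case: eqP => [e|_]; [rewrite -e mem_tnth in pL|rewrite mulr0].
exists (fun i => d@_(Li i)); rewrite combE; congr et_comb; apply/malgP => p.
have [/(tnthP (in_tuple L))[i ->]|pL] := boolP (p \in L); first by rewrite coefE.
rewrite mcoeff_outdom ?(contra (hd p)) // raddf_sum big1 // => i _ /=; rewrite mcoeffZ mcoeffU.
by case: eqP => [e|_]; [rewrite -e mem_tnth in pL|rewrite mulr0].
Qed.

(** * The values of the energy *)

Lemma nonsingular_rcons s i : nonsingular1 (rcons s i) =
  [&& nonsingular1 s, (0 < i)%N & if s is [::] then true else (last 0%N s + 3 <= i)%N].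
Proof.
rewrite /nonsingular1 /partition1 all_rcons.
case: s => [|a s] /=; first by rewrite !andbT.
rewrite !rcons_path; apply/idP/idP.
  by move=> /andP[/andP[/andP[-> _] /and3P[-> -> ->]] /andP[-> ->]].
move=> /and3P[/andP[/andP[-> /andP[-> ->]] ->] -> h]; rewrite h /= !andbT.
by apply: leq_trans h; apply: leq_addr.
Qed.

(* Six times the bracket of E(I) at the last part [i], with [i - 2] truncated harmlessly at i = 1. *)
Lemma gap_ge s i : nonsingular1 (rcons s i) -> (6 * sumn s <= i.-1 * (i - 2))%N.
Proof.
elim/last_ind: s i => [|s g IH] i //; rewrite nonsingular_rcons.
case/and3P=> ns i0; rewrite last_rcons => gi.
have {gi} gi : (g + 3 <= i)%N by case: s gi {IH ns}.
have := IH g ns; move: ns; rewrite nonsingular_rcons => /and3P[_ g0 _].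
by rewrite sumn_rcons; nia.
Qed.

Lemma main_part_rcons r q : main_part r q.+1 = rcons (main_part r q) (r + 3 * q)%N.
Proof. by rewrite /main_part -(addn1 q) iotaD map_cat cats1 add0n. Qed.

(** Equality is inherited by the preceding part and forces the gap 3 at each step; at the first part
    it reads (i - 1)(i - 2) = 0. *)
Lemma gap_eq s i : nonsingular1 (rcons s i) -> (6 * sumn s = i.-1 * (i - 2))%N ->
  exists2 r, (r == 1%N) || (r == 2)%N & rcons s i = main_part r (size s).+1.
Proof.
elim/last_ind: s i => [|s g IH] i.
  rewrite nonsingular_rcons => /and3P[_ i0 _]; case: i i0 => [|[|[|i]]] //= _ h.
  - by exists 1%N.
  - by exists 2%N.
rewrite nonsingular_rcons; case/and3P=> ns i0; rewrite last_rcons => gi.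
have {gi} gi : (g + 3 <= i)%N by case: s gi {IH ns}.
have := gap_ge ns; have g0 : (0 < g)%N by move: ns; rewrite nonsingular_rcons => /and3P[].
rewrite sumn_rcons => le eq; have e : i = (g + 3)%N by nia.
have [|r r12 es] := IH g ns; first by nia.
exists r => //; rewrite main_part_rcons size_rcons -es; congr rcons.
have : last 0%N (rcons s g) = (r + 3 * size s)%N by rewrite es main_part_rcons last_rcons.
by rewrite last_rcons e => ->; lia.
Qed.

Lemma en_rcons s i : (0 < i)%N -> 
  en (rcons s i) = en s + i%:R * ((i.-1 * (i - 2))%:R - 6 * (sumn s)%:R) / 6.
Proof.
move=> i0; have /en_perm -> : perm_eq (rcons s i) (i :: s) by rewrite perm_rcons.
rewrite !enE big_cons /= natrD /en_part natrM.
have -> : ((i.-1)%:R = i%:R - 1 :> rat)%R by rewrite -[in RHS](prednK i0) -natr1 addrK.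
case: i i0 => [|[|i]] // _; first by rewrite subrr mul0r; field.
by rewrite subn2 /= -!(natr1 i.+1) -(natr1 i); field.
Qed.

Lemma en_ge0 s : nonsingular1 s -> 0 <= en s.
Proof.
elim/last_ind: s => [_|s i IH ns]; first by rewrite enE big_nil /= expr0n mul0r subr0.
have := ns; rewrite nonsingular_rcons => /and3P[/IH en0 i0 _]; rewrite en_rcons //.
have h : 6 * (sumn s)%:R <= (i.-1 * (i - 2))%:R :> rat by rewrite -natrM ler_nat gap_ge.
by rewrite addr_ge0 ?divr_ge0 ?mulr_ge0 ?subr_ge0.
Qed.

Lemma energy_main r q : (r == 1%N) || (r == 2)%N -> energy (main_part r q) = 0.
Proof.
move=> r12; rewrite energyE; elim: q => [|q IH]; first by rewrite enE big_nil /= expr0n mul0r subr0.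
rewrite main_part_rcons en_rcons ?IH ?add0r; last by lia.
have -> : ((r + 3 * q).-1 * (r + 3 * q - 2) = 6 * sumn (main_part r q))%N.
  elim: {IH} q => [|q IH]; first by case/orP: r12 => /eqP ->.
  by rewrite main_part_rcons sumn_rcons mulnDr -IH; case/orP: r12 => /eqP ->; nia.
by rewrite natrM subrr mulr0 mul0r.
Qed.

Lemma part_le_energy I i : nonsingular1 I -> energy I != 0 -> i \in I -> i%:R <= 6 * energy I.
Proof.
rewrite energyE; case/lastP: I => // s j ns E0 ij.
have := ns; rewrite nonsingular_rcons => /and3P[nss j0 _].
have gap : (6 * sumn s < j.-1 * (j - 2))%N.
  rewrite ltn_neqAle gap_ge // andbT; apply: contraNneq E0 => /(gap_eq ns)[r r12 ->].
  by rewrite -energyE energy_main.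
have le_ij : (i <= j)%N.
  have /andP[/andP[sj _] _] := ns; move: sj ij.
  rewrite -[rcons s j]revK rev_sorted mem_rev rev_rcons /= => sj.
  rewrite inE => /predU1P[->//|]; apply/allP: i; apply: order_path_min sj.
  by move=> a b c /= ab bc; apply: leq_trans bc ab.
have h : 6 * (sumn s)%:R + 1 <= (j.-1 * (j - 2))%:R :> rat by rewrite -natrM natr1 ler_nat.
have e0 := en_ge0 nss; rewrite en_rcons //.
have l : i%:R <= j%:R :> rat by rewrite ler_nat.
have j0' : 0 < j%:R :> rat by rewrite ltr0n.
nra.
Qed.

Lemma energy_eq0 I : nonsingular1 I -> energy I = 0 ->
  exists2 r, (r == 1%N) || (r == 2)%N & I = main_part r (size I).
Proof.
case/lastP: I => [_ _|s i ns E0]; first by exists 1%N.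
rewrite size_rcons; apply: gap_eq => //; apply/eqP; rewrite eqn_leq gap_ge //= leqNgt.
apply/negP => gap; move: ns; rewrite nonsingular_rcons => /and3P[nss i0 _].
have h : 6 * (sumn s)%:R + 1 <= (i.-1 * (i - 2))%:R :> rat by rewrite -natrM natr1 ler_nat.
move: E0; rewrite energyE en_rcons //; have e0 := en_ge0 nss.
have i0' : 0 < i%:R :> rat by rewrite ltr0n.
by nra.
Qed.

Lemma main_nonsingular r q : (r == 1%N) || (r == 2)%N -> nonsingular1 (main_part r q).
Proof.
move=> r12; elim: q => [|q IH] //; rewrite main_part_rcons nonsingular_rcons IH /=.
apply/andP; split; first by lia.
by case: q {IH} => [|q] //; rewrite main_part_rcons last_rcons; case: rcons => // _ _; lia.
Qed.

Lemma leading_main r q : (r == 1%N) || (r == 2)%N -> leading_parts (main_part r q) = [::].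
Proof.
move=> r12; rewrite leading_partsE ?main_nonsingular //.
apply/eqP; rewrite -(negbK (_ == _)) -has_filter; apply/hasPn => i /mapP[k].
rewrite mem_iota add0n => /andP[_ kq] ->; rewrite negb_and negbK.
case: k kq => [|k] kq; first by rewrite muln0; case/orP: r12 => /eqP ->.
apply/orP; right; apply/mapP; exists k; last by lia.
by rewrite mem_iota /=; lia.
Qed.

Lemma nonsingular_dp_nil I : nonsingular1 I -> nonsingular_dp (I, [::]).
Proof. by move=> nI; rewrite /nonsingular_dp nI sub0seq. Qed.

Lemma sumn_le_energy I N : nonsingular1 I -> energy I != 0 -> 6 * energy I <= N%:R ->
  (sumn I <= N.+1 * N)%N.
Proof.
move=> nI E0 hN; have leN i : i \in I -> (i <= N)%N.
  by move=> /(part_le_energy nI E0) h; rewrite -(ler_nat rat); apply: le_trans h hN.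
have sz : (size I <= N.+1)%N.
  rewrite -(size_iota 0 N.+1); apply: uniq_leq_size (nonsingular_uniq nI) _ => i /leN.
  by rewrite mem_iota add0n ltnS.
apply: leq_trans (leq_mul sz (leqnn N)).
elim: I leN {nI E0 hN sz} => //= i I IH h; rewrite mulSn leq_add ?h ?mem_head // IH // => j jI.
by rewrite h // inE jI orbT.
Qed.

(** * The spectrum *)

Lemma malgU_neq0 (p : ns_dpart) : (<< p >> : {malg rat[ns_dpart]}) != 0.
Proof. by apply/eqP => /malgP/(_ p); rewrite mcoeffU eqxx mcoeff0 => /eqP; rewrite oner_eq0. Qed.

Lemma tau_comb_exists_unique x : exists! c : {malg rat[ns_dpart]}, x = tau_comb c.
Proof. by have [c e] := tau_comb_surj x; exists c; split=> // c' e'; apply: tau_comb_inj; rewrite -e. Qed.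

Lemma Gamma1_triangular (p : ns_dpart) : exists l : {malg rat[ns_dpart]},
  (forall p' : ns_dpart, p' \in msupp l -> prec (val p') (val p)) /\
  Gamma1 (tau_mono (val p)) = energy (val p).1 *: tau_mono (val p) + tau_comb l.
Proof.
have [l hl e] := Gam_tau p; exists l; split=> //.
by rewrite -e -[Gamma1]Gam.unlock addrC subrK.
Qed.

(** If the two leading pairs differed, each would have to occur among the lower terms of the other,
    against the ranks. *)
Lemma leading_term_unique (c c' : rat) (p p' : ns_dpart) (l l' : {malg rat[ns_dpart]}) :
  (forall q, q \in msupp l -> prec (val q) (val p)) ->
  (forall q, q \in msupp l' -> prec (val q) (val p')) ->
  c != 0 -> c' != 0 -> c *: (<< p >> + l) = c' *: (<< p' >> + l') ->
  [/\ c = c', p = p' & l = l'].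
Proof.
have irr (q : ns_dpart) (m : {malg rat[ns_dpart]}) :
    (forall r, r \in msupp m -> prec (val r) (val q)) -> m@_q = 0.
  move=> h; apply: mcoeff_outdom; apply/negP => /h /precP[]; by rewrite ltnn.
move=> hl hl' c0 c0' e.
have ep : p = p'.
  have [//|/eqP ne] := eqVneq p p'.
  have h q q' (m : {malg rat[ns_dpart]}) : q <> q' ->
      (forall r, r \in msupp m -> prec (val r) (val q')) ->
      (<< q' >> + m)@_q != 0 -> (rk (val q) < rk (val q'))%N.
    move=> qq' hm; rewrite mcoeffD mcoeffU; case: (q' =P q) => [/esym//|_].
    by rewrite mulr0n add0r mcoeff_neq0 => /hm /precP[].
  have lt1 : (rk (val p) < rk (val p'))%N.
    apply: (h _ _ l') => //; apply: contra_neq c0 => h0.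
    move/malgP/(_ p): e; rewrite !mcoeffZ h0 mulr0 mcoeffD mcoeffU eqxx irr // addr0 mulr1.
    by [].
  have : (rk (val p') < rk (val p))%N.
    apply: (h _ _ l) => // [/esym//|]; apply: contra_neq c0' => h0.
    move/malgP/(_ p'): e; rewrite !mcoeffZ h0 mulr0 mcoeffD mcoeffU eqxx irr // addr0 mulr1.
    by move=> <-.
  by move=> /(ltn_trans lt1); rewrite ltnn.
rewrite -{}ep in hl' e *.
have ec : c = c'.
  by move/malgP/(_ p): e; rewrite !mcoeffZ !mcoeffD mcoeffU eqxx !irr // addr0 !mulr1.
split=> //; move: e; rewrite -ec => /(scalerI c0); exact: addrI.
Qed.

(** The lexicographic order is total. So a nonzero eigenvector of one I and one dimension has a
    single highest term, by which it is normalised in [eigenvector_form]. *)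
Lemma prec_same_partition (p q : ns_dpart) : (val p).1 = (val q).1 ->
  dp_dim (val p) = dp_dim (val q) -> p != q -> prec (val p) (val q) \/ prec (val q) (val p).
Proof.
case: p q => [[I J] ns] [[I' J'] ns'] /= eI; rewrite -{}eI /dp_dim /= in ns' * => sJ ne.
have dist : distinguished (I, J) by have [<- /good_dist] := ns_word_dp ns.
have dist' : distinguished (I, J') by have [<- /good_dist] := ns_word_dp ns'.
have nJ : J <> J' by move=> eJ; case/eqP: ne; apply/val_inj; rewrite /= eJ.
have [lt|lt|/nJ//] := ltgtP (J : seqlexi nat) (J' : seqlexi nat).
  left; apply: t_step; split; rewrite ?dist ?dist' //; first by move=> [].
  by apply: Or31.
right; apply: t_step; split; rewrite ?dist ?dist' //; first by move=> [/esym].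
by apply: Or31.
Qed.

Lemma eigenvector_form (I : seq nat) (q : nat) (x : chain) :
  eigenspace_of I x -> has_dim q x -> x <> 0 ->
  exists! t : rat * seq nat * {malg rat[ns_dpart]},
    let: (c, J, l) := t in
    nonsingular_dp (I, J) /\
    exists2 y : chain, triangular_form (I, J) l y & x = c *: y.
Proof.
case/eigenspace_ofP => d hd ex; rewrite ex => /et_comb_dim dq x0.
have d0 : d != 0 by apply/eqP => d0; apply: x0; rewrite d0 linear0.
have [p pd hp] := max_rk d0; have [cc ecc [cp sc]] := et_tau_comb d.
have pI := hd p pd.
have {}cp : cc@_p = d@_p by apply: cp => r /hp h /precP[/leq_trans/(_ h)]; rewrite ltnn.
have {}sc r : r \in msupp cc -> r != p -> prec (val r) (val p).
  have sd s : s \in msupp d -> s != p -> prec (val s) (val p).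
    move=> sd; case/prec_same_partition; rewrite ?hd ?dq // => /precP[].
    by rewrite ltnNge hp.
  move=> /sc[/sd//|[s /sd h rs] _]; have [<-//|/h] := eqVneq s p.
  exact: prec_trans.
have c0 : d@_p != 0 by rewrite mcoeff_neq0.
pose l := (d@_p)^-1 *: cc - << p >>.
have hl r : r \in msupp l -> prec (val r) (val p).
  rewrite -mcoeff_neq0 mcoeffB mcoeffZ mcoeffU; have [<-|ne] := eqVneq p r.
    by rewrite cp mulVf // subrr eqxx.
  rewrite subr0 mulf_eq0 negb_or mcoeff_neq0 => /andP[_ /sc]; apply; by rewrite eq_sym.
have eJ : (I, (val p).2) = val p by rewrite -pI -surjective_pairing.
have el : cc = d@_p *: (<< p >> + l).
  by rewrite /l addrCA subrr addr0 scalerA divff // scale1r.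
have tauU (r : ns_dpart) : tau_mono (val r) = tau_comb << r >> by rewrite /tau_comb linextU.
exists (d@_p, (val p).2, l); split.
  rewrite eJ; split; first exact: valP.
  exists (tau_mono (val p) + tau_comb l); first by [].
  by rewrite ecc el linearZZ linearD tauU.
move=> [[c' J'] l'] [ns' [y [hl' ey] ey']].
pose p' : ns_dpart := Sub (I, J') ns'.
have vp' : val p' = (I, J') by rewrite SubK.
have c0' : c' != 0 by apply/eqP => c0'; apply: x0; rewrite ey' c0' scale0r.
have e : d@_p *: (<< p >> + l) = c' *: (<< p' >> + l').
  apply: tau_comb_inj; rewrite -el -ecc ey' ey -vp' tauU [in RHS]linearZZ; congr (_ *: _).
  by rewrite linearD.
have hl'' r : r \in msupp l' -> prec (val r) (val p') by rewrite vp'; apply: hl'.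
have [-> pp' ->] := leading_term_unique hl hl'' c0 c0' e.
by rewrite pp' vp'.
Qed.

Lemma eigenspace_dim I : nonsingular1 I -> subspace_dim (eigenspace_of I) (2 ^ alpha1 I).
Proof.
move=> nI; pose L : seq ns_dpart := pmap insub [seq (I, J) | J <- subs (leading_parts I)].
have -> : (2 ^ alpha1 I = size L)%N.
  rewrite size_pmap_sub count_map /alpha1 -size_subs -(count_predT (subs _)).
  by apply/esym/eq_in_count => J; rewrite mem_subs /= /nonsingular_dp /= nI => ->.
have mL (p : ns_dpart) : (p \in L) = ((val p).1 == I).
  rewrite mem_pmap_sub; apply/mapP/eqP => [[J _ ->]//|pI]; exists (val p).2.
    by rewrite mem_subs -pI; have /andP[] := valP p.
  by rewrite -pI -surjective_pairing.
apply: subspace_dim_et => [|x].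
  apply: (pmap_uniq (@insubK _ _ _)); rewrite map_inj_uniq => [|J J' []//].
  by apply/subs_uniq; rewrite leading_partsE // filter_uniq // nonsingular_uniq.
apply: iff_trans (eigenspace_ofP I x) _.
by split=> -[d hd ->]; exists d => // p /hd; rewrite mL => /eqP.
Qed.

Lemma nonsingular_parts_uniq n : uniq (nonsingular_parts n).
Proof. by rewrite filter_uniq // map_inj_uniq ?strict_parts_uniq //; apply: val_inj. Qed.

Lemma ns_dpart_nonsingular (p : ns_dpart) : nonsingular1 (val p).1.
Proof. by have /andP[] := valP p. Qed.

Lemma eigenvector_decomposition (n : nat) (a : rat) (x : chain) :
  has_degree n x -> Gamma1 x = a *: x ->
  exists2 v : seq nat -> chain,
    forall I, I \in nonsingular_parts n -> eigenspace_of I (v I) &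
    x = \sum_(I <- nonsingular_parts n | energy I == a) v I.
Proof.
have [d ->] := et_comb_surj x; rewrite -Gam.unlock => /et_comb_degree dn /et_eigen da.
exists (fun I => et_comb (tw (fun p => ((val p).1 == I)%:R) d)).
  move=> I _; apply/eigenspace_ofP; exists (tw (fun p => ((val p).1 == I)%:R) d) => // p /tw_supp[_].
  by case: ((val p).1 =P I) => [->//|_]; rewrite eqxx.
rewrite -[RHS]linear_sum; congr et_comb; apply/malgP => p; rewrite raddf_sum /=.
have [pd|pd] := boolP (p \in msupp d); last first.
  by rewrite big1 => [|I _]; rewrite ?mcoeff_tw ?(mcoeff_outdom pd) ?mulr0.
rewrite big_mkcond (bigD1_seq (val p).1) ?nonsingular_parts_uniq //=; last first.
  by rewrite mem_nonsingular_parts ns_dpart_nonsingular -(dn p pd) /dp_degree eqxx.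
rewrite (da p pd) eqxx mcoeff_tw eqxx mul1r big1 ?addr0 // => I.
by rewrite eq_sym => /negPf h; case: ifP => // _; rewrite mcoeff_tw h mul0r.
Qed.

Lemma eigenspaces_independent (n : nat) (v : seq nat -> chain) :
  (forall I, I \in nonsingular_parts n -> eigenspace_of I (v I)) ->
  \sum_(I <- nonsingular_parts n) v I = 0 ->
  forall I, I \in nonsingular_parts n -> v I = 0.
Proof.
move=> hv; have ex I : exists d, I \in nonsingular_parts n ->
    (forall p, p \in msupp d -> (val p).1 = I) /\ v I = et_comb d.
  have [/hv/eigenspace_ofP[d hd e]|_] := boolP (I \in nonsingular_parts n); first by exists d.
  by exists 0.
pose g I := proj1_sig (constructive_indefinite_description _ (ex I)).
have gP I : I \in nonsingular_parts n ->
    (forall p, p \in msupp (g I) -> (val p).1 = I) /\ v I = et_comb (g I).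
  by rewrite /g; case: constructive_indefinite_description.
rewrite big_seq (eq_bigr (fun I => et_comb (g I))) => [|I /gP[]//].
rewrite -linear_sum -big_seq => /et_comb_eq0 s0 I In; have [hI ->] := gP I In.
suff -> : g I = 0 by rewrite linear0.
apply/malgP => p; rewrite mcoeff0; have [/hI pI|/mcoeff_outdom//] := boolP (p \in msupp (g I)).
move/malgP/(_ p): s0; rewrite raddf_sum /= mcoeff0 (bigD1_seq I) ?nonsingular_parts_uniq //=.
rewrite big_seq_cond big1 ?addr0 // => K /andP[/gP[hK _] KI].
by apply: mcoeff_outdom; apply/negP => /hK e; case/eqP: KI; rewrite -e.
Qed.

Lemma spectrumP (a : rat) : (exists2 x : chain, x <> 0 & Gamma1 x = a *: x) <->
  (exists2 I : seq nat, nonsingular1 I & a = energy I).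
Proof.
split=> [[x x0]|[I nI ->]].
  have [d ex] := et_comb_surj x; rewrite ex -Gam.unlock => /et_eigen da.
  have d0 : d != 0 by apply/eqP => d0; apply: x0; rewrite ex d0 linear0.
  have [p pd _] := max_rk d0; exists (val p).1; first exact: ns_dpart_nonsingular.
  by rewrite (da p pd).
pose p : ns_dpart := Sub (I, [::]) (nonsingular_dp_nil nI).
exists (et p); last by rewrite -Gam.unlock Gam_et.
rewrite -[et p](linextU et) => /et_comb_eq0 /eqP; exact/negP/malgU_neq0.
Qed.

Lemma finite_multiplicity (a : rat) : a <> 0 ->
  exists m : nat, subspace_dim (fun x => Gamma1 x = a *: x) m.
Proof.
move=> /eqP a0; have [N hN] : exists N, 6 * a <= N%:R.
  exists (Num.bound `|6 * a|); exact: le_trans (ler_norm _) (ltW (archi_boundP (normr_ge0 _))).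
(* The degree is at most (N + 1) N: the parts are distinct and at most N. *)
pose L := [seq p <- undup (flatten [seq ns_list n | n <- iota 0 (N.+1 * N).+1]) | energy (val p).1 == a].
exists (size L); apply: subspace_dim_et => [|x]; first by rewrite filter_uniq ?undup_uniq.
have [d ->] := et_comb_surj x.
have mL (p : ns_dpart) : (p \in L) = (energy (val p).1 == a).
  rewrite mem_filter mem_undup; apply: andb_idr => /eqP pa.
  apply/flatten_mapP; exists (dp_degree (val p)); last by rewrite mem_ns_list.
  rewrite mem_iota add0n ltnS /=; apply: sumn_le_energy; rewrite ?pa //.
  exact: ns_dpart_nonsingular.
rewrite -Gam.unlock; apply: iff_trans (et_eigen a d) _; split=> [h|[d' hd' /et_comb_inj ->] p].
  by exists d => // p; rewrite mL => /h ->.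
by move=> /hd'; rewrite mL => /eqP.
Qed.

Definition main_dpart r q (r12 : (r == 1%N) || (r == 2)%N) : ns_dpart :=
  Sub (main_part r q, [::]) (nonsingular_dp_nil (main_nonsingular q r12)).

Lemma main_dpart_eq r q (r12 : (r == 1%N) || (r == 2)%N) (p : ns_dpart) :
  (val p).1 = main_part r q -> p = main_dpart q r12.
Proof.
move=> e; apply/val_inj; have := valP p; rewrite /main_dpart SubK.
case: (val p) e => [I J] /= ->; rewrite /nonsingular_dp /= leading_main // subseq0.
by case/andP=> _ /eqP ->.
Qed.

(** A main partition has no leading parts, so it carries a single pair, and lower pairs have
    positive energy. The difference of two candidates, an eigenvector for 0 composed of lower terms,
    is therefore zero. *)
Lemma etilde_main r q (r12 : (r == 1%N) || (r == 2)%N) x :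
  etilde (main_part r q, [::]) x -> x = et (main_dpart q r12).
Proof.
pose p := main_dpart q r12; have vp : val p = (main_part r q, [::]) by rewrite SubK.
rewrite -vp => -[gx [l [hl ex]]]; apply/eqP; rewrite -subr_eq0.
have [_ [m [hm em]]] := etP p.
have dD : down_closed (fun s => prec s (val p)) by move=> s t sp ts; apply: prec_trans sp.
have low : spanned (fun s => prec s (val p)) (x - et p).
  rewrite ex em opprD addrACA subrr add0r.
  by apply: spannedD; [exists l|apply: spannedN; exists m].
have [d hd e] := spanned_et dD low; rewrite e.
have : Gam (et_comb d) = 0 *: et_comb d.
  rewrite -e GamB Gam_et scale0r Gam.unlock gx vp /= energy_main // !scale0r.
  by rewrite subr0.
move=> /et_eigen hE; suff -> : d = 0 by rewrite linear0.
apply/malgP => s; rewrite mcoeff0; have [sd|/mcoeff_outdom//] := boolP (s \in msupp d).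
have sp := hd s sd; have [es|/eqP ne] := eqVneq (val s).1 (val p).1; last first.
  by have := prec_energy sp ne; rewrite (hE s sd) vp energy_main // ltxx.
move: sp; rewrite (_ : s = p) => [/precP[]|]; first by rewrite ltnn.
by apply: main_dpart_eq; rewrite es vp.
Qed.

Lemma et_comb_pair (p1 p2 : ns_dpart) d : (forall p, p \in msupp d -> p = p1 \/ p = p2) ->
  exists a b : rat, et_comb d = a *: et p1 + b *: et p2.
Proof.
move=> hd; have etU (p : ns_dpart) : et p = et_comb << p >> by rewrite /et_comb linextU.
(* The two main pairs coincide for q = 0; the coefficient must then be counted once. *)
pose b := if p1 == p2 then 0 else d@_p2; exists d@_p1, b.
suff ed : d = d@_p1 *: << p1 >> + b *: << p2 >>.
  by rewrite {1}ed linearD /= !linearZZ /= !etU.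
apply/malgP => p; rewrite mcoeffD !mcoeffZ !mcoeffU /b.
have [/hd[->|->]|pd] := boolP (p \in msupp d).
- by rewrite eqxx mulr1 [p2 == _]eq_sym; case: eqP; rewrite ?mul0r ?mulr0 addr0.
- by rewrite eqxx mulr1; case: eqP => [->|_]; rewrite ?mulr0 ?mulr1 ?addr0 ?add0r.
rewrite (mcoeff_outdom pd); case: (p1 =P p) => [e|_].
  by rewrite e (mcoeff_outdom pd) mul0r add0r [p == _]eq_sym; case: eqP; rewrite ?mul0r ?mulr0.
rewrite mulr0 add0r; case: (p2 =P p) => [->|_]; last by rewrite mulr0.
by rewrite (mcoeff_outdom pd) if_same mul0r.
Qed.

Lemma harmonicP (q : nat) (x1 x2 : chain) :
  etilde (main_part 1 q, [::]) x1 -> etilde (main_part 2 q, [::]) x2 ->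
  forall x : chain, (has_dim q x /\ Gamma1 x = 0) <-> exists a b : rat, x = a *: x1 + b *: x2.
Proof.
have r1 : (1 == 1%N) || (1 == 2)%N by []; have r2 : (2 == 1)%N || (2 == 2)%N by [].
move=> /(etilde_main r1) -> /(etilde_main r2) -> x.
set p1 := main_dpart q r1; set p2 := main_dpart q r2.
split=> [[]|[a [b ->]]].
  have [d ->] := et_comb_surj x; rewrite -Gam.unlock => /et_comb_dim dq.
  rewrite -(scale0r (et_comb d)) => /et_eigen dE.
  apply: et_comb_pair => p pd.
  have [r r12 e] := energy_eq0 (ns_dpart_nonsingular p) (dE p pd).
  have {e} ep := main_dpart_eq r12 e.
  have sq : size (val p).1 = q by have := dq p pd; rewrite ep /dp_dim SubK /= addn0.
  rewrite sq in ep.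
  by case/orP: (r12) => /eqP r'; [left|right]; rewrite ep; apply/val_inj; rewrite !SubK r'.
have dimE r (r12 : (r == 1%N) || (r == 2)%N) : dp_dim (val (main_dpart q r12)) = q.
  by rewrite /dp_dim SubK /= size_map size_iota addn0.
split.
  apply/has_dimP/spannedD; apply/spannedZ/(et_spanned (D := fun p => dp_dim p = q));
    rewrite ?dimE //; exact: down_dim.
rewrite -Gam.unlock GamD !GamZ !Gam_et !SubK /= !energy_main // !scale0r !scaler0 addr0 //.
Qed.

Theorem theorem5p1 :
  (* (1) *)
  ((forall x : chain, exists! c : {malg rat[ns_dpart]}, x = tau_comb c) /\
   (forall p : ns_dpart, exists l : {malg rat[ns_dpart]},
      (forall p' : ns_dpart, p' \in msupp l -> prec (val p') (val p)) /\
      Gamma1 (tau_mono (val p)) =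
        energy (val p).1 *: tau_mono (val p) + tau_comb l)) /\
  (* (2) *)
  ((forall p : ns_dpart, exists x : chain, etilde (val p) x) /\
   (forall (I : seq nat) (q : nat) (x : chain),
      nonsingular1 I -> eigenspace_of I x -> has_dim q x -> x <> 0 ->
      exists! t : rat * seq nat * {malg rat[ns_dpart]},
        let: (c, J, l) := t in
        nonsingular_dp (I, J) /\
        exists2 y : chain, triangular_form (I, J) l y & x = c *: y)) /\
  (* (3) *)
  ((forall I : seq nat, nonsingular1 I ->
      subspace_dim (eigenspace_of I) (2 ^ alpha1 I)) /\
   (forall (n : nat) (a : rat) (x : chain),
      has_degree n x -> Gamma1 x = a *: x ->
      exists2 v : seq nat -> chain,
        forall I, I \in nonsingular_parts n -> eigenspace_of I (v I) &
        x = \sum_(I <- nonsingular_parts n | energy I == a) v I) /\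
   (forall (n : nat) (v : seq nat -> chain),
      (forall I, I \in nonsingular_parts n -> eigenspace_of I (v I)) ->
      \sum_(I <- nonsingular_parts n) v I = 0 ->
      forall I, I \in nonsingular_parts n -> v I = 0) /\
   (forall a : rat,
      (exists2 x : chain, x <> 0 & Gamma1 x = a *: x) <->
      (exists2 I : seq nat, nonsingular1 I & a = energy I))) /\
  (* (4) *)
  (forall a : rat, a <> 0 ->
     exists m : nat, subspace_dim (fun x => Gamma1 x = a *: x) m) /\
  (* (5) *)
  (forall (q : nat) (x1 x2 : chain),
     etilde (main_part 1 q, [::]) x1 -> etilde (main_part 2 q, [::]) x2 ->
     forall x : chain,
       (has_dim q x /\ Gamma1 x = 0) <->
       exists a b : rat, x = a *: x1 + b *: x2).
Proof.
split; first by split; [exact: tau_comb_exists_unique|exact: Gamma1_triangular].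
split; first by split; [exact: etilde_ex|move=> I q x _; exact: eigenvector_form].
split.
  split; first exact: eigenspace_dim.
  split; first exact: eigenvector_decomposition.
  by split; [exact: eigenspaces_independent|exact: spectrumP].
by split; [exact: finite_multiplicity|exact: harmonicP].
Qed.
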